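(* Let $p>3$ be a prime and let $D_{2p}=\langle r,s: r^{2p}=s^2=(rs)^2=1\rangle$ be the dihedral group of order $4p$. Let $X$ be a smooth projective complex curve of genus $\ge2$ with an action of $D_{2p}$ (so $D_{2p}\subset\mathrm{Aut}(X)$), and let $Y=X/D_{2p}$. Put $D_p=\langle s,r^2\rangle$, $\tilde D_p=\langle r^ps,r^2\rangle$, $D_2=\{1,s,r^p,r^ps\}$, and $X_M=X/M$ for a subgroup $M$. Then $$JX\sim JY\times B_2\times B_3\times B_4\times B_5^2\times B_6^2$$ with $$B_2\sim P(X_{\langle r\rangle}/Y),\quad B_3\sim P(X_{D_p}/Y),\quad B_4\sim P(X_{\tilde D_p}/Y),\quad B_6\sim P(X_{D_2}/Y),$$ $$B_5\sim\bigl(P(X_{\langle s\rangle}/X_{D_p})\cap P(X_{\langle s\rangle}/X_{D_2})\bigr)^{0}\subset JX_{\langle s\rangle}.$$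
   Context: $\sim$ means ''isogenous to''; $(\cdot)^0$ is the connected component containing $0$. For a finite morphism $f:X'\to Y'$ of smooth projective curves, $P(X'/Y'):=\ker(\mathrm{Nm} f:JX'\to JY')^{\circ}$. The irreducible $\mathbb{Q}$-representations of $D_{2p}$ are the four one-dimensional ones: $W_1$ trivial, $W_2$ ($r\mapsto1$, $s\mapsto-1$), $W_3$ ($r\mapsto-1$, $s\mapsto1$), $W_4$ ($r\mapsto-1$, $s\mapsto-1$), together with $W_5,W_6$ whose complexifications are $\bigoplus_{i=1}^{(p-1)/2}V_{2i-1}$ and $\bigoplus_{i=1}^{(p-1)/2}V_{2i}$ respectively, where for $k=1,\dots,p-1$, with $\omega$ a primitive $2p$-th root of unity, $V_k$ is the two-dimensional complex representation with $r\mapsto\mathrm{diag}(\omega^k,\omega^{-k})$ and $s\mapsto\begin{pmatrix}0&1\\1&0\end{pmatrix}$. For a finite group $G\subset\mathrm{Aut}(X)$ let $\rho:\mathbb{Q}[G]\to\mathrm{End}_{\mathbb{Q}}(JX)$ be the induced homomorphism. For each irreducible $\mathbb{Q}$-representation $W_i$ with $D_i=\mathrm{End}_G(W_i)$, let $Q_i\simeq\mathrm{End}_{D_i}(W_i)$ be the corresponding simple factor of $\mathbb{Q}[G]$ and $e$ a primitive idempotent of $Q_i$. Then $B_i:=\mathrm{Im}(\rho(me))\subset JX$ for any positive integer $m$ with $me\in\mathbb{Z}[G]$; its isogeny class does not depend on $e$. *)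

(* Defs.v *)
From HB Require Import structures.
From mathcomp Require Import all_boot all_order all_algebra all_fingroup.
From mathcomp Require Import all_character complex.
From mathcomp Require Import all_classical all_reals all_analysis.

Set Implicit Arguments.
Unset Strict Implicit.
Unset Printing Implicit Defensive.

Import Order.TTheory GRing.Theory Num.Theory numFieldNormedType.Exports.

Local Open Scope classical_set_scope.
Local Open Scope ring_scope.

(* The complex numbers are R[i], written R[i]^o where their topology is used.
   Smooth projective complex curves are encoded as compact connected Riemann
   surfaces.  [chart_param i] matters only on the open set
   [chart_coord i @` chart_dom i], where it is the inverse of [chart_coord i]. *)
Record curve (R : realType) := Curve {
  curve_space :> topologicalType;
  chart : Type;
  chart_dom : chart -> set curve_space;
  chart_coord : chart -> curve_space -> R[i]^o;
  chart_param : chart -> R[i]^o -> curve_space;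
  dom_open : forall i, open (chart_dom i);
  dom_cover : forall x, exists i, chart_dom i x;
  codom_open : forall i, open (chart_coord i @` chart_dom i);
  coordK : forall i x, chart_dom i x -> chart_param i (chart_coord i x) = x;
  coord_continuous : forall i x, chart_dom i x ->
    {for x, continuous (chart_coord i)};
  param_continuous : forall i x, chart_dom i x ->
    {for chart_coord i x, continuous (chart_param i)};
  transition_holomorphic : forall i j x, chart_dom i x -> chart_dom j x ->
    derivable (chart_coord j \o chart_param i) (chart_coord i x) 1;
  curve_nonempty : [set: curve_space] !=set0;
  curve_hausdorff : hausdorff_space curve_space;
  curve_compact : compact [set: curve_space];
  curve_connected : connected [set: curve_space]
}.
Arguments chart_dom {R c}.
Arguments chart_coord {R c}.
Arguments chart_param {R c}.

Definition holomorphic_map (R : realType) (X Y : curve R) (f : X -> Y) : Prop :=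
  continuous f /\
  forall (i : chart X) (j : chart Y) (x : X),
    chart_dom i x -> chart_dom j (f x) ->
    derivable (chart_coord j \o f \o chart_param i) (chart_coord i x) 1.

(* A family [w] stands for the 1-form equal to [w i x * d(chart_coord i)] on
   [chart_dom i]; [w i] is extended by 0 so that equal forms are equal
   families. *)
Definition is_holomorphic_form (R : realType) (X : curve R)
    (w : chart X -> X -> R[i]^o) : Prop :=
  [/\ forall i x, ~ chart_dom i x -> w i x = 0,
      forall i x, chart_dom i x ->
        derivable (w i \o chart_param i) (chart_coord i x) 1
    & forall i j x, chart_dom i x -> chart_dom j x ->
        w i x =
          w j x * 'D_1 (chart_coord j \o chart_param i) (chart_coord i x)].

Definition holomorphic_form_pred (R : realType) (X : curve R)
    : {pred chart X -> X -> R[i]^o} :=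
  [pred w | `[< is_holomorphic_form w >]].
Arguments holomorphic_form_pred {R} X.

Lemma holomorphic_form_submod_closed (R : realType) (X : curve R) :
  submod_closed (holomorphic_form_pred X).
Proof.
have cE (a : R[i]) (w v : chart X -> X -> R[i]^o) i x :
  (a *: w + v) i x = a * w i x + v i x by [].
split=> [|a u v].
  apply/asboolP; split=> // [i x _|i j x _ _].
  - exact: derivable_cst.
  - by rewrite mul0r.
move=> /asboolP[u0 u1 u2] /asboolP[v0 v1 v2]; apply/asboolP; split.
- by move=> i x nx; rewrite cE u0// v0// mulr0 addr0.
- move=> i x ix.
  have -> : (a *: u + v) i \o chart_param i =
      a *: (u i \o chart_param i) + (v i \o chart_param i).
    by apply/funext => z; rewrite /= cE.
  by apply: derivableD; [apply: derivableZ; exact: u1|exact: v1].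
- by move=> i j x ix jx; rewrite !cE (u2 i j)// (v2 i j)// mulrDl mulrA.
Qed.

HB.instance Definition _ (R : realType) (X : curve R) :=
  GRing.isSubmodClosed.Build R[i] (chart X -> X -> R[i]^o)
    (holomorphic_form_pred X) (@holomorphic_form_submod_closed R X).

(* The space H^0(X, Omega) of holomorphic 1-forms. *)
Record holo_form (R : realType) (X : curve R) := Form {
  form_coef :> chart X -> X -> R[i]^o;
  form_coefP : form_coef \in holomorphic_form_pred X
}.

HB.instance Definition _ (R : realType) (X : curve R) :=
  [isSub for @form_coef R X].
HB.instance Definition _ (R : realType) (X : curve R) :=
  [Choice of holo_form X by <:].
HB.instance Definition _ (R : realType) (X : curve R) :=
  [SubChoice_isSubLmodule of holo_form X by <:].

Definition has_genus (R : realType) (X : curve R) (g : nat) : Prop :=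
  exists b : 'I_g -> holo_form X,
    forall w, exists! c : 'I_g -> R[i], w = \sum_i c i *: b i.

Definition is_pullback (R : realType) (X Y : curve R) (f : X -> Y)
    (w : holo_form Y) (w' : holo_form X) : Prop :=
  forall (i : chart X) (j : chart Y) (x : X),
    chart_dom i x -> chart_dom j (f x) ->
    w' i x =
      w j (f x) * 'D_1 (chart_coord j \o f \o chart_param i) (chart_coord i x).

(* For a holomorphic [f] exactly one form satisfies [is_pullback f w]. *)
Definition pullback (R : realType) (X Y : curve R) (f : X -> Y)
    (w : holo_form Y) : holo_form X :=
  xget 0 [set w' | is_pullback f w w'].

(* [z] is the integral of [w] along the continuous path [g] on [0, 1]: [F] is
   a primitive of [w] along [g], i.e. near each [t] it is a local primitive
   [G] of [w], read in a chart, composed with [g]. *)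
Definition path_integral (R : realType) (X : curve R) (w : holo_form X)
    (g : R -> X) (z : R[i]) : Prop :=
  exists2 F : R -> R[i],
    forall t : R, `[0, 1]%classic t ->
      exists (i : chart X) (G : R[i]^o -> R[i]^o),
      [/\ chart_dom i (g t),
          \forall u \near chart_coord i (g t),
            is_derive (u : R[i]^o) (1 : R[i]^o) G (w i (chart_param i u))
        & \forall u \near t, `[0, 1]%classic u -> F u = G (chart_coord i (g u))]
    & z = F 1 - F 0.

(* H^0(X, Omega)^*, as a subset of all maps from forms to numbers. *)
Definition dual_forms (R : realType) (X : curve R)
    : set (holo_form X -> R[i]^o) :=
  [set l | forall (a : R[i]) (u v : holo_form X),
    l (a *: u + v) = a * l u + l v].
Arguments dual_forms {R} X.

(* The image of H_1(X, Z) in H^0(X, Omega)^*: every class is carried by a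
   single loop because X is connected. *)
Definition periods (R : realType) (X : curve R)
    : set (holo_form X -> R[i]^o) :=
  [set l | exists g : R -> X,
    [/\ {within `[0, 1], continuous g}, g 0 = g 1
      & forall w, path_integral w g (l w)]].
Arguments periods {R} X.

(* A complex torus V / L, with V a complex subspace of some ambient space and
   L a subgroup of V.  That L is a lattice in V is not recorded; it is a
   theorem for the tori considered here. *)
Record torus (R : realType) := Torus {
  torus_ambient : lmodType R[i];
  torus_cover : set torus_ambient;
  torus_lattice : set torus_ambient
}.
Arguments Torus {R torus_ambient}.
Arguments torus_cover {R}.
Arguments torus_lattice {R}.

Definition prod_torus (R : realType) (A B : torus R) : torus R :=
  @Torus R (torus_ambient A * torus_ambient B)%type
    (torus_cover A `*` torus_cover B) (torus_lattice A `*` torus_lattice B).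

(* Homomorphisms of complex tori are given by their analytic representation. *)
Definition torus_hom (R : realType) (A B : torus R)
    (F : torus_ambient A -> torus_ambient B) : Prop :=
  [/\ forall v, torus_cover A v -> torus_cover B (F v),
      forall (a : R[i]) (u v : torus_ambient A),
        torus_cover A u -> torus_cover A v ->
        F (a *: u + v) = a *: F u + F v
    & forall v, torus_lattice A v -> torus_lattice B (F v)].

Definition torus_surjective (R : realType) (A B : torus R)
    (F : torus_ambient A -> torus_ambient B) : Prop :=
  forall w, torus_cover B w ->
    exists2 v, torus_cover A v & torus_lattice B (w - F v).

Definition torus_finite_kernel (R : realType) (A B : torus R)
    (F : torus_ambient A -> torus_ambient B) : Prop :=
  exists k : seq (torus_ambient A),
    forall v, torus_cover A v -> torus_lattice B (F v) ->
      exists2 u, u \in k & torus_lattice A (v - u).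

Definition isogenous (R : realType) (A B : torus R) : Prop :=
  exists F : torus_ambient A -> torus_ambient B,
    [/\ torus_hom F, torus_surjective F & torus_finite_kernel F].

Definition jacobian_variety (R : realType) (X : curve R) : torus R :=
  Torus (dual_forms X) (periods X).

(* The image in JX of a complex subspace V of H^0(X, Omega)^*. *)
Definition subtorus (R : realType) (X : curve R)
    (V : set (holo_form X -> R[i]^o)) : torus R :=
  Torus V (V `&` periods X).
Arguments subtorus {R} X V.

(* The preimage in H^0(X, Omega)^* of the set of points of [subtorus X V]. *)
Definition preimage_points (R : realType) (X : curve R)
    (V : set (holo_form X -> R[i]^o)) : set (holo_form X -> R[i]^o) :=
  [set l | exists2 v, V v & periods X (l - v)].
Arguments preimage_points {R} X V.

(* For [K] the preimage of a closed subgroup H of JX under the covering map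
   H^0(X, Omega)^* -> JX, the component of 0 in [K] maps onto the component H^0
   of 0 in H and is its universal cover.  On the finite-dimensional space
   H^0(X, Omega)^* the usual topology is that of pointwise convergence. *)
Definition component0 (R : realType) (X : curve R)
    (K : set (holo_form X -> R[i]^o)) : set (holo_form X -> R[i]^o) :=
  connected_component (K : set {ptws holo_form X -> R[i]^o}) (fun=> 0).
Arguments component0 {R} X K.

(* Nm f : JX -> JY sends the class of a divisor sum_k n_k x_k to that of
   sum_k n_k f(x_k); under the Abel-Jacobi isomorphism it is induced by the
   transpose of the pullback of forms. *)
Definition norm_map (R : realType) (X Y : curve R) (f : X -> Y)
    (l : holo_form X -> R[i]^o) : holo_form Y -> R[i]^o :=
  fun w => l (pullback f w).

Definition prym_cover (R : realType) (X Y : curve R) (f : X -> Y)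
    : set (holo_form X -> R[i]^o) :=
  component0 X [set l | dual_forms X l /\ periods Y (norm_map f l)].

Definition prym (R : realType) (X Y : curve R) (f : X -> Y) : torus R :=
  subtorus X (prym_cover f).

(* (P(X/Y) `&` P(X/Z))^0 inside JX. *)
Definition prym_inter (R : realType) (X Y Z : curve R) (f : X -> Y)
    (h : X -> Z) : torus R :=
  subtorus X (component0 X (preimage_points X (prym_cover f) `&`
                            preimage_points X (prym_cover h))).

(* A faithful left action by automorphisms: D is a subgroup of Aut(X). *)
Definition faithful_action (R : realType) (D : finGroupType) (X : curve R)
    (a : D -> X -> X) : Prop :=
  [/\ forall x, a 1%g x = x,
      forall g h x, a (g * h)%g x = a g (a h x),
      forall g, holomorphic_map (a g)
    & forall g, (forall x, a g x = x) -> g = 1%g].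

Definition is_quotient (R : realType) (D : finGroupType) (X Z : curve R)
    (a : D -> X -> X) (M : {group D}) (q : X -> Z) : Prop :=
  [/\ holomorphic_map q,
      forall z, exists x, q x = z
    & forall x y, q x = q y <-> exists2 g, g \in M & y = a g x].

(* The image of rho(c) : JX -> JX, for c = sum_g c(g) g in Z[D]. *)
Definition group_image (R : realType) (D : finGroupType) (X : curve R)
    (a : D -> X -> X) (c : D -> int) : torus R :=
  subtorus X
    ((fun l => \sum_g (c g)%:~R *: norm_map (a g) l) @` dual_forms X).

(* Q[D] is MathComp's [group_ring], spanned by the matrices of the regular
   representation.  The simple factor attached to an irreducible W consists of
   the elements acting as 0 on every other irreducible representation. *)
Definition simple_factor (D : finGroupType) (n : nat)
    (W : mx_representation rat [set: D]%G n) (e : 'M[rat]_#|[set: D]%G|)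
    : Prop :=
  (e \in group_ring rat [set: D]%G)%MS /\
  forall (k : nat) (U : mx_representation rat [set: D]%G k),
    mx_irreducible U -> ~ mx_rsim U W -> gring_op U e = 0.

Definition primitive_idempotent (D : finGroupType) (n : nat)
    (W : mx_representation rat [set: D]%G n) (e : 'M[rat]_#|[set: D]%G|)
    : Prop :=
  [/\ simple_factor W e, e *m e = e, e != 0
    & forall e1 e2, simple_factor W e1 -> simple_factor W e2 ->
        e1 *m e1 = e1 -> e2 *m e2 = e2 -> e1 *m e2 = 0 -> e2 *m e1 = 0 ->
        e = e1 + e2 -> e1 = 0 \/ e2 = 0].

(* [gring_row e] lists the coefficients of [e] on the group elements. *)
Definition integral_multiple (D : finGroupType) (e : 'M[rat]_#|[set: D]%G|)
    (m : nat) (c : D -> int) : Prop :=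
  (0 < m)%N /\
  forall g, (c g)%:~R =
    m%:R * gring_row e 0 (gring_index [set: D]%G g) :> rat.

Definition dihedral_presentation (D : finGroupType) (n : nat) (r s : D)
    : Prop :=
  [/\ <<[set r; s]%SET>>%g = [set: D]%SET, #|D| = (2 * n)%N, (r ^+ n = 1)%g,
      (s ^+ 2 = 1)%g & ((r * s) ^+ 2 = 1)%g].

(* The representation V_k, w being a primitive root of unity. *)
Definition is_V (R : realType) (D : finGroupType) (r s : D) (w : R[i])
    (k : nat) (V : mx_representation R[i] [set: D]%G 2) : Prop :=
  V r = \matrix_(i, j) (if i != j then 0 else if i == 0 then w ^+ k else w ^- k)
  /\ V s = \matrix_(i, j) (i != j)%:R.

(* W is irreducible over Q and its complexification is the direct sum of the
   V_(k i) for i = 1, ..., m. *)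
Definition is_rational_form (R : realType) (D : finGroupType) (r s : D)
    (w : R[i]) (m : nat) (k : nat -> nat) (n : nat)
    (W : mx_representation rat [set: D]%G n) : Prop :=
  mx_irreducible W /\
  exists2 V : nat -> mx_representation R[i] [set: D]%G 2,
    forall i, (1 <= i <= m)%N -> is_V r s w (k i) (V i)
  & mx_rsim (map_repr (ratr : {rmorphism rat -> R[i]}) W)
      (\big[@dadd_grepr _ _ _ / @grepr0 _ _ _]_(1 <= i < m.+1)
         Representation (V i)).

(* Main.v *)
(* Tori are quotients of spaces of dual forms, and two lattice-preserving linear
   maps which are inverse to each other up to a positive integer give an isogeny,
   because the periods of a compact curve are finitely generated.  The rational
   group ring acts on dual forms, so a decomposition of 1 into orthogonal
   idempotents splits JX up to isogeny, and idempotents e = y x and f = x y give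
   isogenous tori.

   The averages n, h, t over <r^2>, <r^p>, <s> are commuting idempotents, so 1 is
   the sum of the eight products of one of n, 1 - n, one of h, 1 - h and one of
   t, 1 - t.  The four products with n are the idempotents of W1, ..., W4.  For
   the others, r - r^-1 exchanges t and 1 - t; and an element of f Q[D] f is a
   multiple of f by a central polynomial in r, invertible as soon as it does not
   act by 0 on W5 (resp. W6), by Schur's lemma.  Hence the primitive idempotents
   of W5 and W6 are conjugate to (1 - n)(1 - h) t and (1 - n) h t.

   All these products are combinations of averages over subgroups.  For M <= N
   the norm of X -> X/M maps the image of avg M - avg N to the kernel of the norm
   of X/M -> X/N, and the transpose of the trace of forms is an inverse up to
   |M|.  The trace exists because a primitive of an M-invariant form descends to
   X/M, holomorphically since it is continuous and branch points are isolated.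
   Finally the component of 0 in the preimage of the kernel of a norm map is a
   linear subspace: on it a norm takes countably many values, hence vanishes. *)

Require Import Defs.
From mathcomp Require Import all_boot all_order all_algebra all_fingroup.
From mathcomp Require Import all_solvable all_character complex.
From mathcomp Require Import all_classical all_reals all_analysis.
From mathcomp Require Import ring lra zify.

Set Implicit Arguments.
Unset Strict Implicit.
Unset Printing Implicit Defensive.

Import Order.TTheory GRing.Theory Num.Theory.

(** Forms are handled through their local primitives: equality, pullback and descent of forms become
    statements about functions up to a constant, and [glue_form] turns compatible functions back
    into a form. Its coefficients must be holomorphic again, and descent has to cross branch points;
    this dictates how far Cauchy's theory is developed. Of a path only its ends and its functional
    on forms are kept ([joined]). A property that is additive along paths is verified on coordinate
    discs ([joined_ind]); linearity of periods, lifting along a quotient map and finite generation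
    all follow this pattern. The relation [isogenous] has a direction and asks for a finite kernel,
    which is awkward under composition and products. The work is done with [qisog], which carries a
    quasi-inverse, and is converted into [isogenous] once, at the end. In the group ring, an
    identity is tested on all irreducible representations ([ring_eq0]); on [W5] and [W6] a
    polynomial in [r] is tested by its values at the eigenvalues of [r]. *)

Module Decomposition.
Import numFieldNormedType.Exports.
Local Open Scope classical_set_scope.
Local Open Scope ring_scope.
Local Open Scope complex_scope.
Local Notation nc := Normc.normc.

(** * Complex differentiability *)

Section ComplexBasics.
Variable R : realType.
Implicit Types (z w : R[i]) (e d t : R).

Lemma nc_norm z : `|z| = (nc z)%:C.
Proof. by case: z. Qed.

Lemma nc_ge0 z : 0 <= nc z.
Proof. by rewrite -ler0c -nc_norm. Qed.

Lemma nc0 : nc (0 : R[i]) = 0. Proof. exact: Normc.normc0. Qed.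
Lemma nc1 : nc (1 : R[i]) = 1. Proof. exact: Normc.normc1. Qed.
Lemma ncM z w : nc (z * w) = nc z * nc w. Proof. exact: Normc.normcM. Qed.
Lemma ncV z : nc z^-1 = (nc z)^-1. Proof. exact: Normc.normcV. Qed.
Lemma ncN z : nc (- z) = nc z.
Proof. by apply: (@complexI R); rewrite -!nc_norm normrN. Qed.
Lemma ncB z w : nc (z - w) = nc (w - z).
Proof. by rewrite -ncN opprB. Qed.
Lemma ncD z w : nc (z + w) <= nc z + nc w.
Proof. by rewrite -lecR rmorphD /= -!nc_norm ler_normD. Qed.
Lemma ncD3 z w w' : nc (z + w + w') <= nc z + nc w + nc w'.
Proof. by apply: le_trans (ncD _ _) _; rewrite lerD2r ncD. Qed.
Lemma ncBD z w : nc z <= nc w + nc (z - w).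
Proof. by rewrite -{1}(subrKC w z) ncD. Qed.
Lemma nc_eq0 z : (nc z == 0) = (z == 0).
Proof. by apply/eqP/eqP => [/Normc.eq0_normc|->] //; rewrite nc0. Qed.
Lemma nc_gt0 z : (0 < nc z) = (z != 0).
Proof. by rewrite lt_def nc_eq0 nc_ge0 andbT. Qed.
Lemma nc_real t : nc t%:C = `|t|.
Proof. by rewrite /= expr0n /= addr0 sqrtr_sqr. Qed.
Lemma ncX z n : nc (z ^+ n) = nc z ^+ n.
Proof. by elim: n => [|n IH]; rewrite ?expr0 ?nc1// !exprS ncM IH. Qed.
Lemma nc_i : nc ('i : R[i]) = 1.
Proof. by rewrite /= expr0n expr1n add0r sqrtr1. Qed.
Lemma ler_Re_nc z : `|complex.Re z| <= nc z.
Proof. by rewrite -lecR -nc_norm normc_ge_Re. Qed.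
Lemma ler_Im_nc z : `|complex.Im z| <= nc z.
Proof.
have := ler_Re_nc (z * 'i); rewrite ncM nc_i mulr1; case: z => a b /=.
by rewrite mulr0 mulr1 sub0r normrN.
Qed.
Lemma nc_le_eq z w : (forall e, 0 < e -> nc (z - w) <= e) -> z = w.
Proof.
move=> h; apply/eqP; rewrite -subr_eq0 -nc_eq0 eq_le nc_ge0 andbT.
by apply/ler_addgt0Pl => e e0; rewrite addr0 h.
Qed.

(** Balls of [R[i]^o] have radii in [R[i]]; a positive element of [R[i]] is real, so real radii
    suffice. *)
Lemma nbhs_ncP (z : R[i]^o) (A : set R[i]^o) :
  nbhs z A <-> exists2 d, 0 < d & forall w, nc (w - z) < d -> A w.
Proof.
split=> [/nbhs_ballP[e /= e0 eA]|[d d0 dA]]; last apply/nbhs_ballP.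
- have re : e = (complex.Re e)%:C.
    by rewrite RRe_real// ger0_real// ltW.
  exists (complex.Re e); first by rewrite -ltcR -re.
  by move=> w wz; apply: eA; rewrite /ball/= distrC nc_norm re ltcR.
exists d%:C => /=; first by rewrite ltcR.
by move=> w; rewrite /ball/= distrC nc_norm ltcR; apply: dA.
Qed.

Lemma nbhs_absP (t : R) (A : set R) :
  nbhs t A <-> exists2 d, 0 < d & forall s, `|s - t| < d -> A s.
Proof.
split=> [/nbhs_ballP|] [d d0 dA]; last apply/nbhs_ballP; exists d => //= s st.
  by apply: dA; rewrite /ball/= distrC.
by apply: dA; rewrite distrC.
Qed.

Lemma cvg_ncP (T : Type) (F : set_system T) (FF : Filter F) (f : T -> R[i]^o)
    (l : R[i]) :
  f x @[x --> F] --> (l : R[i]^o) <->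
  forall e, 0 < e -> \forall x \near F, nc (f x - l) < e.
Proof.
split=> [h e e0|h A /nbhs_ncP[d d0 dA]].
  apply: (h [set w : R[i]^o | nc (w - l) < e]); apply/nbhs_ncP.
  by exists e.
by apply: filterS (h d d0) => x xd; apply: dA.
Qed.

Lemma cvg_nc_atP (T : topologicalType) (x : T) (f : T -> R[i]^o) (l : R[i]) :
  f y @[y --> x] --> (l : R[i]^o) <->
  forall e, 0 < e -> \forall y \near x, nc (f y - l) < e.
Proof. exact: (@cvg_ncP T (nbhs x) _ f l). Qed.

(* An inductive copy of continuity at a point, which unification never unfolds. *)
Variant ccont (T : topologicalType) (x : T) (f : T -> R[i]) : Prop :=
  CCont of (f : T -> R[i]^o) y @[y --> x] --> (f x : R[i]^o).
Lemma ccontE (T : topologicalType) (x : T) (f : T -> R[i]) :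
  ccont x f -> (f : T -> R[i]^o) y @[y --> x] --> (f x : R[i]^o).
Proof. by case. Qed.

Lemma ccontP (f : R[i] -> R[i]) z :
  ccont (z : R[i]^o) f <->
  forall e, 0 < e -> exists2 d, 0 < d &
    forall w, nc (w - z) < d -> nc (f w - f z) < e.
Proof.
split=> [/ccontE/cvg_nc_atP h e e0|h]; first by have /nbhs_ncP := h e e0.
by constructor; apply/cvg_nc_atP => e e0; have [d d0 dh] := h e e0; apply/nbhs_ncP; exists d.
Qed.

Lemma ccont_RP (f : R -> R[i]) t :
  ccont t f <->
  forall e, 0 < e -> exists2 d, 0 < d &
    forall s, `|s - t| < d -> nc (f s - f t) < e.
Proof.
split=> [/ccontE/cvg_nc_atP h e e0|h]; first by have /nbhs_absP := h e e0.
by constructor; apply/cvg_nc_atP => e e0; have [d d0 dh] := h e e0; apply/nbhs_absP; exists d.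
Qed.

Section ccont.
Variables (T : topologicalType) (x : T).
Implicit Types f g : T -> R[i].

Lemma ccont_cst z : ccont x (fun=> z). Proof. by constructor; exact: cvg_cst. Qed.
Lemma ccontD f g : ccont x f -> ccont x g -> ccont x (fun y => f y + g y).
Proof. move=> /ccontE hf /ccontE hg; constructor; exact: (@cvgD R[i] R[i]^o T (nbhs x) _ f g _ _ hf hg). Qed.
Lemma ccontB f g : ccont x f -> ccont x g -> ccont x (fun y => f y - g y).
Proof. move=> /ccontE hf /ccontE hg; constructor; exact: (@cvgB R[i] R[i]^o T (nbhs x) _ f g _ _ hf hg). Qed.
Lemma ccontN f : ccont x f -> ccont x (fun y => - f y).
Proof. move=> /ccontE hf; constructor; exact: (@cvgN R[i] R[i]^o T (nbhs x) _ f _ hf). Qed.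
Lemma ccontM f g : ccont x f -> ccont x g -> ccont x (fun y => f y * g y).
Proof. move=> /ccontE hf /ccontE hg; constructor; exact: (@cvgM R[i] T (nbhs x) _ f g (f x) (g x) hf hg). Qed.
Lemma ccontV f : f x != 0 -> ccont x f -> ccont x (fun y => (f y)^-1).
Proof. move=> f0 /ccontE hf; constructor; exact: (@cvgV R[i] T (nbhs x) _ f (f x) f0 hf). Qed.
Lemma ccont_comp (S : topologicalType) (g : S -> T) (y : S) f :
  {for y, continuous g} -> ccont (g y) f -> ccont y (f \o g).
Proof. move=> hg /ccontE hf; constructor=> A fA; exact: (hg _ (hf A fA)). Qed.
Lemma ccont_compC (f : T -> R[i]) (g : R[i] -> R[i]) :
  ccont x f -> ccont (f x : R[i]^o) g -> ccont x (g \o f).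
Proof.
by move=> /ccontE hf /ccontE hg; constructor=> A gA; exact: (hf _ (hg A gA)).
Qed.
Lemma ccont_near f g : (\forall y \near x, f y = g y) -> ccont x f -> ccont x g.
Proof.
move=> fg /ccontE hf; constructor; rewrite -(nbhs_singleton fg).
apply: cvg_trans hf => A; apply: filterS2 fg.
by move=> y /= ->.
Qed.
End ccont.

Lemma ccont_id z : ccont (z : R[i]^o) id. Proof. by constructor; exact: cvg_id. Qed.

Lemma ccont_real (T : topologicalType) (x : T) (f : T -> R) :
  {for x, continuous f} -> ccont x (fun y => (f y)%:C).
Proof.
move=> hf; constructor; apply/cvg_nc_atP => e e0.
have /cvgrPdist_lt /(_ e e0) := hf.
by apply: filterS => y; rewrite -rmorphB nc_real distrC.
Qed.

(* Caratheodory's form of differentiability. *)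
Definition cder (f : R[i] -> R[i]) z v : Prop :=
  exists k : R[i] -> R[i], [/\ k z = v, ccont (z : R[i]^o) k
    & forall w, f w - f z = k w * (w - z)].

Lemma cderE f z v : cder f z v ->
  forall e, 0 < e -> exists2 d, 0 < d &
    forall w, nc (w - z) < d -> nc (f w - f z - v * (w - z)) <= e * nc (w - z).
Proof.
move=> [k [<- /ccontP kc kE]] e /kc[d d0 dk]; exists d => // w /dk wk.
by rewrite kE -mulrBl ncM ler_wpM2r ?nc_ge0// ltW.
Qed.

Lemma cderI f z v :
  (forall e, 0 < e -> exists2 d, 0 < d &
    forall w, nc (w - z) < d -> nc (f w - f z - v * (w - z)) <= e * nc (w - z))
  -> cder f z v.
Proof.
move=> h; exists (fun w => if w == z then v else (f w - f z) / (w - z)).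
split; first by rewrite eqxx.
  apply/ccontP => e e0; have e20 : 0 < e / 2 by rewrite divr_gt0.
  have [d d0 dk] := h _ e20; exists d => // w wd; rewrite eqxx.
  case: eqP => [_|/eqP wz]; first by rewrite subrr nc0.
  have wz0 : w - z != 0 by rewrite subr_eq0.
  have -> : (f w - f z) / (w - z) - v = (f w - f z - v * (w - z)) / (w - z).
    by field.
  rewrite ncM ncV ltr_pdivrMr ?nc_gt0//; apply: le_lt_trans (dk _ wd) _.
  by rewrite ltr_pM2r ?nc_gt0// ltr_pdivrMr// ltr_pMr// ltr1n.
move=> w; case: eqP => [->|/eqP wz]; first by rewrite !subrr mulr0.
by rewrite divfK// subr_eq0.
Qed.

Lemma cder_cont f z v : cder f z v -> ccont (z : R[i]^o) f.
Proof.
move=> [k [_ kc kE]].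
have -> : f = (fun w => f z + k w * (w - z)).
  by apply/funext => w; rewrite -kE subrKC.
apply: ccontD; first exact: ccont_cst.
by apply: ccontM => //; apply: ccontB; [exact: ccont_id|exact: ccont_cst].
Qed.

Lemma cder_unique f z v v' : cder f z v -> cder f z v' -> v = v'.
Proof.
move=> /cderE h /cderE h'; apply: nc_le_eq => e e0.
have e20 : 0 < e / 2 by rewrite divr_gt0.
have [d d0 dh] := h _ e20; have [d' d'0 dh'] := h' _ e20.
pose m := Num.min d d'.
have m0 : 0 < m by rewrite lt_min d0.
pose w := z + (m / 2)%:C.
have wz : w - z = (m / 2)%:C by rewrite addrC addKr.
have nw : nc (w - z) = m / 2 by rewrite wz nc_real ger0_norm// divr_ge0// ltW.
have wm : nc (w - z) < m by rewrite nw ltr_pdivrMr// ltr_pMr// ltr1n.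
have wd : nc (w - z) < d by apply: lt_le_trans wm _; rewrite ge_min lexx.
have wd' : nc (w - z) < d' by apply: lt_le_trans wm _; rewrite ge_min lexx orbT.
have := dh _ wd; have := dh' _ wd'; set A := _ - v' * _; set B := _ - v * _.
move=> hA hB; have AB : (v - v') * (w - z) = A - B by rewrite /A /B; ring.
have : nc ((v - v') * (w - z)) <= e * nc (w - z).
  rewrite AB; apply: le_trans (ncD _ _) _; rewrite ncN.
  by apply: le_trans (lerD hA hB) _; rewrite -mulrDl -splitr.
by rewrite ncM ler_pM2r// nw divr_gt0.
Qed.

Lemma cder_near f g z v :
  (\forall w \near (z : R[i]^o), f w = g w) -> cder f z v -> cder g z v.
Proof.
move=> fg /cderE h; apply: cderI => e /h[d d0 dh].
have /nbhs_ncP[d' d'0 dg] := fg.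
exists (Num.min d d'); first by rewrite lt_min d0.
move=> w; rewrite lt_min => /andP[wd wd'].
by rewrite -!dg ?subrr ?nc0//; exact: dh.
Qed.

Lemma cder_eqd (d : R) f g z v : 0 < d ->
  (forall w, nc (w - z) < d -> f w = g w) -> cder f z v -> cder g z v.
Proof. by move=> d0 fg; apply: cder_near; apply/nbhs_ncP; exists d. Qed.

Lemma cder_cst c z : cder (fun=> c) z 0.
Proof.
exists (fun=> 0); split => //; first exact: ccont_cst.
by move=> w; rewrite subrr mul0r.
Qed.
Lemma cder_id z : cder id z 1.
Proof.
exists (fun=> 1); split => //; first exact: ccont_cst.
by move=> w; rewrite mul1r.
Qed.
Lemma cderD f g z a b : cder f z a -> cder g z b ->
  cder (fun w => f w + g w) z (a + b).
Proof.
move=> [k [<- kc kE]] [l [<- lc lE]]; exists (fun w => k w + l w).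
by split=> //; [exact: ccontD|move=> w; rewrite mulrDl -kE -lE; ring].
Qed.
Lemma cderN f z a : cder f z a -> cder (fun w => - f w) z (- a).
Proof.
move=> [k [<- kc kE]]; exists (fun w => - k w).
by split=> //; [exact: ccontN|move=> w; rewrite mulNr -kE; ring].
Qed.
Lemma cderB f g z a b : cder f z a -> cder g z b ->
  cder (fun w => f w - g w) z (a - b).
Proof. by move=> hf /cderN; exact: cderD. Qed.
Lemma cderM f g z a b : cder f z a -> cder g z b ->
  cder (fun w => f w * g w) z (a * g z + f z * b).
Proof.
move=> [k [<- kc kE]] gb; have gc := cder_cont gb; move: gb => [l [<- lc lE]].
exists (fun w => k w * g w + f z * l w); split=> //.
  by apply: ccontD; apply: ccontM => //; exact: ccont_cst.
move=> w; rewrite mulrDl -mulrA (mulrC (g w)) mulrA -kE -mulrA -lE; ring.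
Qed.
Lemma cderV f z a : f z != 0 -> cder f z a ->
  cder (fun w => (f w)^-1) z (- a / f z ^+ 2).
Proof.
move=> f0 fa; have fc := cder_cont fa.
have Vc : ccont (z : R[i]^o) (fun w => (f w)^-1) by exact: ccontV.
(* Caratheodory's identity is required at every [w], and it would fail for the totalised inverse
   where [f w = 0]. The modified function agrees with the inverse near [z] and makes the difference
   0 at those points. *)
apply: (@cder_near (fun w => if f w == 0 then (f z)^-1 else (f w)^-1)).
  have /ccontP/(_ (nc (f z))) := fc.
  rewrite nc_gt0 => /(_ f0)[d d0 dh]; apply/nbhs_ncP; exists d => // w /dh wd.
  case: eqP => // fw0; move: wd.
  by rewrite fw0 sub0r ncN ltxx.
move: fa => [k [<- kc kE]].
exists (fun w => if f w == 0 then 0 else - k w / (f w * f z)).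
split; first by rewrite (negPf f0) expr2.
  apply: (@ccont_near R[i]^o z (fun w => - k w / (f w * f z))).
    have /ccontP/(_ (nc (f z))) := fc.
    rewrite nc_gt0 => /(_ f0)[d d0 dh]; apply/nbhs_ncP; exists d => // w /dh wd.
    case: eqP => // fw0; move: wd.
    by rewrite fw0 sub0r ncN ltxx.
  apply: ccontM; first exact: ccontN.
  apply: ccontV; first by rewrite mulf_neq0.
  by apply: ccontM => //; exact: ccont_cst.
move=> w; rewrite (negPf f0); case: eqP => [_|/eqP fw].
  by rewrite subrr mul0r.
rewrite mulrAC mulNr -kE; field; exact/andP.
Qed.
Lemma cder_comp f g z a b : cder g z b -> cder f (g z) a ->
  cder (f \o g) z (a * b).
Proof.
move=> gb; have gc := cder_cont gb; move: gb => [l [<- lc lE]].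
move=> [k [<- kc kE]]; exists (fun w => k (g w) * l w); split=> //.
  by apply: ccontM => //; exact: (@ccont_compC R[i]^o z g k).
by move=> w; rewrite /= kE lE mulrA.
Qed.
Lemma cderZ f z a c : cder f z a -> cder (fun w => c * f w) z (c * a).
Proof.
by move=> fa; have := cderM (cder_cst c z) fa; rewrite mul0r add0r.
Qed.

(** The bridge to the derivatives in the definitions of curves and forms; all computations take
    place on the side of [cder]. *)
Lemma is_derive_cderP (f : R[i]^o -> R[i]^o) (z v : R[i]^o) :
  is_derive z (1 : R[i]^o) f v <-> cder f z v.
Proof.
have key (w : R[i]^o) : (w *: (1 : R[i]^o)) = w by rewrite /GRing.scale/= mulr1.
split.
  move=> [df vE]; rewrite -vE; move: df => /cvg_ncP /= h.
  apply: cderI => e e0; have /nbhs_ncP[d /= d0 dh] := h e e0.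
  exists d => // w wd; have [->|wz] := eqVneq w z.
    by rewrite !subrr mulr0 subrr nc0 mulr0.
  have wz0 : w - z != 0 by rewrite subr_eq0.
  have := dh (w - z); rewrite subr0 => /(_ wd wz0).
  rewrite key /= subrK => /ltW.
  rewrite -(@ler_pM2r _ (nc (w - z))) ?nc_gt0// -ncM => hle.
  apply: le_trans hle; rewrite le_eqVlt; apply/orP; left; apply/eqP; congr nc.
  by rewrite /derive /GRing.scale/= mulrBl mulrAC mulVf// mul1r.
move=> /cderE h.
have hc : h^-1 *: ((f \o shift z) (h *: (1 : R[i]^o)) - f z)
    @[h --> (0 : R[i]^o)^'] --> (v : R[i]^o).
  apply/cvg_ncP => e e0; have e20 : 0 < e / 2 by rewrite divr_gt0.
  have [d d0 dh] := h _ e20; apply/nbhs_ncP; exists d => // w; rewrite subr0 => wd w0.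
  rewrite key /= /GRing.scale/=.
  have := dh (w + z); rewrite addrK => /(_ wd) {}dh.
  have -> : w^-1 * (f (w + z) - f z) - v = w^-1 * (f (w + z) - f z - v * w).
    by field.
  rewrite ncM ncV mulrC ltr_pdivrMr ?nc_gt0//; apply: le_lt_trans dh _.
  by rewrite ltr_pM2r ?nc_gt0// ltr_pdivrMr// ltr_pMr// ltr1n.
by split; [apply/cvg_ex; exists v|apply: cvg_lim].
Qed.

Lemma derivable_cder (f : R[i]^o -> R[i]^o) (z : R[i]^o) :
  derivable f z 1 -> cder f z ('D_1 f z).
Proof. by move=> h; apply/is_derive_cderP; split. Qed.

Lemma cder_derivable (f : R[i]^o -> R[i]^o) (z : R[i]^o) v :
  cder f z v -> derivable f z 1.
Proof. by move=> /is_derive_cderP[]. Qed.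

Lemma cder_derive (f : R[i]^o -> R[i]^o) (z : R[i]^o) v :
  cder f z v -> 'D_1 f z = v.
Proof. by move=> /is_derive_cderP[]. Qed.

End ComplexBasics.

(** * Integration along segments *)

Section Segments.
Variable R : realType.
Implicit Types (z w : R[i]) (s t a b c d e : R) (f g : R[i] -> R[i]).

(** Compactness of [0, 1] in the form used for every subdivision argument below. The supremum of the
    points reachable from 0 is reachable, and the local hypothesis there would lead beyond it if it
    were below 1. *)
Lemma cousin (P : R -> R -> Prop) :
  (forall a b c, 0 <= a -> a <= b -> b <= c -> c <= 1 ->
    P a b -> P b c -> P a c) ->
  (forall t, 0 <= t -> t <= 1 -> exists2 d, 0 < d & forall a b,
    0 <= a -> a <= t -> t <= b -> b <= 1 -> b - a < d -> P a b) ->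
  P 0 1.
Proof.
move=> Ptr Ploc; pose S := [set x | 0 <= x <= 1 /\ P 0 x].
have S0 : S 0.
  have [|d d0 dP] := Ploc 0 (lexx _); first exact: ler01.
  by split; [rewrite lexx ler01|apply: dP; rewrite ?ler01 ?subrr].
have S1 : ubound S 1 by move=> x [/andP[]].
have hS : has_sup S by split; [exists 0|exists 1].
have s0 : 0 <= sup S by exact: (ub_le_sup hS.2).
have s1 : sup S <= 1 by apply: ge_sup => //; exists 0.
have [d d0 dP] := Ploc _ s0 s1.
have d20 : 0 < d / 2 by rewrite divr_gt0.
have [x [/andP[x0 x1] Px] xs] := sup_adherent d20 hS.
have xS : x <= sup S by apply: (ub_le_sup hS.2); split=> //; rewrite x0.
(* As [x > sup S - d / 2], the interval from [x] to [y] contains [sup S] and has length below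
   [5 d / 6], so the local hypothesis applies to it. *)
pose y := Num.min 1 (sup S + d / 3).
have sy : sup S <= y by rewrite /y le_min s1 lerDl divr_ge0// ltW.
have y1 : y <= 1 by rewrite /y ge_min lexx.
have yd : y <= sup S + d / 3 by rewrite /y ge_min lexx orbT.
have Py : P 0 y.
  apply: (@Ptr 0 x y) => //; first exact: le_trans sy.
  by apply: dP => //; lra.
have : y <= sup S.
  by apply: (ub_le_sup hS.2); split=> //; rewrite y1 (le_trans s0 sy).
rewrite /y ge_min => /orP[h|]; last lra.
suff e1 : y = 1 by rewrite -e1.
by apply/eqP; rewrite eq_le y1 (le_trans h sy).
Qed.

Definition rder (F : R -> R[i]) t (v : R[i]) : Prop :=
  exists k : R -> R[i], [/\ k t = v, ccont t k
    & forall s, F s - F t = k s * (s - t)%:C].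

Lemma rderE F t v : rder F t v -> forall e, 0 < e -> exists2 d, 0 < d &
  forall s, `|s - t| < d -> nc (F s - F t - v * (s - t)%:C) <= e * `|s - t|.
Proof.
move=> [k [<- /ccont_RP kc kE]] e /kc[d d0 dk]; exists d => // s /dk st.
by rewrite kE -mulrBl ncM nc_real ler_wpM2r// ltW.
Qed.

Lemma rderB F G t v u : rder F t v -> rder G t u ->
  rder (fun s => F s - G s) t (v - u).
Proof.
move=> [k [<- kc kE]] [l [<- lc lE]]; exists (fun s => k s - l s).
by split=> //; [exact: ccontB|move=> s; rewrite mulrBl -kE -lE; ring].
Qed.
Lemma rderD F G t v u : rder F t v -> rder G t u ->
  rder (fun s => F s + G s) t (v + u).
Proof.
move=> [k [<- kc kE]] [l [<- lc lE]]; exists (fun s => k s + l s).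
by split=> //; [exact: ccontD|move=> s; rewrite mulrDl -kE -lE; ring].
Qed.
Lemma rderZ F t v (c : R[i]) : rder F t v -> rder (fun s => c * F s) t (c * v).
Proof.
move=> [k [<- kc kE]]; exists (fun s => c * k s); split=> //.
  by apply: ccontM => //; exact: ccont_cst.
by move=> s; rewrite -mulrA -kE mulrBr.
Qed.

Lemma continuous_affine a b : continuous (fun t : R => a + b * t).
Proof.
move=> t; apply: cvgD; first exact: cvg_cst.
by apply: cvgM; [exact: cvg_cst|exact: cvg_id].
Qed.

Lemma rder_affine F a b t v : rder F (a + b * t) v ->
  rder (fun s => F (a + b * s)) t (b%:C * v).
Proof.
move=> [k [<- kc kE]]; exists (fun s => b%:C * k (a + b * s)); split=> //.
  apply: ccontM; first exact: ccont_cst.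
  exact: (ccont_comp (@continuous_affine a b t) kc).
move=> s; rewrite kE -mulrA mulrCA -rmorphM /=; congr (_ * _%:C); ring.
Qed.

(** For complex values there is no intermediate point; instead the first-order estimate at each [t],
    with slope [M + e], is added up over a subdivision. *)
Lemma mean_value (F f' : R -> R[i]) M :
  (forall t, 0 <= t -> t <= 1 -> rder F t (f' t)) ->
  (forall t, 0 <= t -> t <= 1 -> nc (f' t) <= M) -> nc (F 1 - F 0) <= M.
Proof.
move=> dF fM; apply/ler_addgt0Pr => e e0.
have := @cousin (fun a b => nc (F b - F a) <= (M + e) * (b - a)).
rewrite subr0 mulr1; apply.
  move=> a b c _ _ _ _ hab hbc.
  have -> : F c - F a = (F c - F b) + (F b - F a) by ring.
  apply: le_trans (ncD _ _) _; apply: le_trans (lerD hbc hab) _.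
  by rewrite le_eqVlt; apply/orP; left; apply/eqP; ring.
move=> t t0 t1; have [d d0 dh] := rderE (dF t t0 t1) e0; exists d => //.
have key s : `|s - t| < d -> nc (F s - F t) <= (M + e) * `|s - t|.
  move=> /dh h; rewrite mulrDl.
  have := ncBD (F s - F t) (f' t * (s - t)%:C); rewrite ncM nc_real => h2.
  apply: le_trans h2 _; apply: lerD => //; apply: ler_wpM2r => //; exact: fM.
move=> a b a0 at1 tb b1 ab.
have -> : F b - F a = (F b - F t) - (F a - F t) by ring.
apply: le_trans (ncD _ _) _; rewrite ncN.
apply: le_trans (lerD (key b _) (key a _)) _.
- by rewrite ger0_norm ?subr_ge0//; lra.
- by rewrite ler0_norm ?subr_le0//; lra.
- rewrite ger0_norm ?subr_ge0// ler0_norm ?subr_le0//.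
  by rewrite le_eqVlt; apply/orP; left; apply/eqP; ring.
Qed.

Lemma real_primitive (h : R -> R) : continuous h ->
  exists F : R -> R, forall t, 0 <= t -> t <= 1 -> exists k : R -> R,
    [/\ k t = h t, {for t, continuous k}
      & forall s, F s - F t = k s * (s - t)].
Proof.
(* Integrating from -1, inside the interval [-1, 2], makes all points of [0, 1] interior for the
   fundamental theorem. *)
move=> hc; pose F (x : R) : R := \int[lebesgue_measure]_(u in `[-1, x]) h u.
exists F => t t0 t1.
have i : (@lebesgue_measure R).-integrable `[-1, 2] (EFin \o h).
  apply: continuous_compact_integrable; first exact: segment_compact.
  by apply: continuous_subspaceT => x; exact: hc.
have [||dF Fh] := @continuous_FTC1_closed R h (-1) t 2 _ i _ (hc t); try lra.
rewrite -/F in dF Fh.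
have {dF}/cvgrPdist_lt Fc : h0^-1 *: ((F \o shift t) (h0 *: (1 : R)) - F t)
    @[h0 --> 0^'] --> h t.
  rewrite -Fh derive1E; exact: dF.
exists (fun s => if s == t then h t else (F s - F t) / (s - t)).
split; first by rewrite eqxx.
  apply/cvgrPdist_lt => e e0; rewrite eqxx.
  have /nbhs_absP[d d0 dh] := Fc e e0; apply/nbhs_absP; exists d => // s st.
  case: eqP => [_|/eqP s_t]; first by rewrite subrr normr0.
  have st0 : s - t != 0 by rewrite subr_eq0.
  have := dh (s - t); rewrite subr0 => /(_ st st0).
  by rewrite /= /GRing.scale/= mulr1 subrK mulrC.
move=> s; case: eqP => [->|/eqP st]; first by rewrite !subrr mulr0.
by rewrite divfK// subr_eq0.
Qed.

Lemma continuous_Re (T : topologicalType) (x : T) (f : T -> R[i]) :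
  ccont x f -> {for x, continuous (fun y => complex.Re (f y))}.
Proof.
move=> /ccontE/cvg_nc_atP h; apply/cvgrPdist_lt => e /h.
apply: filterS => y; apply: le_lt_trans.
by rewrite distrC -raddfB /= ler_Re_nc.
Qed.

Lemma continuous_Im (T : topologicalType) (x : T) (f : T -> R[i]) :
  ccont x f -> {for x, continuous (fun y => complex.Im (f y))}.
Proof.
move=> /ccontE/cvg_nc_atP h; apply/cvgrPdist_lt => e /h.
apply: filterS => y; apply: le_lt_trans.
by rewrite distrC -raddfB /= ler_Im_nc.
Qed.

Lemma complex_primitive (h : R -> R[i]) : (forall t, ccont t h) ->
  exists F : R -> R[i], forall t, 0 <= t -> t <= 1 -> rder F t (h t).
Proof.
move=> hc.
have [F Fh] := @real_primitive _ (fun t => continuous_Re (hc t)).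
have [G Gh] := @real_primitive _ (fun t => continuous_Im (hc t)).
exists (fun t => (F t)%:C + 'i * (G t)%:C) => t t0 t1.
have [k [kt kc kE]] := Fh t t0 t1; have [l [lt lc lE]] := Gh t t0 t1.
exists (fun t => (k t)%:C + 'i * (l t)%:C); split.
- by rewrite kt lt -complexE.
- apply: ccontD; first exact: ccont_real.
  by apply: ccontM; [exact: ccont_cst|exact: ccont_real].
- move=> s; rewrite mulrDl -mulrA -!rmorphM -kE -lE !rmorphB /=; ring.
Qed.

(** The integral is described by a primitive in the real parameter, so that uniqueness and bounds
    come from [mean_value] and additivity from adding primitives. *)
Definition seg_int f z w (I : R[i]) := exists2 F : R -> R[i],
  forall t, 0 <= t -> t <= 1 -> rder F t (f (z + t%:C * (w - z)) * (w - z))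
  & I = F 1 - F 0.

Definition seg f z w : R[i] := xget 0 [set I | seg_int f z w I].

Definition seg_cont f z w := forall t, 0 <= t -> t <= 1 ->
  ccont (z + t%:C * (w - z) : R[i]^o) f.

Lemma seg_int_unique f z w I J : seg_int f z w I -> seg_int f z w J -> I = J.
Proof.
move=> [F FE ->] [G GE ->]; apply: nc_le_eq => e e0.
have -> : F 1 - F 0 - (G 1 - G 0) = (F 1 - G 1) - (F 0 - G 0) by ring.
apply: (@mean_value (fun t => F t - G t) (fun=> 0)) => [t t0 t1|t _ _].
  by have := rderB (FE t t0 t1) (GE t t0 t1); rewrite subrr.
by rewrite nc0 ltW.
Qed.

Lemma segE f z w I : seg_int f z w I -> seg f z w = I.
Proof.
move=> h; rewrite /seg; case: xgetP => [J _ hJ|/(_ I)//].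
exact: seg_int_unique hJ h.
Qed.

Lemma line_cont z w t : {for t, continuous (fun s : R => z + s%:C * (w - z) : R[i]^o)}.
Proof.
apply: (@ccontE R R t (fun s => z + s%:C * (w - z))).
apply: ccontD; first exact: ccont_cst.
by apply: ccontM; [apply: ccont_real; exact: cvg_id|exact: ccont_cst].
Qed.

Lemma segP f z w : seg_cont f z w -> seg_int f z w (seg f z w).
Proof.
(* [f] is continuous at the points of the segment only, while [complex_primitive] wants continuity
   on all of [R]; hence the clamped parameter. *)
move=> fc; pose cl (t : R) := Num.max 0 (Num.min 1 t).
have clc : continuous cl.
  move=> t; apply: continuous_max; first exact: cvg_cst.
  by apply: continuous_min; [exact: cvg_cst|exact: cvg_id].
have cl0 t : 0 <= cl t by rewrite /cl le_max lexx.
have cl1 t : cl t <= 1 by rewrite /cl ge_max ler01 ge_min lexx.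
have clE t : 0 <= t -> t <= 1 -> cl t = t.
  by move=> t0 t1; rewrite /cl min_r// max_r.
have [|F FE] := @complex_primitive (fun t => f (z + (cl t)%:C * (w - z)) * (w - z)).
  move=> t; apply: ccontM; last exact: ccont_cst.
  have gc := @continuous_comp _ _ _ cl _ t (clc t) (@line_cont z w (cl t)).
  by apply: (ccont_comp gc); apply: fc.
have h : seg_int f z w (F 1 - F 0).
  by exists F => // t t0 t1; have := FE t t0 t1; rewrite clE.
by rewrite (segE h).
Qed.

Lemma eq_seg f g z w :
  (forall t, 0 <= t -> t <= 1 ->
    f (z + t%:C * (w - z)) = g (z + t%:C * (w - z))) ->
  seg f z w = seg g z w.
Proof.
move=> fg; rewrite /seg; congr (xget 0 _); apply/seteqP; split=> I [F h ->];
  exists F => // t t0 t1; have := h t t0 t1; by rewrite fg.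
Qed.

Lemma segD f g z w : seg_cont f z w -> seg_cont g z w ->
  seg (fun u => f u + g u) z w = seg f z w + seg g z w.
Proof.
move=> /segP[F Fh FE] /segP[G Gh GE]; rewrite FE GE.
have -> : F 1 - F 0 + (G 1 - G 0) = F 1 + G 1 - (F 0 + G 0) by ring.
apply: segE; exists (fun t => F t + G t) => // t t0 t1.
by rewrite mulrDl; apply: rderD; auto.
Qed.

Lemma segZ (c : R[i]) f z w : seg_cont f z w ->
  seg (fun u => c * f u) z w = c * seg f z w.
Proof.
move=> /segP[F Fh FE]; rewrite FE mulrBr.
apply: segE; exists (fun t => c * F t) => // t t0 t1.
by rewrite -mulrA; apply: rderZ; auto.
Qed.

Lemma seg_contZ (c : R[i]) f z w : seg_cont f z w -> seg_cont (fun u => c * f u) z w.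
Proof.
move=> h t t0 t1; apply: ccontM; [exact: ccont_cst|exact: h].
Qed.

Lemma segB f g z w : seg_cont f z w -> seg_cont g z w ->
  seg (fun u => f u - g u) z w = seg f z w - seg g z w.
Proof.
move=> fc gc; rewrite -[- seg g z w]mulN1r -segZ// -segD//; last exact: seg_contZ.
by apply: eq_seg => t _ _; rewrite mulN1r.
Qed.

Lemma seg_contB f g z w : seg_cont f z w -> seg_cont g z w ->
  seg_cont (fun u => f u - g u) z w.
Proof. by move=> hf hg t t0 t1; apply: ccontB; [exact: hf|exact: hg]. Qed.

Lemma seg_sub f z w a b : 0 <= a <= 1 -> 0 <= b <= 1 -> seg_cont f z w ->
  forall F, (forall t, 0 <= t -> t <= 1 ->
    rder F t (f (z + t%:C * (w - z)) * (w - z))) ->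
  seg f (z + a%:C * (w - z)) (z + b%:C * (w - z)) = F b - F a.
Proof.
move=> /andP[a0 a1] /andP[b0 b1] fc F Fh; apply: segE.
exists (fun t => F (a + (b - a) * t)); last by rewrite mulr1 mulr0 addr0 subrKC.
move=> t t0 t1.
have -> : z + a%:C * (w - z) + t%:C * (z + b%:C * (w - z) - (z + a%:C * (w - z)))
   = z + (a + (b - a) * t)%:C * (w - z).
  by rewrite rmorphD rmorphM rmorphB /=; ring.
have -> : z + b%:C * (w - z) - (z + a%:C * (w - z)) = (b - a)%:C * (w - z).
  by rewrite rmorphB /=; ring.
by rewrite mulrCA; apply: rder_affine; apply: Fh; nra.
Qed.

Lemma seg_split f z w m s : 0 <= s <= 1 -> m = z + s%:C * (w - z) ->
  seg_cont f z w -> seg f z w = seg f z m + seg f m w.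
Proof.
move=> s01 -> fc; have [F Fh FE] := segP fc.
have h0 : 0 <= (0 : R) <= 1 by apply/andP; split; lra.
have h1 : 0 <= (1 : R) <= 1 by apply/andP; split; lra.
have := seg_sub h0 s01 fc Fh; have := seg_sub s01 h1 fc Fh.
rewrite rmorph0 rmorph1 mul0r addr0 mul1r subrKC => -> ->.
by rewrite FE; ring.
Qed.

Lemma seg_rev f z w : seg_cont f z w -> seg f w z = - seg f z w.
Proof.
move=> fc; have [F Fh FE] := segP fc.
have h0 : 0 <= (0 : R) <= 1 by apply/andP; split; lra.
have h1 : 0 <= (1 : R) <= 1 by apply/andP; split; lra.
have := seg_sub h1 h0 fc Fh; rewrite rmorph0 rmorph1 mul0r addr0 mul1r subrKC => ->.
by rewrite FE opprB.
Qed.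

Lemma seg_bound f z w M : seg_cont f z w ->
  (forall t, 0 <= t -> t <= 1 -> nc (f (z + t%:C * (w - z))) <= M) ->
  nc (seg f z w) <= M * nc (w - z).
Proof.
move=> /segP[F Fh ->] fM; apply: (mean_value Fh) => t t0 t1.
by rewrite ncM ler_wpM2r ?nc_ge0// fM.
Qed.

Lemma rder_line F z w t v : cder F (z + t%:C * (w - z)) v ->
  rder (fun s => F (z + s%:C * (w - z))) t (v * (w - z)).
Proof.
move=> [k [<- kc kE]]; exists (fun s => k (z + s%:C * (w - z)) * (w - z)).
split=> //.
  apply: ccontM; last exact: ccont_cst.
  exact: (ccont_comp (@line_cont z w t)).
by move=> s; rewrite kE rmorphB /=; ring.
Qed.

Lemma seg_FTC f F z w :
  (forall t, 0 <= t -> t <= 1 ->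
    cder F (z + t%:C * (w - z)) (f (z + t%:C * (w - z)))) ->
  seg f z w = F w - F z.
Proof.
move=> h; apply: segE; exists (fun t => F (z + t%:C * (w - z))).
  by move=> t t0 t1; apply: rder_line; exact: h.
by rewrite rmorph0 rmorph1 mul0r addr0 mul1r subrKC.
Qed.

End Segments.

(** * Cauchy's theorem and its consequences *)
Section Goursat.
Variable R : realType.
Implicit Types (z w p : R[i]) (s t e : R) (f g : R[i] -> R[i]).

Definition cconvex (U : R[i] -> Prop) := forall z w t, U z -> U w ->
  0 <= t -> t <= 1 -> U (z + t%:C * (w - z)).

Definition copen (U : R[i] -> Prop) := forall z, U z ->
  exists2 d : R, 0 < d & forall w, nc (w - z) < d -> U w.

Definition holo (U : R[i] -> Prop) f := forall z, U z -> exists v, cder f z v.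

Definition tri f a b c := seg f a b + seg f b c + seg f c a.

(** The sides of the middle triangle are traversed twice in opposite directions and cancel; the
    outer sides are halved. *)
Lemma tri_split U f a b c : cconvex U ->
  (forall z, U z -> ccont (z : R[i]^o) f) ->
  U a -> U b -> U c ->
  let m z w := z + (2^-1 : R)%:C * (w - z) in
  tri f a b c = tri f a (m a b) (m a c) + tri f (m a b) b (m b c)
    + tri f (m a c) (m b c) c + tri f (m a b) (m b c) (m a c).
Proof.
move=> Uc Uf Ua Ub Ucc m.
have h2 : 0 <= (2^-1 : R) <= 1 by apply/andP; split; lra.
have sc z w : U z -> U w -> seg_cont f z w.
  by move=> Uz Uw t t0 t1; apply: Uf; apply: Uc.
have mU z w : U z -> U w -> U (m z w).
  by move=> Uz Uw; case/andP: h2 => *; exact: Uc.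
have sp z w : U z -> U w -> seg f z w = seg f z (m z w) + seg f (m z w) w.
  by move=> Uz Uw; apply: (seg_split h2 erefl); exact: sc.
have rv z w : U z -> U w -> seg f w z = - seg f z w.
  by move=> Uz Uw; apply: seg_rev; exact: sc.
have Ux := mU a b Ua Ub; have Uy := mU b c Ub Ucc; have Uz := mU a c Ua Ucc.
rewrite /tri (sp a b)// (sp b c)// (rv a c)// (sp a c)//.
rewrite (rv a (m a c))// (rv (m a c) c)// (rv (m a b) (m b c))//.
rewrite (rv (m b c) (m a c))// (rv (m a b) (m a c))//; ring.
Qed.

Lemma half_power_limit (x : nat -> R) :
  (forall n, `|x n.+1 - x n| <= 2^-1 ^+ n) ->
  exists l, forall n, `|x n - l| <= 2 * 2^-1 ^+ n.
Proof.
(* [q n] is the sum of all later steps, so the intervals of radius [q n] around [x n] are nested. *)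
move=> h; pose q n : R := 2 * 2^-1 ^+ n.
have qS n : q n.+1 = 2^-1 ^+ n by rewrite /q exprS mulrA divff// mul1r.
have q2 n : q n = 2 * q n.+1 by rewrite qS.
have lo n k : x n - q n <= x (n + k)%N - q (n + k)%N.
  elim: k => [|k IH]; first by rewrite addn0.
  apply: le_trans IH _; rewrite addnS.
  have := h (n + k)%N; rewrite -qS (q2 (n + k)%N) ler_norml => /andP[]; lra.
have hi n k : x (n + k)%N + q (n + k)%N <= x n + q n.
  elim: k => [|k IH]; first by rewrite addn0.
  apply: le_trans IH; rewrite addnS.
  have := h (n + k)%N; rewrite -qS (q2 (n + k)%N) ler_norml => /andP[]; lra.
have q0 n : 0 <= q n by rewrite /q mulr_ge0// exprn_ge0// invr_ge0.
have lh m n : x m - q m <= x n + q n.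
  have := lo m n; have := hi n m; rewrite addnC; have := q0 (m + n)%N; lra.
pose S := [set x n - q n | n in [set: nat]].
have hS : has_sup S.
  split; first by exists (x 0%N - q 0%N), 0%N.
  by exists (x 0%N + q 0%N) => _ [n _ <-].
exists (sup S) => n; rewrite ler_norml -/(q n); apply/andP; split.
  have : sup S <= x n + q n.
    by apply: ge_sup => [|_ [m _ <-]//]; exact: hS.1.
  lra.
have : x n - q n <= sup S by apply: (ub_le_sup hS.2); exists n.
lra.
Qed.

(** The Archimedean property, through [n / 2^n <= 1]. *)
Lemma half_power_ge0 (x : R) (C : R) : (forall n, - x <= C * 2^-1 ^+ n) -> 0 <= x.
Proof.
move=> h; rewrite leNgt; apply/negP => x0.
have h1 n : 2^-1 ^+ n * n%:R <= 1 :> R.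
  elim: n => [|n IH]; first by rewrite mulr0.
  have p1 : 2^-1 ^+ n <= 1 :> R by apply: exprn_ile1; lra.
  rewrite exprS -[n.+1%:R]natr1 -mulrA mulrDr mulr1.
  move: IH p1; set P := _ * _; set Q := _ ^+ _ => *; lra.
have C0 : 0 < C by have := h 0%N; rewrite expr0; lra.
have [n hn] : exists n : nat, C / - x < n%:R.
  exists (Num.truncn (C / - x)).+1; exact: truncnS_gt.
have := h n; have := h1 n.
rewrite ltr_pdivrMr in hn; last lra.
have e0 : 0 < 2^-1 ^+ n :> R by rewrite exprn_gt0// invr_gt0.
nra.
Qed.

Lemma ball_convex p (r : R) : cconvex (fun z => nc (z - p) <= r).
Proof.
move=> z w t zr wr t0 t1.
have -> : z + t%:C * (w - z) - p = (1 - t)%:C * (z - p) + t%:C * (w - p).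
  by rewrite rmorphB rmorph1 /=; ring.
apply: le_trans (ncD _ _) _; rewrite !ncM !nc_real !ger0_norm ?subr_ge0//.
nra.
Qed.

Lemma oball_convex p (r : R) : cconvex (fun z => nc (z - p) < r).
Proof.
move=> z w t zr wr t0 t1; set m := Num.max (nc (z - p)) (nc (w - p)).
have mr : m < r by rewrite gt_max zr.
apply: le_lt_trans mr; apply: ball_convex => //; by rewrite le_max lexx ?orbT.
Qed.

Lemma oball_open p (r : R) : copen (fun z => nc (z - p) < r).
Proof.
move=> z zr; exists (r - nc (z - p)); first by rewrite subr_gt0.
move=> w; rewrite ltrBrDr; apply: le_lt_trans.
by apply: le_trans (ncD _ _); rewrite subrKA.
Qed.

(** The affine part of [f] at [p] has the primitive [G] and contributes nothing around the triangle.
    The remainder is at most [e r] on three sides of length at most [2 r]. *)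
Lemma tri_bound U f p v (e d r : R) a b c : cconvex U -> U a -> U b -> U c ->
  (forall w, nc (w - p) < d -> nc (f w - f p - v * (w - p)) <= e * nc (w - p)) ->
  (forall w, U w -> ccont (w : R[i]^o) f) -> 0 <= e ->
  r < d -> nc (a - p) <= r -> nc (b - p) <= r -> nc (c - p) <= r ->
  nc (tri f a b c) <= 6 * e * r ^+ 2.
Proof.
move=> Uc Ua Ub Ucc fd fc e0 rd ar br cr.
pose h u := f u - (f p + v * (u - p)).
pose G u := f p * u + v * (2^-1 * (u - p) * (u - p)).
have dG u : cder G u (f p + v * (u - p)).
  have d1 : cder (fun u => u - p) u 1.
    by have := cderB (cder_id u) (cder_cst p u); rewrite subr0.
  have d2 := cderM (cderZ (2^-1) d1) d1.
  have d3 := cderD (cderZ (f p) (cder_id u)) (cderZ v d2).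
  rewrite (_ : f p + v * (u - p) =
    f p * 1 + v * (2^-1 * 1 * (u - p) + 2^-1 * (u - p) * 1))//.
  by field.
have r0 : 0 <= r by apply: le_trans ar; exact: nc_ge0.
have key z w : U z -> U w -> nc (z - p) <= r -> nc (w - p) <= r ->
    exists2 I, seg f z w = I + (G w - G z) & nc I <= 2 * e * r ^+ 2.
  move=> Uz Uw zr wr.
  have inb t : 0 <= t -> t <= 1 -> nc (z + t%:C * (w - z) - p) <= r.
    by move=> t0 t1; exact: ball_convex.
  have inb' t : 0 <= t -> t <= 1 -> nc (z + t%:C * (w - z) - p) < d.
    by move=> t0 t1; apply: le_lt_trans (inb t t0 t1) rd.
  have sf : seg_cont f z w by move=> t t0 t1; apply: fc; exact: Uc.
  have sa : seg_cont (fun u => f p + v * (u - p)) z w.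
    move=> t t0 t1; apply: ccontD; first exact: ccont_cst.
    apply: ccontM; first exact: ccont_cst.
    by apply: ccontB; [exact: ccont_id|exact: ccont_cst].
  exists (seg h z w).
    rewrite /h segB// -(@seg_FTC _ (fun u => f p + v * (u - p)) G z w).
      by rewrite subrK.
    by move=> t _ _; exact: dG.
  have -> : 2 * e * r ^+ 2 = (e * r) * (2 * r) by ring.
  apply: (@le_trans _ _ ((e * r) * nc (w - z))).
    apply: seg_bound; first exact: seg_contB.
    move=> t t0 t1; rewrite /h opprD addrA.
    by apply: le_trans (fd _ (inb' t t0 t1)) _; rewrite ler_wpM2l// inb.
  apply: ler_wpM2l; first exact: mulr_ge0.
  have -> : w - z = (w - p) - (z - p) by ring.
  by apply: le_trans (ncD _ _) _; rewrite ncN mulr2n mulrDl mul1r lerD.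
have [I1 E1 h1] := key _ _ Ua Ub ar br; have [I2 E2 h2] := key _ _ Ub Ucc br cr.
have [I3 E3 h3] := key _ _ Ucc Ua cr ar.
rewrite /tri E1 E2 E3.
have -> : I1 + (G b - G a) + (I2 + (G c - G b)) + (I3 + (G a - G c)) =
  I1 + I2 + I3 by ring.
by apply: le_trans (ncD3 _ _ _) _; lra.
Qed.

(* Goursat's bisection argument, carried out in barycentric coordinates. *)
Lemma goursat U f a b c : cconvex U -> holo U f -> U a -> U b -> U c ->
  tri f a b c = 0.
Proof.
move=> Uc Uf Ua Ub Ucc.
pose phi (u : R * R) := a + u.1%:C * (b - a) + u.2%:C * (c - a).
pose D (u : R * R) := [/\ 0 <= u.1, 0 <= u.2 & u.1 + u.2 <= 1].
have DU u : D u -> U (phi u).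
  move=> [x0 y0 xy1]; have [xy|xy] := eqVneq (u.1 + u.2) 0.
    have x00 : u.1 = 0 by lra. have y00 : u.2 = 0 by lra.
    by rewrite /phi x00 y00 !mul0r !addr0.
  have xyp : 0 < u.1 + u.2 by rewrite lt_def xy addr_ge0.
  have -> : phi u = a + (u.1 + u.2)%:C *
     (b + (u.2 / (u.1 + u.2))%:C * (c - b) - a).
    rewrite /phi rmorphM rmorphV/= ?unitfE// rmorphD /=; field.
    by rewrite -rmorphD /= -(rmorph0 (real_complex R)) (inj_eq (@complexI R)).
  apply: (Uc) => //; last lra.
  by apply: Uc => //; [rewrite divr_ge0// ltW|rewrite ler_pdivrMr//; lra].
have Uct z : U z -> ccont (z : R[i]^o) f.
  by move=> /Uf[v]; exact: cder_cont.
pose T := ((R * R) * (R * R) * (R * R))%type.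
pose tr (x : T) := tri f (phi x.1.1) (phi x.1.2) (phi x.2).
pose m (u v : R * R) := ((u.1 + v.1) / 2, (u.2 + v.2) / 2).
have mC u v : m u v = m v u by rewrite /m addrC [u.2 + _]addrC.
have mE u v : phi (m u v) = phi u + (2^-1 : R)%:C * (phi v - phi u).
  rewrite /phi /m /= !rmorphM !rmorphD /= !(rmorphV, rmorph_nat)/= ?unitfE//.
  by field.
have Dm u v : D u -> D v -> D (m u v).
  by move=> [? ? ?] [? ? ?]; split; rewrite /m /=; lra.
pose near (e : R) (u v : R * R) := `|u.1 - v.1| <= e /\ `|u.2 - v.2| <= e.
have nearC e u v : near e u v -> near e v u.
  by move=> [h1 h2]; split; rewrite distrC.
have half (e x y : R) : x = y / 2 -> `|y| <= e -> `|x| <= e / 2.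
  by move=> -> h; rewrite normrM [`|2^-1|]ger0_norm ?invr_ge0// ler_pM2r ?invr_gt0.
have near1 e u v : near e u v -> near (e / 2) u (m u v).
  by move=> [h1 h2]; split; [apply: half h1|apply: half h2] => //=; field.
have near2 e (u v w : R * R) : near e v w -> near (e / 2) (m u v) (m u w).
  by move=> [h1 h2]; split; [apply: half h1|apply: half h2] => //=; field.
have near_half e u v : near (e / 2) u v -> near e u v.
  move=> [h1 h2]; have e0 : 0 <= e / 2 by apply: le_trans h1.
  by split; [apply: le_trans h1 _|apply: le_trans h2 _]; lra.
pose ok (e : R) (x : T) := [/\ D x.1.1, D x.1.2 & D x.2] /\
  [/\ near e x.1.1 x.1.2, near e x.1.2 x.2 & near e x.1.1 x.2].
(* The child is chosen before the scale [e], so that one choice function can be iterated at all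
   scales. *)
have child x : exists y : T, forall e, ok e x ->
  [/\ ok (e / 2) y, near e x.1.1 y.1.1 & nc (tr x) <= 4 * nc (tr y)].
  case: x => -[u v] w.
  pose y1 : T := (u, m u v, m u w). pose y2 : T := (m u v, v, m v w).
  pose y3 : T := (m u w, m v w, w). pose y4 : T := (m u v, m v w, m u w).
  have trs e : ok e (u, v, w) -> tr (u, v, w) = tr y1 + tr y2 + tr y3 + tr y4.
    move=> [[/= Du Dv Dw] _]; rewrite /tr /= !mE.
    by apply: (@tri_split U) => //; exact: DU.
  have ok1 e : ok e (u, v, w) -> ok (e / 2) y1 /\ near e u y1.1.1.
    move=> [[/= Du Dv Dw] [uv vw uw]]; split; last first.
      by apply: near_half; split; rewrite subrr normr0;
         apply: le_trans (near1 _ _ _ uv).1.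
    by split; split => /=; auto.
  have ok2 e : ok e (u, v, w) -> ok (e / 2) y2 /\ near e u y2.1.1.
    move=> [[/= Du Dv Dw] [uv vw uw]]; split; last by auto.
    split; split => /=; auto; first by rewrite mC; auto.
    by rewrite mC; auto.
  have ok3 e : ok e (u, v, w) -> ok (e / 2) y3 /\ near e u y3.1.1.
    move=> [[/= Du Dv Dw] [uv vw uw]]; split; last by auto.
    split; split => /=; auto.
    - by rewrite mC (mC v); auto.
    - by rewrite mC; auto.
    - by rewrite mC; auto.
  have ok4 e : ok e (u, v, w) -> ok (e / 2) y4 /\ near e u y4.1.1.
    move=> [[/= Du Dv Dw] [uv vw uw]]; split; last by auto.
    split; split => /=; auto.
    - by rewrite mC; auto.
    - by rewrite mC (mC u); auto.
  have big e : ok e (u, v, w) ->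
    nc (tr (u, v, w)) <= nc (tr y1) + nc (tr y2) + nc (tr y3) + nc (tr y4).
    move=> /trs ->; apply: le_trans (ncD _ _) _; rewrite lerD2r.
    exact: ncD3.
  have [h1|h1] := lerP (nc (tr (u, v, w))) (4 * nc (tr y1)).
    by exists y1 => e oke; have [? ?] := ok1 e oke; split.
  have [h2|h2] := lerP (nc (tr (u, v, w))) (4 * nc (tr y2)).
    by exists y2 => e oke; have [? ?] := ok2 e oke; split.
  have [h3|h3] := lerP (nc (tr (u, v, w))) (4 * nc (tr y3)).
    by exists y3 => e oke; have [? ?] := ok3 e oke; split.
  exists y4 => e oke; have [? ?] := ok4 e oke; split => //.
  have := big e oke; lra.
have [F FE] := choice child.
pose X n := iter n F ((0, 0), (1, 0), (0, 1)).
have okX n : ok (2^-1 ^+ n) (X n).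
  elim: n => [|n IH]; last by rewrite exprSr; have [] := FE _ _ IH.
  by rewrite /X /= expr0; split; split;
       split; rewrite /= ?ler_norml; try (apply/andP; split); lra.
have step n : near (2^-1 ^+ n) (X n).1.1 (X n.+1).1.1 by have [] := FE _ _ (okX n).
have trX n : nc (tri f a b c) <= 4 ^+ n * nc (tr (X n)).
  elim: n => [|n IH].
    rewrite expr0 mul1r /tr /X /phi /= !rmorph0 !rmorph1 !mul0r !mul1r !addr0.
    by rewrite !subrKC.
  apply: le_trans IH _; rewrite exprSr -mulrA ler_wpM2l ?exprn_ge0//.
  by have [] := FE _ _ (okX n).
have [n|lx hx] := @half_power_limit (fun n => (X n).1.1.1).
  by rewrite distrC; have [] := step n.
have [n|ly hy] := @half_power_limit (fun n => (X n).1.1.2).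
  by rewrite distrC; have [] := step n.
have Dl : D (lx, ly).
  split => /=.
  - apply: (@half_power_ge0 lx 2) => n; have [[[? ? ?] _ _] _] := okX n.
    have := hx n; rewrite ler_norml => /andP[]; lra.
  - apply: (@half_power_ge0 ly 2) => n; have [[[? ? ?] _ _] _] := okX n.
    have := hy n; rewrite ler_norml => /andP[]; lra.
  - rewrite -subr_ge0; apply: (@half_power_ge0 _ 4) => n.
    have [[[? ? ?] _ _] _] := okX n.
    have := hx n; have := hy n; rewrite !ler_norml => /andP[? ?] /andP[]; lra.
pose C := nc (b - a) + nc (c - a); pose p := phi (lx, ly).
have C0 : 0 <= C by rewrite addr_ge0// nc_ge0.
have dist (q : R) u : `|u.1 - lx| <= 3 * q -> `|u.2 - ly| <= 3 * q ->
    nc (phi u - p) <= 3 * C * q.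
  move=> h1 h2; have -> : phi u - p =
      (u.1 - lx)%:C * (b - a) + (u.2 - ly)%:C * (c - a).
    by rewrite /p /phi /= !rmorphB /=; ring.
  apply: le_trans (ncD _ _) _; rewrite !ncM !nc_real.
  have -> : 3 * C * q = 3 * q * nc (b - a) + 3 * q * nc (c - a).
    by rewrite /C; ring.
  by apply: lerD; apply: ler_wpM2r => //; exact: nc_ge0.
have tri3 (x y l q : R) : `|x - l| <= 2 * q -> `|x - y| <= q -> `|y - l| <= 3 * q.
  by rewrite !ler_norml => /andP[? ?] /andP[? ?]; apply/andP; split; lra.
have distX n : let q := 2^-1 ^+ n in
    [/\ nc (phi (X n).1.1 - p) <= 3 * C * q, nc (phi (X n).1.2 - p) <= 3 * C * q
      & nc (phi (X n).2 - p) <= 3 * C * q].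
  move=> q; have [_ [[n1 n2] _ [n3 n4]]] := okX n.
  have := hx n; have := hy n; rewrite -/q => hy' hx'.
  have q0 : 0 <= q by rewrite exprn_ge0// invr_ge0.
  split; apply: dist.
  - by apply: le_trans hx' _; lra.
  - by apply: le_trans hy' _; lra.
  - exact: tri3 hx' n1.
  - exact: tri3 hy' n2.
  - exact: tri3 hx' n3.
  - exact: tri3 hy' n4.
have [v fv] := Uf _ (DU _ Dl); rewrite -/p in fv.
(* At stage [n] the vertices are within [3 C / 2^n] of [p]. The square of this radius cancels the
   factor [4^n] of the bisection, and [54 = 6 * 3^2]. *)
have fin e : 0 < e -> nc (tri f a b c) <= 54 * e * C ^+ 2.
  move=> e0; have [d d0 fd] := cderE fv e0.
  have [n hn] : exists n : nat, 3 * C * 2^-1 ^+ n < d.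
    apply: contrapT => hn.
    have := @half_power_ge0 (- d) (3 * C) _; rewrite oppr_ge0 leNgt d0.
    suff h n : - - d <= 3 * C * 2^-1 ^+ n by move=> /(_ h).
    by rewrite opprK leNgt; apply/negP => h; apply: hn; exists n.
  have [d1 d2 d3] := distX n; have [[D1 D2 D3] _] := okX n.
  have tb := tri_bound Uc (DU _ D1) (DU _ D2) (DU _ D3) fd Uct (ltW e0) hn d1 d2 d3.
  apply: le_trans (trX n) _.
  apply: (@le_trans _ _ (4 ^+ n * (6 * e * (3 * C * 2^-1 ^+ n) ^+ 2))).
    by rewrite ler_wpM2l// exprn_ge0.
  have -> : 4 ^+ n * (6 * e * (3 * C * 2^-1 ^+ n) ^+ 2) =
      54 * e * C ^+ 2 * (4 ^+ n * (2^-1 ^+ n) ^+ 2) by ring.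
  rewrite -exprM mulnC exprM -exprMn (_ : 4 * 2^-1 ^+ 2 = 1) ?expr1n ?mulr1//.
  by field.
apply: nc_le_eq => e e0; rewrite subr0.
have C2 : 0 <= C ^+ 2 by exact: exprn_ge0.
have M0 : 0 < 54 * C ^+ 2 + 1 by lra.
apply: le_trans (fin (e / (54 * C ^+ 2 + 1)) _) _; first exact: divr_gt0.
have -> : 54 * (e / (54 * C ^+ 2 + 1)) * C ^+ 2 =
  e * ((54 * C ^+ 2) / (54 * C ^+ 2 + 1)) by field; rewrite gt_eqF.
apply: ler_piMr; first exact: ltW.
by rewrite ler_pdivrMr// mul1r; lra.
Qed.
End Goursat.

(** * Primitives on convex open sets *)

Section Cauchy.
Variable R : realType.
Implicit Types (z w p : R[i]) (s t e r : R) (f g : R[i] -> R[i]).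

Definition hull a b c (u : R[i]) := exists x y z : R,
  [/\ [/\ 0 <= x, 0 <= y & 0 <= z], x + y + z = 1
    & u = x%:C * a + y%:C * b + z%:C * c].

Lemma hull_convex (a b c : R[i]) : cconvex (hull a b c).
Proof.
move=> _ _ t [x [y [z [[x0 y0 z0] s1 ->]]]] [x' [y' [z' [[x'0 y'0 z'0] s'1 ->]]]] t0 t1.
exists ((1 - t) * x + t * x'), ((1 - t) * y + t * y'), ((1 - t) * z + t * z').
split; last by rewrite !rmorphD !rmorphM /= !rmorphB rmorph1 /=; ring.
- by split; nra.
- have -> : (1 - t) * x + t * x' + ((1 - t) * y + t * y') +
   ((1 - t) * z + t * z') = (1 - t) * (x + y + z) + t * (x' + y' + z') by ring.
  by rewrite s1 s'1; ring.
Qed.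

Lemma hull_vertices (a b c : R[i]) : [/\ hull a b c a, hull a b c b & hull a b c c].
Proof.
split; [exists 1, 0, 0|exists 0, 1, 0|exists 0, 0, 1];
  (split; [by split; lra|lra|]);
  by rewrite !rmorph0 rmorph1 !mul0r mul1r ?add0r ?addr0.
Qed.

Lemma sub_hull (U : R[i] -> Prop) a b c : cconvex U -> U a -> U b -> U c ->
  forall u, hull a b c u -> U u.
Proof.
move=> Uc Ua Ub Ucc u [x [y [z [[x0 y0 z0] s1 ->]]]].
have [z1|z1] := eqVneq z 1.
  have -> : x = 0 by lra. have -> : y = 0 by lra.
  by rewrite z1 !rmorph0 rmorph1 !mul0r !add0r mul1r.
have xy : x + y != 0 by apply: contra_neq z1; lra.
have xy0 : 0 < x + y by rewrite lt_def xy addr_ge0.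
have -> : x%:C * a + y%:C * b + z%:C * c =
    (a + (y / (x + y))%:C * (b - a)) + z%:C *
    (c - (a + (y / (x + y))%:C * (b - a))).
  have -> : z = 1 - (x + y) by lra.
  rewrite rmorphM rmorphV/= ?unitfE// !rmorphB rmorphD rmorph1 /=; field.
  by rewrite -rmorphD /= -(rmorph0 (real_complex R)) (inj_eq (@complexI R)).
apply: (Uc) => //; last lra.
by apply: Uc => //; [rewrite divr_ge0// ltW|rewrite ler_pdivrMr//; lra].
Qed.

(** Differentiability may fail at the apex [p]. Shrinking the triangle towards [p] by the factor [t]
    cuts off two triangles whose hulls avoid [p], where Goursat's lemma applies. What remains has
    perimeter of order [t], and [f] is bounded near [p]. *)
Lemma tri_apex0 (U : R[i] -> Prop) f p z w : cconvex U -> U p -> U z -> U w ->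
  (forall u, U u -> ccont (u : R[i]^o) f) ->
  (forall u, U u -> u != p -> exists v, cder f u v) ->
  tri f p z w = 0.
Proof.
move=> Uc Up Uz Uw fc fd.
have sc a b : U a -> U b -> seg_cont f a b.
  by move=> Ua Ub t t0 t1; apply: fc; apply: Uc.
have rv a b : U a -> U b -> seg f b a = - seg f a b.
  by move=> Ua Ub; apply: seg_rev; exact: sc.
(* In the first case [p] lies on the opposite side and the integrals cancel in pairs. Otherwise a
   membership of [p] in one of the cut-off hulls would produce such [x] and [y]. *)
have [[x [y [x0 y0 xy pE]]]|nseg] := pselect (exists x y : R,
    [/\ 0 <= x, 0 <= y, 0 < x + y & x%:C * (z - p) + y%:C * (w - p) = 0]).
  have pE' : p = z + (y / (x + y))%:C * (w - z).
    have xyC : (x + y)%:C != 0 :> R[i].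
      by rewrite -(rmorph0 (real_complex R)) (inj_eq (@complexI R)) gt_eqF.
    apply: (mulfI xyC); rewrite mulrDr mulrA -rmorphM /= mulrCA divff ?gt_eqF// mulr1.
    apply/eqP; rewrite -subr_eq0 -oppr_eq0 -pE rmorphD /=; apply/eqP; ring.
  have s01 : 0 <= y / (x + y) <= 1.
    by rewrite divr_ge0 ?(ltW xy)//= ler_pdivrMr// mul1r; lra.
  rewrite /tri (seg_split s01 pE' (sc _ _ Uz Uw)) (rv z p)// (rv p w)//; ring.
pose zt t := p + t%:C * (z - p); pose wt t := p + t%:C * (w - p).
have Uzt t : 0 <= t -> t <= 1 -> U (zt t) by move=> *; exact: Uc.
have Uwt t : 0 <= t -> t <= 1 -> U (wt t) by move=> *; exact: Uc.
have gz a b c : U a -> U b -> U c -> ~ hull a b c p -> tri f a b c = 0.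
  move=> Ua Ub Ucc np; have [ha hb hc] := hull_vertices a b c.
  apply: (@goursat _ (hull a b c)) => //; first exact: hull_convex.
  move=> u hu; apply: fd; first exact: sub_hull hu.
  by apply: contra_notN np => /eqP <-.
have n1 t : 0 < t -> t <= 1 -> ~ hull (zt t) z w p.
  move=> t0 t1 [x [y [v [[x0 y0 v0] s1 pE]]]]; apply: nseg.
  exists (x * t + y), v; split => //; [by nra|by nra|].
  rewrite rmorphD rmorphM /=; apply/eqP; rewrite -subr_eq0; apply/eqP.
  transitivity (x%:C * zt t + y%:C * z + v%:C * w - (x + y + v)%:C * p).
    by rewrite /zt !rmorphD /=; ring.
  by rewrite -pE s1 rmorph1 mul1r subrr.
have n2 t : 0 < t -> t <= 1 -> ~ hull (zt t) w (wt t) p.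
  move=> t0 t1 [x [y [v [[x0 y0 v0] s1 pE]]]]; apply: nseg.
  exists (x * t), (y + v * t); split; [by nra|by nra|by nra|].
  rewrite rmorphD !rmorphM /=; apply/eqP; rewrite -subr_eq0; apply/eqP.
  transitivity (x%:C * zt t + y%:C * w + v%:C * wt t - (x + y + v)%:C * p).
    by rewrite /zt /wt !rmorphD /=; ring.
  by rewrite -pE s1 rmorph1 mul1r subrr.
have shrink t : 0 < t -> t <= 1 -> tri f p z w = tri f p (zt t) (wt t).
  move=> t0 t1.
  have t01 : 0 <= t <= 1 by rewrite ltW.
  have Uz' := Uzt t (ltW t0) t1; have Uw' := Uwt t (ltW t0) t1.
  have := gz _ _ _ Uz' Uz Uw (n1 t t0 t1).
  have := gz _ _ _ Uz' Uw Uw' (n2 t t0 t1).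
  rewrite /tri (seg_split t01 erefl (sc _ _ Up Uz)) -/(zt t).
  rewrite (rv p w)// (seg_split t01 erefl (sc _ _ Up Uw)) -/(wt t).
  rewrite (rv p (wt t))// (rv (wt t) w)// (rv (zt t) w)// (rv (zt t) (wt t))//.
  move=> h1 h2; apply/eqP; rewrite -subr_eq0; apply/eqP; rewrite -[RHS]addr0.
  by rewrite -{1}h1 -h2; ring.
have [d d0 fd1] : exists2 d : R, 0 < d &
    forall u, nc (u - p) < d -> nc (f u) <= nc (f p) + 1.
  have /ccontP/(_ 1 ltr01)[d d0 h] := fc _ Up.
  exists d => // u /h /ltW hu; apply: le_trans (ncBD (f u) (f p)) _.
  by rewrite lerD2l.
pose M := nc (f p) + 1; pose Q := nc (z - p) + nc (w - p).
have M0 : 0 < M by rewrite /M ltr_wpDl// nc_ge0.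
have Q0 : 0 <= Q by rewrite addr_ge0// nc_ge0.
apply: nc_le_eq => e e0; rewrite subr0.
(* The second bound keeps the small triangle in the disc where [f] is at most [M]; the third makes
   [2 * M] times its two sides at [p] at most [e]. *)
pose t := Num.min 1 (Num.min (d / (2 * (Q + 1))) (e / (2 * M * (Q + 1)))).
have t0 : 0 < t.
  rewrite !lt_min ltr01 !divr_gt0// ?mulr_gt0//; lra.
have t1 : t <= 1 by rewrite ge_min lexx.
have td : t * (Q + 1) < d.
  have : t <= d / (2 * (Q + 1)) by rewrite !ge_min lexx orbT.
  rewrite ler_pdivlMr; last lra.
  move=> h; lra.
have te : 2 * M * (t * (Q + 1)) <= e.
  have : t <= e / (2 * M * (Q + 1)) by rewrite !ge_min lexx !orbT.
  rewrite ler_pdivlMr; last by rewrite !mulr_gt0//; lra.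
  move=> h; lra.
rewrite (shrink t)//.
have tQ : t * nc (z - p) + t * nc (w - p) <= t * (Q + 1).
  by rewrite -mulrDr ler_wpM2l// ?(ltW t0)//; rewrite /Q; lra.
have nz0 := nc_ge0 (z - p); have nw0 := nc_ge0 (w - p).
have zr : nc (zt t - p) = t * nc (z - p).
  by rewrite /zt addrAC subrr add0r ncM nc_real ger0_norm// ltW.
have wr : nc (wt t - p) = t * nc (w - p).
  by rewrite /wt addrAC subrr add0r ncM nc_real ger0_norm// ltW.
have tz0 : 0 <= t * nc (z - p) by rewrite mulr_ge0// ltW.
have tw0 : 0 <= t * nc (w - p) by rewrite mulr_ge0// ltW.
pose B u := nc (u - p) < d.
have Bc : cconvex B by exact: oball_convex.
have Bp : B p by rewrite /B subrr nc0.
have Bz : B (zt t) by rewrite /B zr; lra.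
have Bw : B (wt t) by rewrite /B wr; lra.
have bd a b : U a -> U b -> B a -> B b -> nc (seg f a b) <= M * nc (b - a).
  move=> Ua Ub Ba Bb; apply: seg_bound; first exact: sc.
  by move=> s s0 s1; apply: fd1; exact: Bc.
have Uz' := Uzt t (ltW t0) t1; have Uw' := Uwt t (ltW t0) t1.
have b1 := bd _ _ Up Uz' Bp Bz; have b2 := bd _ _ Uz' Uw' Bz Bw.
have b3 := bd _ _ Uw' Up Bw Bp.
have zw : nc (wt t - zt t) <= t * nc (z - p) + t * nc (w - p).
  have -> : wt t - zt t = (wt t - p) - (zt t - p) by ring.
  by apply: le_trans (ncD _ _) _; rewrite ncN zr wr addrC.
rewrite /tri; apply: le_trans (ncD3 _ _ _) _.
rewrite [nc (p - _)]ncB wr in b3; rewrite zr in b1.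
have b2' : nc (seg f (zt t) (wt t)) <= M * (t * nc (z - p) + t * nc (w - p)).
  by apply: le_trans b2 _; rewrite ler_pM2l.
apply: le_trans te.
have : M * (t * nc (z - p) + t * nc (w - p)) <= M * (t * (Q + 1)).
  by rewrite ler_pM2l.
lra.
Qed.

(** The exceptional point is the base point itself. This is the case met by divided differences, in
    the integral formula, and by removable singularities. *)
Lemma seg_primitive (U : R[i] -> Prop) f p : cconvex U -> copen U -> U p ->
  (forall u, U u -> ccont (u : R[i]^o) f) ->
  (forall u, U u -> u != p -> exists v, cder f u v) ->
  forall z, U z -> cder (seg f p) z (f z).
Proof.
move=> Uc Uo Up fc fd z Uz.
have sc a b : U a -> U b -> seg_cont f a b.
  by move=> Ua Ub t t0 t1; apply: fc; apply: Uc.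
apply: cderI => e e0; have [d d0 dU] := Uo _ Uz.
have /ccontP/(_ e e0)[d' d'0 fz] := fc _ Uz.
exists (Num.min d d'); first by rewrite lt_min d0.
move=> w; rewrite lt_min => /andP[wd wd'].
have Uw := dU _ wd.
have := tri_apex0 Uc Up Uz Uw fc fd.
rewrite /tri (seg_rev (sc _ _ Up Uw)) => h.
have -> : seg f p w - seg f p z = seg f z w.
  by apply/eqP; rewrite -subr_eq0 -oppr_eq0 -h; apply/eqP; ring.
have sk : seg_cont (fun=> f z) z w by move=> t _ _; exact: ccont_cst.
have -> : f z * (w - z) = seg (fun=> f z) z w.
  rewrite (@seg_FTC _ _ (fun u => f z * u)) ?mulrBr// => t _ _.
  by rewrite -[X in cder _ _ X](mulr1 (f z)); apply: cderZ; exact: cder_id.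
rewrite -segB//; last exact: sc.
apply: seg_bound; first by apply: seg_contB => //; exact: sc.
move=> t t0 t1; apply/ltW/fz.
by apply: (@oball_convex R z d') => //; rewrite subrr nc0.
Qed.
End Cauchy.

(** * Contour integrals over squares *)

Section CauchyFormula.
Variable R : realType.
Implicit Types (z w p : R[i]) (s t e r : R) (f g : R[i] -> R[i]).

Lemma seg_bounded f a b : seg_cont f a b -> exists2 M : R, 0 <= M &
  forall t, 0 <= t -> t <= 1 -> nc (f (a + t%:C * (b - a))) <= M.
Proof.
move=> fc; pose P (x y : R) := exists2 M : R, 0 <= M & forall t, x <= t -> t <= y ->
  nc (f (a + t%:C * (b - a))) <= M.
apply: (@cousin R P).
  move=> x y u _ _ _ _ [M M0 hM] [N N0 hN]; exists (M + N); first exact: addr_ge0.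
  move=> t xt tu; have [ty|/ltW yt] := lerP t y.
    by apply: le_trans (hM _ xt ty) _; rewrite lerDl.
  by apply: le_trans (hN _ yt tu) _; rewrite lerDr.
move=> t t0 t1.
have : ccont t (fun s => f (a + s%:C * (b - a))).
  by apply: (ccont_comp (@line_cont R a b t)); exact: fc.
move=> /ccont_RP/(_ 1 ltr01)[d d0 fd]; exists d => // x y x0 xt ty y1 xy.
exists (nc (f (a + t%:C * (b - a))) + 1); first by rewrite addr_ge0// nc_ge0.
move=> s xs sy; apply: le_trans (ncBD _ (f (a + t%:C * (b - a)))) _.
rewrite lerD2l; apply/ltW/fd; rewrite ltr_norml; apply/andP; split; lra.
Qed.

(** Differentiation under the integral sign: the quadratic remainder is uniform along the segment,
    which explicit rational kernels provide. *)
Lemma seg_param (h : R[i] -> R[i] -> R[i]) h' a b z0 (K d : R) : 0 < d -> 0 <= K ->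
  (forall z, nc (z - z0) < d -> seg_cont (h z) a b) -> seg_cont h' a b ->
  (forall z t, nc (z - z0) < d -> 0 <= t -> t <= 1 ->
    let u := a + t%:C * (b - a) in
    nc (h z u - h z0 u - (z - z0) * h' u) <= K * nc (z - z0) ^+ 2) ->
  cder (fun z => seg (h z) a b) z0 (seg h' a b).
Proof.
move=> d0 K0 hc h'c hK; apply: cderI => e e0.
pose Q := K * nc (b - a) + 1.
have Q0 : 0 < Q by rewrite ltr_wpDl// mulr_ge0// nc_ge0.
exists (Num.min d (e / Q)); first by rewrite lt_min d0 divr_gt0.
move=> z; rewrite lt_min => /andP[zd ze].
have z0d : nc (z0 - z0) < d by rewrite subrr nc0.
rewrite mulrC -segZ// -segB; [|exact: hc|exact: hc].
rewrite -segB; [|by apply: seg_contB; apply: hc|exact: seg_contZ].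
apply: le_trans (@seg_bound _ _ _ _ (K * nc (z - z0) ^+ 2) _ _) _.
- apply: seg_contB; last exact: seg_contZ.
  by apply: seg_contB; apply: hc.
- by move=> t t0 t1; exact: hK.
have n0 := nc_ge0 (z - z0); have b0 := nc_ge0 (b - a).
have -> : K * nc (z - z0) ^+ 2 * nc (b - a) =
  (K * nc (b - a) * nc (z - z0)) * nc (z - z0) by ring.
apply: ler_wpM2r => //; move: ze; rewrite ltr_pdivlMr// => ze.
rewrite /Q in ze; lra.
Qed.

Lemma ler_ncV (x : R[i]) (m : R) : 0 < m -> m <= nc x -> nc x^-1 <= m^-1.
Proof. by move=> m0 mx; rewrite ncV lef_pV2// posrE (lt_le_trans m0). Qed.

Lemma nc_neq0 (x : R[i]) (m : R) : 0 < m -> m <= nc x -> x != 0.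
Proof. by move=> m0 mx; rewrite -nc_gt0 (lt_le_trans m0). Qed.

Section kernel.
Variables (f : R[i] -> R[i]) (a b z0 : R[i]) (m : R).
Hypotheses (m0 : 0 < m) (fc : seg_cont f a b).
Hypothesis far : forall t, 0 <= t -> t <= 1 -> m <= nc (a + t%:C * (b - a) - z0).

Let m2 : 0 < m / 2. Proof. by rewrite divr_gt0. Qed.

Let far2 z t : nc (z - z0) < m / 2 -> 0 <= t -> t <= 1 ->
  m / 2 <= nc (a + t%:C * (b - a) - z).
Proof.
move=> zm t0 t1; have := far t0 t1; have := ncD (a + t%:C * (b - a) - z) (z - z0).
rewrite subrKA; lra.
Qed.

Let inv_cont n z : nc (z - z0) < m / 2 ->
  seg_cont (fun u => f u * ((u - z) ^+ n)^-1) a b.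
Proof.
move=> zm t t0 t1; apply: ccontM; first exact: fc.
have u0 := nc_neq0 m2 (far2 zm t0 t1).
apply: ccontV; first exact: expf_neq0.
elim: n => [|n IH]; first exact: ccont_cst.
rewrite (_ : (fun u => (u - z) ^+ n.+1) = (fun u => (u - z) * (u - z) ^+ n)).
  by apply: ccontM => //; apply: ccontB; [exact: ccont_id|exact: ccont_cst].
by apply/funext => u; rewrite exprS.
Qed.

Lemma kernel1_der :
  cder (fun z => seg (fun u => f u * ((u - z) ^+ 1)^-1) a b) z0
    (seg (fun u => f u * ((u - z0) ^+ 2)^-1) a b).
Proof.
have [M M0 fM] := seg_bounded fc.
have z00 : nc (z0 - z0) < m / 2 by rewrite subrr nc0.
apply: (@seg_param _ _ _ _ _ (M * (2 / m) * (m^-1 * m^-1)) (m / 2)) => //.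
- by rewrite !mulr_ge0// ?invr_ge0// ltW.
- by move=> z; exact: inv_cont.
- exact: inv_cont.
move=> z t zm t0 t1; cbv zeta; set u := a + _; have A0 := nc_neq0 m0 (far t0 t1).
have B0 := nc_neq0 m2 (far2 zm t0 t1); rewrite -/u in A0 B0.
have -> : f u / (u - z) ^+ 1 - f u / (u - z0) ^+ 1 - (z - z0) * (f u / (u - z0) ^+ 2)
   = f u * (u - z)^-1 * ((u - z0)^-1 * (u - z0)^-1) * (z - z0) ^+ 2.
  by rewrite !expr1; field; apply/andP.
rewrite ncM ncX ler_wpM2r ?exprn_ge0 ?nc_ge0// !ncM.
have iA := ler_ncV m0 (far t0 t1); have iB := ler_ncV m2 (far2 zm t0 t1).
rewrite -/u invf_div in iA iB.
by rewrite !ler_pM ?mulr_ge0 ?nc_ge0// fM.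
Qed.

Lemma kernel2_der :
  cder (fun z => seg (fun u => f u * ((u - z) ^+ 2)^-1) a b) z0
    (seg (fun u => 2 * (f u * ((u - z0) ^+ 3)^-1)) a b).
Proof.
have [M M0 fM] := seg_bounded fc.
have z00 : nc (z0 - z0) < m / 2 by rewrite subrr nc0.
pose q := m^-1; pose q2 := 2 / m.
have q0 : 0 <= q by rewrite invr_ge0 ltW.
have q20 : 0 <= q2 by rewrite mulr_ge0.
apply: (@seg_param _ _ _ _ _ (M * (q * q * (q2 * q2) + 2 * (q * q * q * q2))) (m / 2)) => //.
- by rewrite mulr_ge0// addr_ge0// !mulr_ge0.
- by move=> z; exact: inv_cont.
- by apply: seg_contZ; exact: inv_cont.
move=> z t zm t0 t1; cbv zeta; set u := a + _; have A0 := nc_neq0 m0 (far t0 t1).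
have B0 := nc_neq0 m2 (far2 zm t0 t1); rewrite -/u in A0 B0.
pose A := (u - z0)^-1; pose B := (u - z)^-1.
have -> : f u / (u - z) ^+ 2 - f u / (u - z0) ^+ 2 - (z - z0) * (2 * (f u / (u - z0) ^+ 3))
   = f u * (A * A * (B * B) + 2 * (A * A * A * B)) * (z - z0) ^+ 2.
  by rewrite /A /B; field; apply/andP.
rewrite ncM ncX ler_wpM2r ?exprn_ge0 ?nc_ge0// ncM.
have iA : nc A <= q := ler_ncV m0 (far t0 t1).
have iB : nc B <= q2 by have := ler_ncV m2 (far2 zm t0 t1); rewrite invf_div.
rewrite ler_pM ?nc_ge0 ?fM//; apply: le_trans (ncD _ _) _; rewrite !ncM.
have -> : nc (2 : R[i]) = 2.
  by rewrite -(rmorph_nat (real_complex R)) nc_real ger0_norm.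
by rewrite lerD ?ler_wpM2l ?ler_pM ?mulr_ge0 ?nc_ge0.
Qed.
End kernel.

(** The vertices, counterclockwise, of the square of half-side [r] centred at [p]. A square keeps
    contour integrals within the calculus of segments, and the powers of ['i] treat its four sides
    alike. *)
Definition corner p r (k : nat) : R[i] := p + r%:C * ('i ^+ k * (1 - 'i)).

Definition oint f p r := seg f (corner p r 0) (corner p r 1) +
  seg f (corner p r 1) (corner p r 2) + seg f (corner p r 2) (corner p r 3) +
  seg f (corner p r 3) (corner p r 4).

Lemma sqr_iC : 'i * 'i = -1 :> R[i].
Proof. by rewrite -expr2 sqr_i. Qed.

Lemma corner4 p r : corner p r 4 = corner p r 0.
Proof.
by rewrite /corner (exprM _ 2 2) sqr_i sqrrN expr1n expr0.
Qed.

Lemma edgeE p r k t : corner p r k + t%:C * (corner p r k.+1 - corner p r k) =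
  p + r%:C * 'i ^+ k * (1 + 'i * (2 * t - 1)%:C).
Proof.
rewrite /corner rmorphB rmorphM /= rmorph1 rmorph_nat exprS.
have := sqr_iC; move: ('i ^+ k) => I.
move=> ii; apply/eqP; rewrite -subr_eq0; apply/eqP.
transitivity ((1 + 'i * 'i) * (- t%:C * r%:C * I) : R[i]); first ring.
by rewrite ii subrr mul0r.
Qed.

Lemma edge_len p r k : 0 <= r -> nc (corner p r k.+1 - corner p r k) = 2 * r.
Proof.
move=> r0; have -> : corner p r k.+1 - corner p r k = (2 * r)%:C * ('i ^+ k * 'i).
  rewrite /corner rmorphM /= rmorph_nat exprS.
  have := sqr_iC; move: ('i ^+ k) => I ii; apply/eqP; rewrite -subr_eq0; apply/eqP.
  transitivity ((1 + 'i * 'i) * (- r%:C * I) : R[i]); first ring.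
  by rewrite ii subrr mul0r.
by rewrite !ncM nc_real ncX nc_i expr1n !mulr1 ger0_norm// mulr_ge0.
Qed.

Lemma edge_dist p r k t : 0 <= r -> 0 <= t -> t <= 1 ->
  r <= nc (corner p r k + t%:C * (corner p r k.+1 - corner p r k) - p) <= 2 * r.
Proof.
move=> r0 t0 t1; rewrite edgeE addrAC subrr add0r !ncM ncX nc_i expr1n mulr1.
rewrite nc_real ger0_norm// mulrC.
have l : 1 <= nc (1 + 'i * (2 * t - 1)%:C).
  apply: le_trans (ler_Re_nc _); rewrite /= !(mul0r, mul1r, subr0, addr0, mulr0).
  by rewrite normr1.
have u : nc (1 + 'i * (2 * t - 1)%:C) <= 2.
  apply: le_trans (ncD _ _) _; rewrite nc1 ncM nc_i mul1r nc_real.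
  have : `|2 * t - 1| <= 1 by rewrite ler_norml; apply/andP; split; lra.
  lra.
by apply/andP; split; nra.
Qed.

Lemma oint_primitive F f p r :
  (forall k t, 0 <= t -> t <= 1 ->
    let u := corner p r k + t%:C * (corner p r k.+1 - corner p r k) in
    cder F u (f u)) ->
  oint f p r = 0.
Proof.
move=> h; have e k : seg f (corner p r k) (corner p r k.+1) =
    F (corner p r k.+1) - F (corner p r k).
  by apply: seg_FTC => t t0 t1; exact: h.
by rewrite /oint !e corner4; ring.
Qed.

(** By rotation and scaling all sides contribute the same number [E]. On the side [1 + 'i s] with
    [|s| <= 1] the function [u^-1] differs from 1 by at most 3/4, so [E] is within 3/2 of
    [2 * 'i]. *)
Lemma oint_inv_center p r : 0 < r -> oint (fun u => 1 * ((u - p) ^+ 1)^-1) p r != 0.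
Proof.
move=> r0; pose E := seg (fun u : R[i] => u^-1) (1 - 'i) (1 + 'i).
have rC : r%:C != 0 :> R[i].
  by rewrite -(rmorph0 (real_complex R)) (inj_eq (@complexI R)) gt_eqF.
have i0 : ('i : R[i]) != 0 by rewrite -nc_eq0 nc_i oner_eq0.
have l1 t : 1 <= nc (1 + 'i * (2 * t - 1)%:C : R[i]).
  apply: le_trans (ler_Re_nc _); rewrite /= !(mul0r, mul1r, subr0, addr0, mulr0).
  by rewrite normr1.
have n0 t : (1 + 'i * (2 * t - 1)%:C : R[i]) != 0.
  exact: nc_neq0 ltr01 (l1 t).
have eE k : seg (fun u => 1 * ((u - p) ^+ 1)^-1) (corner p r k) (corner p r k.+1) = E.
  rewrite /E /seg; congr (xget 0 _).
  have same t : 1 * ((corner p r k + t%:C * (corner p r k.+1 - corner p r k) - p) ^+ 1)^-1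
      * (corner p r k.+1 - corner p r k) =
      (1 - 'i + t%:C * (1 + 'i - (1 - 'i)))^-1 * (1 + 'i - (1 - 'i)).
    rewrite edgeE expr1 addrAC subrr add0r mul1r.
    have -> : corner p r k.+1 - corner p r k = r%:C * 'i ^+ k * (2 * 'i).
      rewrite /corner exprS.
      have := sqr_iC; move: ('i ^+ k) => I ii; apply/eqP; rewrite -subr_eq0; apply/eqP.
      transitivity ((1 + 'i * 'i) * (- r%:C * I) : R[i]); first ring.
      by rewrite ii subrr mul0r.
    have -> : 1 - 'i + t%:C * (1 + 'i - (1 - 'i)) = 1 + 'i * (2 * t - 1)%:C.
      by rewrite rmorphB rmorphM /= rmorph1 rmorph_nat; ring.
    have -> : 1 + 'i - (1 - 'i) = 2 * 'i :> R[i] by ring.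
    have Ik : ('i ^+ k : R[i]) != 0 by rewrite expf_neq0.
    have := n0 t; move: Ik; move: ('i ^+ k) (1 + _) => I J I0 J0.
    by field; rewrite rC I0 J0.
  by apply/seteqP; split=> I [F h ->]; exists F => // t t0 t1; have := h t t0 t1;
    rewrite same.
have -> : oint (fun u => 1 * ((u - p) ^+ 1)^-1) p r = 4 * E.
  by rewrite /oint !eE; ring.
have two n : nc (n%:R : R[i]) = n%:R.
  by rewrite -(rmorph_nat (real_complex R)) nc_real ger0_norm.
rewrite mulf_neq0 ?pnatr_eq0//.
have lineE t : 1 - 'i + t%:C * (1 + 'i - (1 - 'i)) = 1 + 'i * (2 * t - 1)%:C :> R[i].
  by rewrite rmorphB rmorphM /= rmorph1 rmorph_nat; ring.
have Ec : seg_cont (fun u : R[i] => u^-1) (1 - 'i) (1 + 'i).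
  by move=> t _ _; rewrite lineE; apply: ccontV => //; exact: ccont_id.
have Oc : seg_cont (fun u : R[i] => 1) (1 - 'i) (1 + 'i).
  by move=> t _ _; exact: ccont_cst.
have : nc (E - 2 * 'i) <= 3 / 4 * nc (1 + 'i - (1 - 'i) : R[i]).
  have -> : 2 * 'i = seg (fun u : R[i] => 1) (1 - 'i) (1 + 'i).
    rewrite (@seg_FTC _ _ id) => [|t _ _]; first by ring.
    exact: cder_id.
  rewrite /E -segB//; apply: seg_bound; first exact: seg_contB.
  move=> t t0 t1; rewrite lineE; set s := 2 * t - 1.
  have -> : (1 + 'i * s%:C)^-1 - 1 = - ('i * s%:C) / (1 + 'i * s%:C).
    by field; exact: n0.
  rewrite ncM ncV ncN ncM nc_i mul1r nc_real ler_pdivrMr ?nc_gt0 ?n0//.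
  have s1 : `|s| <= 1 by rewrite ler_norml /s; apply/andP; split; lra.
  have p0 : 0 <= 3 / 4 * nc (1 + 'i * s%:C).
    by apply: mulr_ge0; [lra|exact: nc_ge0].
  rewrite -(@ler_pXn2r _ 2)// ?nnegrE//.
  rewrite exprMn.
  have -> : nc (1 + 'i * s%:C) ^+ 2 = 1 + s ^+ 2.
    rewrite /= !(mul0r, mul1r, subr0, addr0, mulr0, add0r).
    by rewrite sqr_sqrtr ?addr_ge0 ?sqr_ge0// expr1n.
  rewrite real_normK ?num_real//.
  have : s ^+ 2 <= 1 by rewrite -real_normK ?num_real// exprn_ile1.
  lra.
have -> : 1 + 'i - (1 - 'i) = 2 * 'i :> R[i] by ring.
move=> h; apply/eqP => E0; move: h; rewrite E0 sub0r ncN ncM nc_i two; lra.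
Qed.
End CauchyFormula.

(** * Derivatives, removable singularities and zeros of holomorphic functions *)

Section HolomorphicFunctions.
Variable R : realType.
Implicit Types (z w p : R[i]) (s t e r : R) (f g : R[i] -> R[i])
  (U : R[i] -> Prop).

Lemma divided_difference U f z : copen U -> holo U f -> U z ->
  exists k : R[i] -> R[i], [/\ forall u, U u -> ccont (u : R[i]^o) k,
    forall u, U u -> u != z -> exists v, cder k u v
  & forall w, f w - f z = k w * (w - z)].
Proof.
move=> Uo Uf Uz; have [v [k [kz kc kE]]] := Uf _ Uz; exists k.
have kd u : U u -> u != z -> exists v, cder k u v.
  move=> Uu uz; have [v' fv'] := Uf _ Uu; have uz0 : u - z != 0 by rewrite subr_eq0.
  have d1 : cder (fun u => u - z) u 1.
    by have := cderB (cder_id u) (cder_cst z u); rewrite subr0.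
  have d2 := cderB fv' (cder_cst (f z) u).
  eexists; apply: (@cder_eqd R (nc (u - z)) _ _ _ _ _ _
    (cderM d2 (@cderV R (fun u => u - z) u 1 uz0 d1))); first by rewrite nc_gt0.
  move=> w wu; rewrite kE mulfK// subr_eq0; apply/eqP => wz.
  by move: wu; rewrite wz ncB ltxx.
split => // u Uu; have [->//|uz] := eqVneq u z.
by have [v' /cder_cont] := kd u Uu uz.
Qed.

(** The divided difference of [f] at [z] has a primitive, hence integral 0 over the square. The
    integral of the bare kernel plays the part of 2 pi i. *)
Lemma cauchy_formula U f p r z : cconvex U -> copen U -> holo U f -> 0 < r ->
  (forall u, nc (u - p) <= 2 * r -> U u) -> nc (z - p) < r ->
  oint (fun u => f u * ((u - z) ^+ 1)^-1) p r =
  f z * oint (fun u => 1 * ((u - z) ^+ 1)^-1) p r.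
Proof.
move=> Uc Uo Uf r0 rU zp.
have Uz : U z by apply: rU; lra.
have [k [kc kd kE]] := divided_difference Uo Uf Uz.
have eU j t : 0 <= t -> t <= 1 ->
    U (corner p r j + t%:C * (corner p r j.+1 - corner p r j)).
  by move=> t0 t1; apply: rU; have /andP[] := @edge_dist R p r j t (ltW r0) t0 t1.
have ez j t : 0 <= t -> t <= 1 ->
    corner p r j + t%:C * (corner p r j.+1 - corner p r j) - z != 0.
  move=> t0 t1; have /andP[h _] := @edge_dist R p r j t (ltW r0) t0 t1.
  rewrite subr_eq0; apply/eqP => e; move: h; rewrite e; lra.
have k0 : oint k p r = 0.
  apply: (@oint_primitive R (seg k z)) => j t t0 t1 u.
  by apply: (seg_primitive Uc Uo Uz kc kd); exact: eU.
have fc j : seg_cont (fun u => f u * ((u - z) ^+ 1)^-1) (corner p r j) (corner p r j.+1).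
  move=> t t0 t1; apply: ccontM.
    by have [v /cder_cont] := Uf _ (eU j t t0 t1).
  apply: ccontV; rewrite ?expr1; first exact: ez.
  by apply: ccontB; [exact: ccont_id|exact: ccont_cst].
have oc j : seg_cont (fun u => 1 * ((u - z) ^+ 1)^-1) (corner p r j) (corner p r j.+1).
  move=> t t0 t1; apply: ccontM; first exact: ccont_cst.
  apply: ccontV; rewrite ?expr1; first exact: ez.
  by apply: ccontB; [exact: ccont_id|exact: ccont_cst].
have ke j : seg k (corner p r j) (corner p r j.+1) =
    seg (fun u => f u * ((u - z) ^+ 1)^-1) (corner p r j) (corner p r j.+1) -
    f z * seg (fun u => 1 * ((u - z) ^+ 1)^-1) (corner p r j) (corner p r j.+1).
  rewrite -segZ// -segB//; last exact: seg_contZ.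
  apply: eq_seg => t t0 t1; have u0 := ez j t t0 t1; rewrite expr1.
  by apply: (mulIf u0); rewrite -kE; field.
apply/eqP; rewrite -subr_eq0 -{}k0 /oint !ke; apply/eqP; ring.
Qed.

Lemma edge_far p r z : 0 < r -> nc (z - p) < r -> forall k t, 0 <= t -> t <= 1 ->
  r - nc (z - p) <= nc (corner p r k + t%:C * (corner p r k.+1 - corner p r k) - z).
Proof.
move=> r0 zp k t t0 t1; have /andP[h _] := @edge_dist R p r k t (ltW r0) t0 t1.
set u := corner p r k + _ in h *.
have := ncD (u - z) (z - p); rewrite subrKA; lra.
Qed.

Lemma oint1_der f p r z : 0 < r -> nc (z - p) < r ->
  (forall k, seg_cont f (corner p r k) (corner p r k.+1)) ->
  cder (fun z => oint (fun u => f u * ((u - z) ^+ 1)^-1) p r) z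
    (oint (fun u => f u * ((u - z) ^+ 2)^-1) p r).
Proof.
move=> r0 zp fc; have m0 : 0 < r - nc (z - p) by rewrite subr_gt0.
have K k := kernel1_der m0 (fc k) (@edge_far p r z r0 zp k).
exact: (cderD (cderD (cderD (K 0%N) (K 1%N)) (K 2%N)) (K 3%N)).
Qed.

Lemma oint2_der f p r z : 0 < r -> nc (z - p) < r ->
  (forall k, seg_cont f (corner p r k) (corner p r k.+1)) ->
  exists v, cder (fun z => oint (fun u => f u * ((u - z) ^+ 2)^-1) p r) z v.
Proof.
move=> r0 zp fc; have m0 : 0 < r - nc (z - p) by rewrite subr_gt0.
have K k := kernel2_der m0 (fc k) (@edge_far p r z r0 zp k).
eexists; exact: (cderD (cderD (cderD (K 0%N) (K 1%N)) (K 2%N)) (K 3%N)).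
Qed.

Lemma seg_cont_cst (c : R[i]) a b : seg_cont (fun=> c) a b.
Proof. by move=> t _ _; exact: ccont_cst. Qed.

(** By the integral formula [f] is the quotient of [n] and [c] near [p]. Both can be differentiated
    twice under the integral sign, so the quotient rule expresses [f'] by functions that are
    differentiable at [p]. *)
Lemma holo_derive U f f' : copen U -> (forall z, U z -> cder f z (f' z)) ->
  holo U f'.
Proof.
move=> Uo Uf p Up; have [d d0 dU] := Uo _ Up.
pose B z := nc (z - p) < d; have Bc : cconvex B by exact: oball_convex.
have Bo : copen B by exact: oball_open.
have Bf : holo B f by move=> z /dU Uz; exists (f' z); exact: Uf.
pose r := d / 3; have r0 : 0 < r by rewrite divr_gt0.
have rB u : nc (u - p) <= 2 * r -> B u by rewrite /B /r; lra.
pose n z := oint (fun u => f u * ((u - z) ^+ 1)^-1) p r.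
pose n' z := oint (fun u => f u * ((u - z) ^+ 2)^-1) p r.
pose c z := oint (fun u => 1 * ((u - z) ^+ 1)^-1) p r.
pose c' z := oint (fun u => 1 * ((u - z) ^+ 2)^-1) p r.
have fc k : seg_cont f (corner p r k) (corner p r k.+1).
  move=> t t0 t1; have /andP[_ h] := @edge_dist R p r k t (ltW r0) t0 t1.
  by have [v /cder_cont] := Bf _ (rB _ h).
have nd z : nc (z - p) < r -> cder n z (n' z) by move=> zp; exact: oint1_der.
have cd z : nc (z - p) < r -> cder c z (c' z).
  by move=> zp; apply: (@oint1_der (fun=> 1)) => // k; exact: seg_cont_cst.
have pp : nc (p - p) < r by rewrite subrr nc0.
have [vn n'd] : exists v, cder n' p v by exact: oint2_der.
have [vc c'd] : exists v, cder c' p v.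
  by apply: (@oint2_der (fun=> 1)) => // k; exact: seg_cont_cst.
have cp : c p != 0 by exact: oint_inv_center.
have [e e0 ce] : exists2 e, 0 < e & forall z, nc (z - p) < e -> c z != 0.
  have /ccontP/(_ (nc (c p))) := cder_cont (cd p pp).
  rewrite nc_gt0 => /(_ cp)[e e0 h]; exists e => // z /h.
  by apply: contraTneq => ->; rewrite sub0r ncN ltxx.
pose m := Num.min e r; have m0 : 0 < m by rewrite lt_min e0.
have f'E z : nc (z - p) < m ->
    f' z = (n' z) * (c z)^-1 + n z * (- c' z / c z ^+ 2).
  rewrite lt_min => /andP[ze zr].
  have h := cderM (nd _ zr) (cderV (ce z ze) (cd _ zr)).
  apply: (@cder_unique R f z) => //.
    by apply: Uf; apply: dU; rewrite /r in zr; lra.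
  apply: (@cder_eqd R (m - nc (z - p)) _ _ _ _ _ _ h).
    by rewrite subr_gt0 lt_min ze.
  move=> w wz; have wp : nc (w - p) < m.
    have := ncD (w - z) (z - p); rewrite subrKA; lra.
  move: wp; rewrite lt_min => /andP[we wr].
  by rewrite /n (cauchy_formula Bc Bo Bf r0 rB wr) mulfK// ce.
have d1 := cderM n'd (cderV cp (cd p pp)).
have d2 := cderM (cd p pp) (cd p pp).
have cc : c p * c p != 0 by rewrite mulf_neq0.
have d3 := cderM (nd p pp) (cderM (cderN c'd) (@cderV R (fun w => c w * c w) p _ cc d2)).
eexists; apply: (@cder_eqd R m _ _ _ _ _ _ (cderD d1 d3)) => // z zm.
by rewrite f'E// expr2.
Qed.

Lemma cder_holo U f : copen U -> holo U f -> exists2 f' : R[i] -> R[i],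
  holo U f' & forall z, U z -> cder f z (f' z).
Proof.
move=> Uo Uf; have : forall z, exists v, U z -> cder f z v.
  by move=> z; have [/Uf[v]|nU] := pselect (U z); [exists v|exists 0].
move=> /choice[f' fE]; exists f' => //; exact: (@holo_derive U f f' Uo fE).
Qed.

Lemma holo_primitive U f p : cconvex U -> copen U -> U p -> holo U f ->
  forall z, U z -> cder (seg f p) z (f z).
Proof.
move=> Uc Uo Up Uf; apply: seg_primitive => // u Uu; last by move=> _; exact: Uf.
by have [v /cder_cont] := Uf u Uu.
Qed.

(** Morera's argument: the primitive based at [p] exists although [f] is only continuous at [p], and
    [f] is its derivative. *)
Lemma removable U f p : copen U -> ccont (p : R[i]^o) f ->
  (forall u, U u -> u != p -> exists v, cder f u v) -> holo U f.
Proof.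
move=> Uo fp fd z Uz; have [zp|zp] := eqVneq z p; last exact: fd.
rewrite zp in Uz *; have [d d0 dU] := Uo _ Uz.
pose B u := nc (u - p) < d; have Bc : cconvex B by exact: oball_convex.
have Bo : copen B by exact: oball_open.
have Bp : B p by rewrite /B subrr nc0.
have h := @seg_primitive R B f p Bc Bo Bp.
apply: (@holo_derive B (seg f p) f) => // u Bu; apply: h => // v Bv.
  have [->//|vp] := eqVneq v p.
  by have [v' /cder_cont] := fd v (dU _ Bv) vp.
by move=> vp; exact: fd (dU _ Bv) vp.
Qed.

Lemma holo_factor U f p : copen U -> holo U f -> U p -> f p = 0 ->
  exists2 g, holo U g & forall w, f w = (w - p) * g w.
Proof.
move=> Uo Uf Up fp; have [k [kc kd kE]] := divided_difference Uo Uf Up.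
exists k; first by apply: (removable Uo (kc _ Up)).
by move=> w; rewrite mulrC -kE fp subr0.
Qed.

(** [C] and [d] are fixed before [f], so that the estimate can be applied to all the quotients of
    one function by powers of [w - p]. *)
Lemma cauchy_bound p r : 0 < r -> exists C d : R, [/\ 0 <= C, 0 < d &
  forall f M, holo (fun u => nc (u - p) < 3 * r) f -> 0 <= M ->
    (forall k t, 0 <= t -> t <= 1 ->
      nc (f (corner p r k + t%:C * (corner p r k.+1 - corner p r k))) <= M) ->
    forall z, nc (z - p) < d -> nc (f z) <= C * M].
Proof.
move=> r0; pose c z := oint (fun u => 1 * ((u - z) ^+ 1)^-1) p r.
have cp : 0 < nc (c p) by rewrite nc_gt0; exact: oint_inv_center.
have pp : nc (p - p) < r by rewrite subrr nc0.
have cc : ccont (p : R[i]^o) c.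
  apply: cder_cont; apply: (@oint1_der (fun=> 1)) => // k; exact: seg_cont_cst.
have c2 : 0 < nc (c p) / 2 by rewrite divr_gt0.
have /ccontP/(_ _ c2)[d d0 cd] := cc.
(* Each side has length [2 r] and distance at least [r / 2] from [z], so it contributes at most
   [4 M]. Together with [nc (c z) >= nc (c p) / 2] this gives [32 = 2 * 16]. *)
exists (32 / nc (c p)), (Num.min d (r / 2)); split.
- by rewrite divr_ge0// ltW.
- by rewrite lt_min d0 divr_gt0.
move=> f M Bf M0 fM z; rewrite lt_min => /andP[zd zr2].
pose B z := nc (z - p) < 3 * r.
have Bc : cconvex B by exact: oball_convex.
have Bo : copen B by exact: oball_open.
have rB u : nc (u - p) <= 2 * r -> B u by rewrite /B; lra.
have zr : nc (z - p) < r by lra.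
have cf := cauchy_formula Bc Bo Bf r0 rB zr; rewrite -/(c z) in cf.
have cz : nc (c p) / 2 <= nc (c z).
  have := cd z zd; rewrite ncB => h; have := ncBD (c p) (c z); lra.
have e k : nc (seg (fun u => f u * ((u - z) ^+ 1)^-1) (corner p r k) (corner p r k.+1))
    <= 4 * M.
  have -> : 4 * M = M * (r / 2)^-1 * (2 * r) by field; rewrite gt_eqF.
  rewrite -(@edge_len R p r k (ltW r0)).
  have far t : 0 <= t -> t <= 1 -> r / 2 <=
      nc (corner p r k + t%:C * (corner p r k.+1 - corner p r k) - z).
    by move=> t0 t1; have := @edge_far p r z r0 zr k t t0 t1; lra.
  have r20 : 0 < r / 2 by rewrite divr_gt0.
  apply: seg_bound => t t0 t1.
    apply: ccontM.
      have /andP[_ h] := @edge_dist R p r k t (ltW r0) t0 t1.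
      by have [v /cder_cont] := Bf _ (rB _ h).
    apply: ccontV; first by rewrite expr1; exact: nc_neq0 r20 (far t t0 t1).
    by apply: ccontB; [exact: ccont_id|exact: ccont_cst].
  by rewrite ncM expr1 ler_pM ?nc_ge0 ?fM// ler_ncV// far.
have : nc (f z) * nc (c z) <= 16 * M.
  rewrite -ncM -cf /oint; apply: le_trans (ncD _ _) _.
  have := ncD3 (seg (fun u => f u * ((u - z) ^+ 1)^-1) (corner p r 0) (corner p r 1))
    (seg (fun u => f u * ((u - z) ^+ 1)^-1) (corner p r 1) (corner p r 2))
    (seg (fun u => f u * ((u - z) ^+ 1)^-1) (corner p r 2) (corner p r 3)).
  have := e 0%N; have := e 1%N; have := e 2%N; have := e 3%N; lra.
move=> h; have : nc (f z) * (nc (c p) / 2) <= 16 * M.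
  by apply: le_trans h; rewrite ler_wpM2l// nc_ge0.
rewrite mulrA ler_pdivrMr// => h2.
have -> : 32 / nc (c p) * M = 16 * M * 2 / nc (c p) by field; rewrite gt_eqF.
by rewrite ler_pdivlMr.
Qed.

(* If [f] vanished to infinite order at [p], the factors [f / (w - p)^n] would
   grow too slowly for Cauchy's estimate. *)
Lemma isolated_zeros U f p : copen U -> holo U f -> U p ->
  (exists2 d : R, 0 < d & forall w, nc (w - p) < d -> f w = 0) \/
  (exists2 d : R, 0 < d & forall w, nc (w - p) < d -> w != p -> f w != 0).
Proof.
move=> Uo Uf Up; have [|nisol] := pselect (exists2 d : R, 0 < d &
  forall w, nc (w - p) < d -> w != p -> f w != 0); first by right.
left; have zeros (d : R) : 0 < d -> exists w, [/\ nc (w - p) < d, w != p & f w = 0].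
  move=> d0; apply: contrapT => nw; apply: nisol; exists d => // w wd wp.
  by apply/eqP => fw; apply: nw; exists w.
have fac n : exists2 g, holo U g & forall w, f w = (w - p) ^+ n * g w.
  elim: n => [|n [g gU gE]]; first by exists f => // w; rewrite expr0 mul1r.
  have gp : g p = 0.
    have [v /cder_cont/ccontP gc] := gU _ Up.
    apply: nc_le_eq => e e0; have [d d0 dg] := gc _ e0.
    have [w [wd wp fw]] := zeros _ d0; rewrite ncB sub0r.
    have := dg _ wd; suff -> : g w = 0 by rewrite sub0r ncN => /ltW.
    have := gE w; rewrite fw => /esym/eqP; rewrite mulf_eq0 => /orP[|/eqP//].
    by rewrite expf_eq0 subr_eq0 (negPf wp) andbF.
  have [h hU hE] := holo_factor Uo gU Up gp; exists h => // w.
  by rewrite gE hE mulrA exprSr.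
have [d0' d'0 dU] := Uo _ Up; pose r := d0' / 3.
have r0 : 0 < r by rewrite divr_gt0.
have [C [d [C0 d0 bnd]]] := cauchy_bound p r0.
have [M M0 fM] : exists2 M : R, 0 <= M & forall k t, 0 <= t -> t <= 1 ->
    nc (f (corner p r k + t%:C * (corner p r k.+1 - corner p r k))) <= M.
  have fb k : exists2 M : R, 0 <= M & forall t, 0 <= t -> t <= 1 ->
      nc (f (corner p r k + t%:C * (corner p r k.+1 - corner p r k))) <= M.
    apply: seg_bounded => t t0 t1.
    have /andP[_ h] := @edge_dist R p r k t (ltW r0) t0 t1.
    have [|v /cder_cont//] := Uf (corner p r k + t%:C * (corner p r k.+1 - corner p r k)).
    by apply: dU; rewrite /r in h *; lra.
  have [M0 M00 h0] := fb 0%N; have [M1 M10 h1] := fb 1%N.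
  have [M2 M20 h2] := fb 2%N; have [M3 M30 h3] := fb 3%N.
  (* The bound is demanded for every [k : nat]; periodicity reduces it to the four sides. *)
  have per k : corner p r (k + 4) = corner p r k.
    by rewrite /corner exprD (exprM _ 2 2) sqr_i sqrrN expr1n mulr1.
  exists (M0 + M1 + M2 + M3); first by rewrite !addr_ge0.
  move=> k; elim/ltn_ind: k => -[|[|[|[|k]]]] IH t t0 t1.
  - by have := h0 t t0 t1; lra.
  - by have := h1 t t0 t1; lra.
  - by have := h2 t t0 t1; lra.
  - by have := h3 t t0 t1; lra.
  - have k4 : (k < k.+4)%N by rewrite ltnS; do 3!apply: leqW.
    have := per k; have := per k.+1; rewrite !addn4 => -> ->.
    exact: IH k4 t t0 t1.
exists (Num.min d (r / 2)); first by rewrite lt_min d0 divr_gt0.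
move=> w; rewrite lt_min => /andP[wd wr]; rewrite -[RHS]subr0.
(* At [w] the factor [(w - p)^n] is at most [(r / 2)^n], whereas on the contour it is at least
   [r^n]. *)
suff h n : nc (f w) <= C * M * 2^-1 ^+ n.
  apply/eqP; rewrite subr0 -nc_eq0 eq_le nc_ge0 andbT -oppr_ge0.
  by apply: (@half_power_ge0 R (- nc (f w)) (C * M)) => n; rewrite opprK.
have [g gU gE] := fac n.
have rn0 : 0 < r ^+ n by exact: exprn_gt0.
have gb k t : 0 <= t -> t <= 1 ->
    nc (g (corner p r k + t%:C * (corner p r k.+1 - corner p r k))) <= M / r ^+ n.
  move=> t0 t1; have /andP[l _] := @edge_dist R p r k t (ltW r0) t0 t1.
  have := fM k t t0 t1; rewrite gE ncM ncX; set x := nc (_ - p) in l *.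
  set y := nc (g _) => h; rewrite ler_pdivlMr// mulrC; apply: le_trans h.
  rewrite ler_wpM2r ?nc_ge0//; apply: lerXn2r => //; rewrite nnegrE ?(ltW r0)//.
  exact: nc_ge0.
have gz := bnd g (M / r ^+ n) _ _ gb w wd.
rewrite gE ncM ncX; apply: (@le_trans _ _ ((r / 2) ^+ n * (C * (M / r ^+ n)))).
  apply: ler_pM; rewrite ?exprn_ge0 ?nc_ge0//.
    by apply: lerXn2r; rewrite ?nnegrE ?nc_ge0 ?divr_ge0 ?(ltW r0)// ltW.
  apply: gz; last by rewrite divr_ge0// ltW.
  by move=> u ub; apply: gU; apply: dU; rewrite /r in ub; lra.
rewrite expr_div_n exprVn le_eqVlt; apply/orP; left; apply/eqP.
by field; rewrite !expf_neq0// gt_eqF.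
Qed.
End HolomorphicFunctions.

(** * Holomorphic forms and their primitives *)
Section LocalTheory.
Variables (R : realType) (X : curve R).
Implicit Types (i j : chart X) (x y : X) (H K : X -> R[i])
  (w : chart X -> X -> R[i]^o).

Lemma param_nbhs i x (A : set X) : chart_dom i x -> nbhs x A ->
  exists2 d : R, 0 < d & forall u, nc (u - chart_coord i x) < d ->
    [/\ chart_dom i (chart_param i u), chart_coord i (chart_param i u) = u
      & A (chart_param i u)].
Proof.
move=> ix xA.
have /nbhs_ncP[d d0 hd] : nbhs (chart_coord i x) (chart_coord i @` chart_dom i).
  by apply: open_nbhs_nbhs; split; [exact: codom_open|exists x].
have pA : nbhs (chart_param i (chart_coord i x)) A by rewrite (coordK ix).
have /nbhs_ncP[e e0 he] := param_continuous ix pA.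
exists (Num.min d e); first by rewrite lt_min d0.
move=> u; rewrite lt_min => /andP[/hd[y iy yu] /he uA].
by split => //; rewrite -yu (coordK iy).
Qed.

Definition disc i x (d : R) : set X :=
  [set y | chart_dom i y /\ nc (chart_coord i y - chart_coord i x) < d].

Lemma disc_open i x d : open (disc i x d).
Proof.
rewrite openE => y [iy yd].
have h1 : nbhs y (chart_dom i) by apply: open_nbhs_nbhs; split => //; exact: dom_open.
have h2 : nbhs (chart_coord i y) [set u : R[i]^o | nc (u - chart_coord i x) < d].
  apply/nbhs_ncP; have [e e0 he] := @oball_open R (chart_coord i x) d _ yd.
  by exists e.
have h3 := Defs.coord_continuous iy h2.
by apply: filterS2 h1 h3 => z iz /= zd; split.
Qed.

(** The chart maps [D] onto a full round disc. Convexity of that disc gives primitives of forms, and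
    their uniqueness up to a constant. *)
Definition nice (D : set X) x := exists i d, [/\ 0 < d, chart_dom i x,
  D = disc i x d & forall u, nc (u - chart_coord i x) < d ->
    chart_dom i (chart_param i u) /\ chart_coord i (chart_param i u) = u].

Lemma nice_open D x : nice D x -> open D.
Proof. by move=> [i [d [_ _ -> _]]]; exact: disc_open. Qed.

Lemma nice_center D x : nice D x -> D x.
Proof. by move=> [i [d [d0 ix -> _]]]; split => //; rewrite subrr nc0. Qed.

Lemma nice_nbhs_center D x : nice D x -> nbhs x D.
Proof.
move=> h; apply: open_nbhs_nbhs; split; [exact: nice_open h|exact: nice_center h].
Qed.

Lemma nice_basis x (A : set X) : nbhs x A -> exists2 D, nice D x & D `<=` A.
Proof.
have [i ix] := dom_cover x => /(param_nbhs ix)[d d0 h]; exists (disc i x d).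
  by exists i, d; split => // u /h[].
by move=> y [iy yd]; have [_ _] := h _ yd; rewrite (coordK iy).
Qed.

Definition dprim w x H := forall i, chart_dom i x ->
  cder (H \o chart_param i) (chart_coord i x) (w i x).

Definition hder x H := forall i, chart_dom i x ->
  exists v, cder (H \o chart_param i) (chart_coord i x) v.

Lemma transition_cder i j x : chart_dom i x -> chart_dom j x ->
  cder (chart_coord j \o chart_param i) (chart_coord i x)
    ('D_1 (chart_coord j \o chart_param i) (chart_coord i x)).
Proof.
move=> ix jx; apply: derivable_cder; exact: transition_holomorphic.
Qed.

Lemma cder_chart H i j x v : chart_dom i x -> chart_dom j x ->
  cder (H \o chart_param j) (chart_coord j x) v ->
  cder (H \o chart_param i) (chart_coord i x)
    (v * 'D_1 (chart_coord j \o chart_param i) (chart_coord i x)).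
Proof.
move=> ix jx hv.
have jn : nbhs x (chart_dom j) by apply: open_nbhs_nbhs; split => //; exact: dom_open.
have [d d0 h] := param_nbhs ix jn.
have tr := transition_cder ix jx.
have hv' : cder (H \o chart_param j)
    ((chart_coord j \o chart_param i) (chart_coord i x)) v.
  by rewrite /= (coordK ix).
apply: (cder_eqd d0 _ (cder_comp tr hv')) => u /h[_ _ ju].
by rewrite /= (coordK ju).
Qed.

Lemma hder_chart H j x v : chart_dom j x ->
  cder (H \o chart_param j) (chart_coord j x) v -> hder x H.
Proof.
move=> jx hv i ix; exists (v * 'D_1 (chart_coord j \o chart_param i) (chart_coord i x)).
exact: cder_chart hv.
Qed.

Lemma dprim_chart w H j x : is_holomorphic_form w -> chart_dom j x ->
  cder (H \o chart_param j) (chart_coord j x) (w j x) -> dprim w x H.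
Proof. by move=> [_ _ wt] jx hv i ix; rewrite (wt i j x)//; exact: cder_chart. Qed.

Lemma cder_near_eq H K i x v : chart_dom i x -> (\forall y \near x, H y = K y) ->
  cder (H \o chart_param i) (chart_coord i x) v ->
  cder (K \o chart_param i) (chart_coord i x) v.
Proof.
move=> ix HK; have [d d0 h] := param_nbhs ix HK.
by apply: cder_eqd d0 _ => u /h[].
Qed.

Lemma dprim_near w H K x : (\forall y \near x, H y = K y) -> dprim w x H -> dprim w x K.
Proof. by move=> HK wH i ix; exact: cder_near_eq HK (wH i ix). Qed.

Lemma dprimDc w H x c : dprim w x H -> dprim w x (fun y => H y + c).
Proof.
by move=> wH i ix; have := cderD (wH i ix) (cder_cst c _); rewrite addr0.
Qed.

Lemma dprim_hder w H x : dprim w x H -> hder x H.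
Proof. by move=> wH i ix; exists (w i x); exact: wH. Qed.

Lemma holo_formP (w : holo_form X) : is_holomorphic_form w.
Proof. by have /asboolP := form_coefP w. Qed.

Lemma holo_form_eq (w w' : holo_form X) :
  (forall x, exists2 H, dprim w x H & dprim w' x H) -> w = w'.
Proof.
move=> h; apply: val_inj; apply/funext => i; apply/funext => x /=.
have [ix|nix] := pselect (chart_dom i x); last first.
  by have [w0 _ _] := holo_formP w; have [w'0 _ _] := holo_formP w'; rewrite w0// w'0.
have [H wH w'H] := h x; exact: cder_unique (wH i ix) (w'H i ix).
Qed.

Lemma nice_primitive D x (w : holo_form X) : nice D x ->
  exists H, forall y, D y -> dprim w y H.
Proof.
move=> [i [d [d0 ix -> hd]]].
pose B (u : R[i]) := nc (u - chart_coord i x) < d.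
have Bc : cconvex B by exact: oball_convex.
have Bo : copen B by exact: oball_open.
have Bx : B (chart_coord i x) by rewrite /B subrr nc0.
have Bw : holo B (w i \o chart_param i).
  move=> u /hd[iu cu]; have [_ wd _] := holo_formP w.
  exists ('D_1 (w i \o chart_param i) u); apply: derivable_cder.
  by have := wd i _ iu; rewrite cu.
exists (seg (w i \o chart_param i) (chart_coord i x) \o chart_coord i).
move=> y [iy yd]; apply: (dprim_chart (holo_formP w) iy).
have := holo_primitive Bc Bo Bx Bw yd; rewrite /= (coordK iy).
have [e e0 he] := Bo _ yd.
by apply: cder_eqd e0 _ => u /he/hd[_ cu]; rewrite /= cu.
Qed.

Lemma nice_constant D x H : nice D x -> (forall y, D y -> dprim (fun _ _ => 0) y H) ->
  forall y z, D y -> D z -> H y = H z.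
Proof.
move=> [i [d [d0 ix -> hd]]] H0 y z [iy yd] [iz zd].
have Bc : cconvex (fun u => nc (u - chart_coord i x) < d) by exact: oball_convex.
have : seg (fun=> 0) (chart_coord i y) (chart_coord i z) =
   (H \o chart_param i) (chart_coord i z) - (H \o chart_param i) (chart_coord i y).
  apply: seg_FTC => t t0 t1; have ut := Bc _ _ _ yd zd t0 t1.
  have [iu cu] := hd _ ut; rewrite -[X in cder _ X _]cu; apply: H0 => //.
  by split => //; rewrite cu.
rewrite (@seg_FTC R _ (fun=> 0)) => [|t _ _]; last exact: cder_cst.
rewrite subrr /= (coordK iy) (coordK iz) => /esym/eqP.
by rewrite subr_eq0 => /eqP ->.
Qed.

Lemma dprimB w w' H H' x : dprim w x H -> dprim w' x H' ->
  dprim (fun i y => w i y - w' i y) x (fun y => H y - H' y).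
Proof. by move=> wH w'H i ix; exact: (cderB (wH i ix) (w'H i ix)). Qed.

Lemma dprimD w w' H H' x : dprim w x H -> dprim w' x H' ->
  dprim (fun i y => w i y + w' i y) x (fun y => H y + H' y).
Proof. by move=> wH w'H i ix; exact: (cderD (wH i ix) (w'H i ix)). Qed.

Lemma dprimZ w H x c : dprim w x H -> dprim (fun i y => c * w i y) x (fun y => c * H y).
Proof. by move=> wH i ix; exact: (cderZ c (wH i ix)). Qed.

Lemma nice_primitive_unique D x w H H' : nice D x ->
  (forall y, D y -> dprim w y H) -> (forall y, D y -> dprim w y H') ->
  forall y z, D y -> D z -> H z - H y = H' z - H' y.
Proof.
move=> nD wH wH' y z Dy Dz.
have h u : D u -> dprim (fun _ _ => 0) u (fun v => H v - H' v).
  move=> Du i iu; have := dprimB (wH u Du) (wH' u Du) iu.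
  by rewrite subrr.
have := nice_constant nD h Dy Dz => e; apply/eqP; rewrite -subr_eq0.
have -> : H z - H y - (H' z - H' y) = (H z - H' z) - (H y - H' y) by ring.
by rewrite e subrr.
Qed.

(** At [x] the coefficient is the derivative of the function [H x] attached to [x] itself. Since
    [H x] and [H y] differ by a constant near [y], it is also the derivative of [H x] throughout
    [U x], hence holomorphic by [holo_derive]. *)
Lemma glue_form (H : X -> X -> R[i]) (U : X -> set X) :
  (forall x, nbhs x (U x)) ->
  (forall x y, U x y -> hder y (H x)) ->
  (forall x y, U x y -> exists c, \forall z \near y, H x z = H y z + c) ->
  exists w : holo_form X, forall x y, U x y -> dprim w y (H x).
Proof.
move=> Ux UH Uc.
pose w i x : R[i]^o := if pselect (chart_dom i x) then
  'D_1 (H x \o chart_param i : R[i]^o -> R[i]^o) (chart_coord i x) else 0.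
have wE x y : U x y -> dprim w y (H x).
  move=> xy i iy; rewrite /w; case: pselect => // ?.
  have [c hc] := Uc _ _ xy; have yy := nbhs_singleton (Ux y).
  have [v hv] := UH _ _ yy i iy; rewrite (cder_derive hv).
  have /cderD/(_ (cder_cst c _)) := hv; rewrite addr0 => h.
  apply: (cder_near_eq iy _ h).
  by apply: filterS hc => z ->.
have wh : is_holomorphic_form w.
  split.
  - by move=> i x nx; rewrite /w; case: pselect.
  - move=> i x ix; have [d d0 hd] := param_nbhs ix (Ux x).
    pose B (u : R[i]) := nc (u - chart_coord i x) < d.
    have Bo : copen B by exact: oball_open.
    have Bd u : B u -> cder (H x \o chart_param i) u (w i (chart_param i u)).
      move=> /hd[iu cu xu]; have := wE _ _ xu i iu; rewrite cu; exact.
    have [|v hv] := @holo_derive R B _ _ Bo Bd (chart_coord i x).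
      by rewrite /B subrr nc0.
    exact: cder_derivable hv.
  - move=> i j x ix jx; have xx := nbhs_singleton (Ux x).
    apply: (@cder_unique R (H x \o chart_param i) (chart_coord i x)).
      exact: wE.
    apply: cder_chart => //; exact: wE.
have wP : w \in holomorphic_form_pred X by apply/asboolP.
by exists (Form wP).
Qed.

End LocalTheory.

(** * Pullback of forms *)

Section Pullback.
Variable R : realType.

Section Map.
Variables (X Y : curve R) (f : X -> Y).
Hypothesis fh : holomorphic_map f.

Let f_nbhs x (A : set Y) : nbhs (f x) A -> nbhs x (f @^-1` A).
Proof. by move=> h; exact: (fh.1 x A h). Qed.

Lemma map_cder i j x : chart_dom i x -> chart_dom j (f x) ->
  cder (chart_coord j \o f \o chart_param i) (chart_coord i x)
    ('D_1 (chart_coord j \o f \o chart_param i) (chart_coord i x)).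
Proof. by move=> ix jx; apply: derivable_cder; exact: fh.2. Qed.

Lemma cder_map H i j x v : chart_dom i x -> chart_dom j (f x) ->
  cder (H \o chart_param j) (chart_coord j (f x)) v ->
  cder (H \o f \o chart_param i) (chart_coord i x)
    (v * 'D_1 (chart_coord j \o f \o chart_param i) (chart_coord i x)).
Proof.
move=> ix jx hv.
have jn : nbhs (f x) (chart_dom j).
  by apply: open_nbhs_nbhs; split => //; exact: dom_open.
have [d d0 h] := param_nbhs ix (f_nbhs jn).
have tr := map_cder ix jx.
have hv' : cder (H \o chart_param j)
    ((chart_coord j \o f \o chart_param i) (chart_coord i x)) v.
  by rewrite /= (coordK ix).
apply: (cder_eqd d0 _ (cder_comp tr hv')) => u /h[_ _ ju].
by rewrite /= (coordK ju).
Qed.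

Lemma hder_map H x : hder (f x) H -> hder x (H \o f).
Proof.
move=> hH i ix; have [j jx] := dom_cover (f x); have [v hv] := hH j jx.
by eexists; exact: cder_map hv.
Qed.

Lemma is_pullback_dprim w w' H x : is_pullback f w w' -> dprim w (f x) H ->
  dprim w' x (H \o f).
Proof.
move=> wf wH i ix; have [j jx] := dom_cover (f x).
by rewrite (wf i j x ix jx); apply: cder_map => //; exact: wH.
Qed.

(** [pullback] falls back to 0 if no such form exists, so existence has to be established first.
    Primitives of [w] composed with [f] differ by local constants and glue. *)
Lemma exists_pullback w : exists w', is_pullback f w w'.
Proof.
have : forall z : Y, exists DH : set Y * (Y -> R[i]),
    nice DH.1 z /\ forall y, DH.1 y -> dprim w y DH.2.
  move=> z; have [D nD _] := nice_basis (@filterT _ (nbhs z) _).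
  by have [H hH] := nice_primitive w nD; exists (D, H).
move=> /choice[DH hDH].
pose H x := (DH (f x)).2 \o f; pose U x := f @^-1` (DH (f x)).1.
have UP x y : U x y -> dprim w (f y) (DH (f x)).2 by have [_] := hDH (f x); apply.
have [||x y xy|w' hw'] := @glue_form R X H U.
- by move=> x; apply: f_nbhs; have [h _] := hDH (f x); exact: nice_nbhs_center h.
- move=> x y xy; apply: hder_map; apply: dprim_hder (UP x y xy).
- have [nx px] := hDH (f x); have [ny py] := hDH (f y).
  have i1 : nbhs (f y) (DH (f x)).1.
    by apply: open_nbhs_nbhs; split => //; exact: nice_open nx.
  have i2 : nbhs (f y) (DH (f y)).1 by exact: nice_nbhs_center ny.
  have [D nD sD] := nice_basis (filterI i1 i2).
  exists (H x y - H y y).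
  have := f_nbhs (nice_nbhs_center nD); apply: filterS => z Dz.
  have := @nice_primitive_unique R Y D (f y) w (DH (f x)).2 (DH (f y)).2 nD.
  move=> /(_ _ _ (f y) (f z) (nice_center nD) Dz) h.
  have := h (fun u Du => px u (sD u Du).1) (fun u Du => py u (sD u Du).2).
  rewrite /H /= => e; apply/eqP; rewrite -subr_eq0; apply/eqP.
  transitivity ((DH (f x)).2 (f z) - (DH (f x)).2 (f y) -
    ((DH (f y)).2 (f z) - (DH (f y)).2 (f y))); first by ring.
  by rewrite e subrr.
exists w' => i j x ix jx; have xx : U x x.
  by have [h _] := hDH (f x); exact: nice_center h.
apply: (@cder_unique R (H x \o chart_param i) (chart_coord i x)).
  exact: hw'.
by apply: cder_map => //; exact: UP.
Qed.

Lemma is_pullback_unique w w1 w2 : is_pullback f w w1 -> is_pullback f w w2 -> w1 = w2.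
Proof.
move=> h1 h2; apply: holo_form_eq => x.
have [D nD _] := nice_basis (@filterT _ (nbhs (f x)) _).
have [H hH] := nice_primitive w nD; have Hx := hH _ (nice_center nD).
by exists (H \o f); apply: is_pullback_dprim Hx.
Qed.

Lemma pullback_is_pullback w : is_pullback f w (pullback f w).
Proof.
rewrite /pullback; case: xgetP => [w' _ //|none].
by have [w' h] := exists_pullback w; have := none w'.
Qed.

Lemma pullback_dprim (w : holo_form Y) H x : dprim w (f x) H -> dprim (pullback f w) x (H \o f).
Proof. exact: is_pullback_dprim (pullback_is_pullback w). Qed.

Lemma pullback_eq w w' : is_pullback f w w' -> pullback f w = w'.
Proof. exact: is_pullback_unique (pullback_is_pullback w). Qed.

Lemma pullback_eq_dprim (w : holo_form Y) (w' : holo_form X) :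
  (forall x, exists2 H, dprim w (f x) H & dprim w' x (H \o f)) -> pullback f w = w'.
Proof.
move=> h; apply: holo_form_eq => x; have [H h1 h2] := h x.
by exists (H \o f) => //; exact: pullback_dprim.
Qed.

Lemma formE (Z : curve R) (a : R[i]) (u v : holo_form Z) i x :
  (a *: u + v) i x = a * u i x + v i x.
Proof. by []. Qed.

Lemma pullback_linear (a : R[i]) (u v : holo_form Y) :
  pullback f (a *: u + v) = a *: pullback f u + pullback f v.
Proof.
apply: pullback_eq => i j x ix jx; rewrite !formE.
by rewrite !(pullback_is_pullback _ ix jx) mulrDl mulrA.
Qed.

Lemma pullback0 : pullback f 0 = 0.
Proof.
have := pullback_linear (-1) 0 0.
by rewrite scaler0 addr0 scaleN1r addNr.
Qed.
Lemma pullbackD (u v : holo_form Y) : pullback f (u + v) = pullback f u + pullback f v.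
Proof. by have := pullback_linear 1 u v; rewrite !scale1r. Qed.
Lemma pullbackZ (a : R[i]) (u : holo_form Y) : pullback f (a *: u) = a *: pullback f u.
Proof. by have := pullback_linear a u 0; rewrite !addr0 pullback0 addr0. Qed.
Lemma pullback_sum (I : finType) (P : pred I) (u : I -> holo_form Y) :
  pullback f (\sum_(i | P i) u i) = \sum_(i | P i) pullback f (u i).
Proof. exact: (big_morph _ pullbackD pullback0). Qed.

End Map.

Lemma local_primitive (X : curve R) x (w : holo_form X) : exists H, dprim w x H.
Proof.
have [D nD _] := nice_basis (@filterT _ (nbhs x) _).
have [H hH] := nice_primitive w nD; exists H; exact: hH (nice_center nD).
Qed.

Lemma pullback_comp (X Y Z : curve R) (f : X -> Y) (g : Y -> Z) (h : X -> Z) w :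
  holomorphic_map f -> holomorphic_map g -> holomorphic_map h -> g \o f = h ->
  pullback h w = pullback f (pullback g w).
Proof.
move=> fh gh hh gf; apply: pullback_eq_dprim => // x; have [H wH] := local_primitive (h x) w.
exists H => //; rewrite -gf in wH *.
exact: (pullback_dprim fh (pullback_dprim gh wH)).
Qed.

Lemma pullback_id (X : curve R) (h : X -> X) w : holomorphic_map h ->
  (forall x, h x = x) -> pullback h w = w.
Proof.
move=> hh h1; have -> : h = id by apply/funext.
apply: pullback_eq_dprim => [|x]; first by rewrite -(_ : h = id)//; apply/funext.
by have [H wH] := local_primitive x w; exists H.
Qed.

End Pullback.

(** * Periods *)
Section Paths.
Variables (R : realType).

Definition clamp (t : R) : R := Num.max 0 (Num.min 1 t).
Lemma clamp_continuous : continuous clamp.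
Proof.
move=> t; apply: continuous_max; first exact: cvg_cst.
by apply: continuous_min; [exact: cvg_cst|exact: cvg_id].
Qed.
Lemma clamp_ge0 t : 0 <= clamp t. Proof. by rewrite /clamp le_max lexx. Qed.
Lemma clamp_le1 t : clamp t <= 1. Proof. by rewrite /clamp ge_max ler01 ge_min lexx. Qed.
Lemma clamp_le t : t <= 0 -> clamp t = 0.
Proof. by move=> t0; rewrite /clamp min_r ?max_l// (le_trans t0). Qed.
Lemma clamp_ge t : 1 <= t -> clamp t = 1.
Proof. by move=> t1; rewrite /clamp min_l// max_r. Qed.
Lemma clamp0 : clamp 0 = 0. Proof. exact: clamp_le. Qed.
Lemma clamp1 : clamp 1 = 1. Proof. exact: clamp_ge. Qed.

Section OneCurve.
Variable X : curve R.
Implicit Types (x y z : X) (g : R -> X) (w : holo_form X) (F : R -> R[i])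
  (P : holo_form X -> R[i]).

(** Paths are defined on all of [R], which makes all neighbourhoods two-sided, and the local
    primitives live on [X] instead of in a chart. *)
Definition along w g F := forall t : R, exists H : X -> R[i],
  (\forall z \near g t, dprim w z H) /\ (\forall s \near t, F s = H (g s)).

Lemma along_comp w g F (phi : R -> R) : continuous phi -> along w g F ->
  along w (g \o phi) (F \o phi).
Proof.
move=> phic h t; have [H [wH FH]] := h (phi t); exists H; split => //.
exact: (phic t _ FH).
Qed.

Lemma along_any w g F t D x H : {for t, continuous g} -> along w g F -> nice D x ->
  D (g t) -> (forall z, D z -> dprim w z H) ->
  exists c, \forall s \near t, F s = H (g s) + c.
Proof.
move=> gc h nD Dt wH; have [K [wK FK]] := h t.
have Dn : nbhs (g t) D by apply: open_nbhs_nbhs; split => //; exact: nice_open nD.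
have [D' nD' sD'] := nice_basis (filterI Dn wK).
exists (K (g t) - H (g t)).
have := gc _ (nice_nbhs_center nD'); apply: filterS2 FK => s -> Ds.
have e := nice_primitive_unique nD' (fun z Dz => (sD' z Dz).2)
  (fun z Dz => wH z (sD' z Dz).1) (nice_center nD') Ds.
apply/eqP; rewrite -subr_eq0; apply/eqP.
transitivity (K (g s) - K (g t) - (H (g s) - H (g t))); first by ring.
by rewrite e subrr.
Qed.

(** All forms are integrated over the same path, so [P] stands for the class of the path in the dual
    of the space of forms. *)
Definition joined x y P := exists g : R -> X, [/\ continuous g, g 0 = x, g 1 = y
  & forall w, exists2 F, along w g F & P w = F 1 - F 0].

Lemma along_cst w x (c : R[i]) : along w (fun=> x) (fun=> c).
Proof.
move=> t; have [D nD _] := nice_basis (@filterT _ (nbhs x) _).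
have [H wH] := nice_primitive w nD; exists (fun z => H z + (c - H x)); split.
  by apply: filterS (nice_nbhs_center nD) => z /wH; exact: dprimDc.
by apply: (@filterE _ (nbhs t)) => s; rewrite subrKC.
Qed.

Lemma joined_refl x : joined x x (fun=> 0).
Proof.
exists (fun=> x); split => //; first exact: cst_continuous.
by move=> w; exists (fun=> 0); [exact: along_cst|rewrite subrr].
Qed.

Lemma joined_sym x y P : joined x y P -> joined y x (fun w => - P w).
Proof.
move=> [g [gc g0 g1 h]].
have phic : continuous (fun t : R => 1 - t).
  by move=> t; apply: cvgB; [exact: cvg_cst|exact: cvg_id].
exists (g \o (fun t => 1 - t)); split => //=.
- by move=> t; apply: continuous_comp; [exact: phic|exact: gc].
- by rewrite subr0.
- by rewrite subrr.
- move=> w; have [F wF ->] := h w; exists (F \o (fun t => 1 - t)).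
    exact: along_comp.
  by rewrite /= subrr subr0 opprB.
Qed.

Lemma joined_eq x y P P' : P =1 P' -> joined x y P -> joined x y P'.
Proof.
by move=> e [g [gc g0 g1 h]]; exists g; split => // w; have [F wF PF] := h w; exists F => //;
  rewrite -e.
Qed.

Lemma joined_clamped x y P : joined x y P -> exists g : R -> X,
  [/\ continuous g, forall t, t <= 0 -> g t = x, forall t, 1 <= t -> g t = y
    & forall w, exists2 F, along w g F & P w = F 1 - F 0].
Proof.
move=> [g [gc g0 g1 h]]; exists (g \o clamp); split => /=.
- by move=> t; apply: continuous_comp; [exact: clamp_continuous|exact: gc].
- by move=> t /clamp_le ->.
- by move=> t /clamp_ge ->.
- move=> w; have [F wF ->] := h w; exists (F \o clamp).
    by apply: along_comp => //; exact: clamp_continuous.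
  by rewrite /= clamp0 clamp1.
Qed.

Lemma nbhs_sub2 (T : topologicalType) (t : T) (A B C : set T) :
  nbhs t A -> nbhs t B -> (forall s, A s -> B s -> C s) -> nbhs t C.
Proof. by move=> tA tB ABC; exact: filterS2 ABC tA tB. Qed.

Lemma near_ltR (t : R) : t < 1 -> \forall s \near t, s <= 1.
Proof.
move=> t1; apply/nbhs_absP; exists (1 - t); first by rewrite subr_gt0.
by move=> s; rewrite ltr_norml => /andP[]; lra.
Qed.
Lemma near_gtR (t : R) : 1 < t -> \forall s \near t, (s <= 1) = false.
Proof.
move=> t1; apply/nbhs_absP; exists (t - 1); first by rewrite subr_gt0.
by move=> s; rewrite ltr_norml => /andP[? ?]; apply/negbTE; rewrite -ltNge; lra.
Qed.

Lemma joined_trans x y z P Q : joined x y P -> joined y z Q ->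
  joined x z (fun w => P w + Q w).
Proof.
move=> /joined_clamped[g [gc g0 g1 hg]] /joined_clamped[k [kc k0 k1 hk]].
pose sh (t : R) := t - 1.
have shc : continuous sh by move=> t; apply: cvgB; [exact: cvg_id|exact: cvg_cst].
have ksc t : {for t, continuous (k \o sh)}.
  by apply: continuous_comp; [exact: shc|exact: kc].
pose m (t : R) := if t <= 1 then g t else k (sh t).
have mc : continuous m.
  move=> t; have [t1|t1|t1] := ltgtP t 1.
  - move=> A; rewrite {1}/m (ltW t1) => /gc gA; change (nbhs t (m @^-1` A)).
    apply: (@nbhs_sub2 _ t (g @^-1` A) _ _ gA (near_ltR t1)) => s gs s1.
    by rewrite /= /m s1.
  - move=> A; rewrite {1}/m leNgt t1 /= => /(ksc t) kA; change (nbhs t (m @^-1` A)).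
    apply: (@nbhs_sub2 _ t ((k \o sh) @^-1` A) _ _ kA (near_gtR t1)) => s gs s1.
    by rewrite /= /m s1.
  - move=> A; rewrite t1 {1}/m lexx => mA; change (nbhs (1 : R) (m @^-1` A)).
    have gA := gc _ _ mA; have kA : nbhs (1 : R) ((k \o sh) @^-1` A).
      by apply: (ksc 1); rewrite /= /sh subrr k0// -(g1 1).
    apply: (@nbhs_sub2 _ (1 : R) (g @^-1` A) _ _ gA kA) => s gs ks.
    by rewrite /= /m; case: ifP.
pose two (t : R) := 0 + 2 * t.
exists (m \o two); split.
- by move=> t; apply: continuous_comp; [exact: continuous_affine|exact: mc].
- by rewrite /= /two mulr0 addr0 /m ler01 g0.
- by rewrite /= /two mulr1 add0r /m leNgt ltr1n /= k1// /sh; lra.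
move=> w; have [F wF FE] := hg w; have [E wE EE] := hk w.
pose M (t : R) := if t <= 1 then F t else E (sh t) + (F 1 - E 0).
suff wM : along w m M.
  exists (M \o two); first by apply: along_comp => //; exact: continuous_affine.
  rewrite /= /two mulr0 mulr1 addr0 add0r /M ler01 leNgt ltr1n /= FE EE.
  by rewrite (_ : sh 2 = 1) /sh; [ring|lra].
move=> t; have [t1|t1|t1] := ltgtP t 1.
- have [H [wH FH]] := wF t; exists H; split; first by rewrite /m (ltW t1).
  apply: (nbhs_sub2 FH (near_ltR t1)) => s Fs s1.
  by rewrite /M /m s1.
- have [H [wH EH]] := along_comp shc wE t; exists (fun z => H z + (F 1 - E 0)); split.
    rewrite /m leNgt t1 /=; apply: filterS wH => v; exact: dprimDc.
  apply: (nbhs_sub2 EH (near_gtR t1)) => s Es s1.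
  by rewrite /M /m s1 -Es.
(* At the junction both primitives are compared with one primitive [H] on a disc around [y]; the
   shift [F 1 - E 0] makes the two constants agree. *)
- have [D nD _] := nice_basis (@filterT _ (nbhs y) _).
  have [H wH] := nice_primitive w nD.
  have Dg : D (g 1) by rewrite g1//; exact: nice_center nD.
  have Dk : D ((k \o sh) 1) by rewrite /= /sh subrr k0//; exact: nice_center nD.
  have [c hc] := along_any (gc 1) wF nD Dg wH.
  have [e he] := along_any (ksc 1) (along_comp shc wE) nD Dk wH.
  exists (fun z => H z + c); split.
    rewrite t1 /m lexx g1//; apply: filterS (nice_nbhs_center nD) => v /wH.
    exact: dprimDc.
  rewrite t1; have F1 := nbhs_singleton hc; have E1 := nbhs_singleton he.
  apply: (nbhs_sub2 hc he) => s Fs Es; rewrite /M /m; case: ifP => // _.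
  rewrite /= in Es; rewrite Es F1.
  have -> : E 0 = H y + e by rewrite -(k0 0)// -[0](subrr 1); exact: E1.
  rewrite g1//; ring.
Qed.

Lemma joined_nice D x (H : holo_form X -> X -> R[i]) y z : nice D x ->
  (forall w v, D v -> dprim w v (H w)) -> D y -> D z ->
  joined y z (fun w => H w z - H w y).
Proof.
move=> nD wH Dy Dz; have Do := nice_open nD.
move: nD => [i [d [d0 ix DE hd]]].
move: (Dy) (Dz); rewrite DE => -[iy yd] [iz zd].
pose l (t : R) : R[i]^o :=
  chart_coord i y + t%:C * (chart_coord i z - chart_coord i y).
have ld t : nc (l (clamp t) - chart_coord i x) < d.
  exact: (oball_convex yd zd (clamp_ge0 t) (clamp_le1 t)).
pose g t := chart_param i (l (clamp t)).
have gD t : D (g t) by rewrite DE; have [? c] := hd _ (ld t); split; rewrite /g ?c.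
have gc : continuous g.
  move=> t; have lc : {for t, continuous (l \o clamp)}.
    by apply: continuous_comp; [exact: clamp_continuous|exact: line_cont].
  apply: (@continuous_comp _ _ _ (l \o clamp) (chart_param i) t lc).
  by have [iu cu] := hd _ (ld t); have := param_continuous iu; rewrite cu.
have g0 : g 0 = y by rewrite /g clamp0 /l rmorph0 mul0r addr0 (coordK iy).
have g1 : g 1 = z by rewrite /g clamp1 /l rmorph1 mul1r subrKC (coordK iz).
exists g; split => // w; exists (H w \o g); last by rewrite /= g0 g1.
move=> t; exists (H w); split; last exact: (@filterE _ (nbhs t)).
have : nbhs (g t) D by apply: open_nbhs_nbhs; split.
by apply: filterS => v; exact: wH.
Qed.

Lemma along_primitive w g F (a b : R) H : continuous g -> along w g F -> a <= b ->
  (forall s, a <= s -> s <= b -> \forall z \near g s, dprim w z H) ->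
  F b - F a = H (g b) - H (g a).
Proof.
move=> gc wF ab wH; pose l (s : R) := a + (b - a) * s.
have := @cousin R (fun s t => F (l t) - H (g (l t)) = F (l s) - H (g (l s))).
rewrite /l mulr0 mulr1 addr0 subrKC => h.
suff e : F b - H (g b) = F a - H (g a).
  apply/eqP; rewrite -subr_eq0; apply/eqP.
  transitivity (F b - H (g b) - (F a - H (g a))); first by ring.
  by rewrite e subrr.
apply: h => [x y z _ _ _ _ <- <-//|t t0 t1].
have at1 : a <= l t by rewrite lerDl mulr_ge0// subr_ge0.
have lb : l t <= b by rewrite /l; nra.
have [D nD sD] := nice_basis (wH _ at1 lb).
have [c hc] := along_any (gc (l t)) wF nD (nice_center nD) sD.
have /nbhs_absP[d d0 hd] := @continuous_affine R a (b - a) t _ hc.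
exists d => // s u s0 st tu u1 su.
have e (v : R) : `|v - t| < d -> F (l v) - H (g (l v)) = c.
  by move=> /hd /= ->; rewrite addrAC subrr add0r.
by rewrite -!/(l _) !e// ltr_norml; apply/andP; split; lra.
Qed.

(** The transfer of [cousin] to paths: a subdivision sends each short piece into one of the sets
    [U], where the functional is a difference of values of a primitive. *)
Lemma joined_ind (Q : X -> X -> (holo_form X -> R[i]) -> Prop) :
  (forall x y z P P', Q x y P -> Q y z P' -> Q x z (fun w => P w + P' w)) ->
  (forall x, exists (U : set X) (H : holo_form X -> X -> R[i]), [/\ open U, U x,
    forall w y, U y -> dprim w y (H w)
  & forall y z, U y -> U z -> Q y z (fun w => H w z - H w y)]) ->
  forall x y P, joined x y P -> Q x y P.
Proof.
move=> Qt Ql x y P [g [gc <- <- h]].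
have /choice[F hF] : forall w, exists F, along w g F /\ P w = F 1 - F 0.
  by move=> w; have [F] := h w; exists F.
have -> : P = fun w => F w 1 - F w 0 by apply/funext => w; have [] := hF w.
apply: (@cousin R (fun a b => Q (g a) (g b) (fun w => F w b - F w a))).
  move=> a b c _ _ _ _ h1 h2; have := Qt _ _ _ _ _ h1 h2.
  by congr (Q _ _ _); apply/funext => w; ring.
move=> t t0 t1; have [U [H [Uo Ut UH UQ]]] := Ql (g t).
have /(gc t)/nbhs_absP[d d0 hd] : nbhs (g t) U by apply: open_nbhs_nbhs; split.
exists d => // a b a0 at1 tb b1 ab.
have gU s : a <= s -> s <= b -> U (g s).
  by move=> sa sb; apply: hd; rewrite ltr_norml; apply/andP; split; lra.
have ab' : a <= b by exact: le_trans tb.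
have := UQ _ _ (gU _ (lexx a) ab') (gU _ ab' (lexx b)).
congr (Q _ _ _); apply/funext => w; apply/esym.
apply: (along_primitive gc (hF w).1 ab') => s sa sb.
have : nbhs (g s) U by apply: open_nbhs_nbhs; split => //; exact: gU.
by apply: filterS => v; exact: UH.
Qed.

Lemma joined_all x y : exists P, joined x y P.
Proof.
pose A := [set z | exists P, joined x z P].
have loc z : exists D : set X, [/\ open D, D z & forall u v, D u -> D v ->
    exists P, joined u v P].
  have [D nD _] := nice_basis (@filterT _ (nbhs z) _).
  have /choice[H hH] : forall w : holo_form X, exists H, forall y, D y -> dprim w y H.
    by move=> w; exact: nice_primitive nD.
  exists D; split; [exact: nice_open nD|exact: nice_center nD|].
  move=> u v Du Dv; eexists; exact: (joined_nice nD hH Du Dv).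
have Ao : open A.
  rewrite openE => z [P zP]; have [D [Do Dz hD]] := loc z.
  have : nbhs z D by apply: open_nbhs_nbhs; split.
  apply: filterS => v Dv; have [Q vQ] := hD _ _ Dz Dv.
  by eexists; exact: joined_trans zP vQ.
have Ac : closed A.
  move=> z cz; have [D [Do Dz hD]] := loc z.
  have [v [[P vP] Dv]] := cz D (open_nbhs_nbhs (conj Do Dz)).
  by have [Q vQ] := hD _ _ Dv Dz; eexists; exact: joined_trans vP vQ.
have Ax : A x by eexists; exact: joined_refl.
suff : A = [set: X] by move=> AT; have : [set: X] y by []; rewrite -AT.
apply: (@curve_connected R X); first by exists x.
- by exists A => //; rewrite setTI.
- by exists A => //; rewrite setTI.
Qed.

(** Clamping turns a path with continuity and primitives relative to [0, 1] into a path on [R]. *)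
Lemma periodsP P : periods X P <-> exists x, joined x x P.
Proof.
split.
  move=> [g [gc g01 h]]; exists (g 0).
  have /subspace_continuousP gc' := gc.
  have clin t : `[0, 1]%classic (clamp t).
    by rewrite /= in_itv /= clamp_ge0 clamp_le1.
  exists (g \o clamp); split.
  - move=> t A gA; have := gc' _ (clin t) _ gA.
    rewrite /within /= => /(@clamp_continuous t) hA.
    change (nbhs t ((g \o clamp) @^-1` A)).
    by apply: (@filterS _ (nbhs t) _ _ _ _ hA) => s hs; exact: (hs (clin s)).
  - by rewrite /= clamp0.
  - by rewrite /= clamp1.
  move=> w; have [F hF ->] := h w; exists (F \o clamp); last by rewrite /= clamp0 clamp1.
  move=> t; have [i [G [it hG hFG]]] := hF _ (clin t).
  exists (G \o chart_coord i); split.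
    have /nbhs_ncP[d d0 hd] := hG.
    have : nbhs (g (clamp t)) (disc i (g (clamp t)) d).
      apply: open_nbhs_nbhs; split; first exact: disc_open.
      by split => //; rewrite subrr nc0.
    apply: filterS => z [iz zd]; apply: (dprim_chart (holo_formP w) iz).
    have [e e0 he] := param_nbhs iz (@filterT _ (nbhs z) _).
    have /is_derive_cderP hz := hd _ zd; rewrite (coordK iz) in hz.
    by apply: cder_eqd e0 _ hz => u /he[_ cu _]; rewrite /= cu.
  apply: (@filterS _ (nbhs t) _ _ _ _ (clamp_continuous hFG)) => s hs.
  exact: (hs (clin s)).
move=> [x [g [gc g0 g1 h]]]; exists g; split.
- exact: continuous_subspaceT.
- by rewrite g0 g1.
move=> w; have [F wF PF] := h w; exists F => // t _.
have [i it] := dom_cover (g t); have [H [wH FH]] := wF t.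
exists i, (H \o chart_param i); split => //.
  have [d d0 hd] := param_nbhs it wH; apply/nbhs_ncP; exists d => // u /hd[iu cu wu].
  by apply/is_derive_cderP; have := wu i iu; rewrite cu.
have idn : nbhs (g t) (chart_dom i) by apply: open_nbhs_nbhs; split => //; exact: dom_open.
apply: (nbhs_sub2 FH (gc t _ idn)) => s -> iS _.
by rewrite /= (coordK iS).
Qed.

Lemma joined_linear x y P : joined x y P -> dual_forms X P.
Proof.
apply: (@joined_ind (fun _ _ P => dual_forms X P)) => {x y P}.
- by move=> x y z P Q hP hQ a u v; rewrite hP hQ; ring.
move=> x; have [D nD _] := nice_basis (@filterT _ (nbhs x) _).
have /choice[H hH] : forall w : holo_form X, exists H, forall y, D y -> dprim w y H.
  by move=> w; exact: nice_primitive nD.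
exists D, H; split => //; [exact: nice_open nD|exact: nice_center nD|].
move=> y z Dy Dz a u v.
have h t : D t -> dprim (a *: u + v : holo_form X) t (fun s => a * H u s + H v s).
  by move=> Dt; apply: (dprimD (dprimZ a (hH u t Dt)) (hH v t Dt)).
rewrite (nice_primitive_unique nD (hH (a *: u + v)) h Dy Dz); ring.
Qed.

Lemma periods_linear P : periods X P -> dual_forms X P.
Proof. by move=> /periodsP[x]; exact: joined_linear. Qed.

Lemma periods0 : periods X (0 : holo_form X -> R[i]).
Proof.
by have [x _] := @curve_nonempty R X; apply/periodsP; exists x; exact: joined_refl.
Qed.

Lemma periodsN P : periods X P -> periods X (- P).
Proof. by move=> /periodsP[x xP]; apply/periodsP; exists x; exact: joined_sym. Qed.

Lemma periodsD P Q : periods X P -> periods X Q -> periods X (P + Q).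
Proof.
move=> /periodsP[x xP] /periodsP[y yQ]; apply/periodsP; exists x.
have [S xS] := joined_all x y.
(* The second loop is moved to the base point [x] along a path; going out and back contributes
   [S w - S w]. *)
have := joined_trans (joined_trans (joined_trans xP xS) yQ) (joined_sym xS).
by apply: joined_eq => w; rewrite addrAC addrK.
Qed.
End OneCurve.

Lemma joined_map (X Y : curve R) (f : X -> Y) x y P : holomorphic_map f ->
  joined x y P -> joined (f x) (f y) (fun w => P (pullback f w)).
Proof.
move=> fh [g [gc g0 g1 h]]; exists (f \o g); split.
- by move=> t; apply: continuous_comp; [exact: gc|exact: fh.1].
- by rewrite /= g0.
- by rewrite /= g1.
move=> w; have [F wF PF] := h (pullback f w); exists F => // t.
have [D nD _] := nice_basis (@filterT _ (nbhs (f (g t))) _).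
have [H wH] := nice_primitive w nD.
have [K [wK FK]] := wF t.
have wHf : \forall z \near g t, dprim (pullback f w) z (H \o f).
  apply: (@filterS _ (nbhs (g t)) _ _ _ _ (fh.1 _ _ (nice_nbhs_center nD))) => z Dz.
  by apply: pullback_dprim => //; exact: wH.
have [D' nD' sD'] := nice_basis wHf.
have [c hc] := along_any (gc t) wF nD' (nice_center nD') sD'.
exists (fun z => H z + c); split => //.
by apply: filterS (nice_nbhs_center nD) => z /wH; exact: dprimDc.
Qed.

Lemma periods_norm_map (X Y : curve R) (f : X -> Y) P : holomorphic_map f ->
  periods X P -> periods Y (norm_map f P).
Proof.
by move=> fh /periodsP[x xP]; apply/periodsP; exists (f x); exact: joined_map.
Qed.

End Paths.

(** * Finitely generated subgroups *)

Section ZSpan.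
Variable V : zmodType.
Implicit Types (s : seq V) (u v : V).

Fixpoint zspan s v : Prop :=
  if s is a :: s' then exists c : int, zspan s' (v - a *~ c) else v = 0.

Lemma zspan0 s : zspan s 0.
Proof. by elim: s => //= a s IH; exists 0; rewrite mulr0z subr0. Qed.

Lemma zspanD s u v : zspan s u -> zspan s v -> zspan s (u + v).
Proof.
elim: s u v => /= [u v -> ->|a s IH u v [c hc] [d hd]]; first by rewrite addr0.
by exists (c + d); have := IH _ _ hc hd; rewrite addrACA -opprD -mulrzDr.
Qed.

Lemma zspanN s v : zspan s v -> zspan s (- v).
Proof.
elim: s v => /= [v ->|a s IH v [c hc]]; first by rewrite oppr0.
by exists (- c); have := IH _ hc; rewrite opprB mulrNz opprK addrC.
Qed.

Lemma zspanB s u v : zspan s u -> zspan s v -> zspan s (u - v).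
Proof. by move=> hu /zspanN; exact: zspanD. Qed.

Lemma zspan_mem s v : v \in s -> zspan s v.
Proof.
elim: s => //= a s IH; rewrite inE => /orP[/eqP->|/IH h].
  by exists 1; rewrite mulr1z subrr; exact: zspan0.
by exists 0; rewrite mulr0z subr0.
Qed.

(** A subgroup [L] of a finitely generated group has finite [L / n L]. By induction on the
    generators, [L] is an extension of a subgroup of the integers by its part in the span of the
    tail. *)
Lemma zspan_finite_quotient s (L : set V) (n : nat) : (0 < n)%N ->
  (forall v, L v -> zspan s v) -> L 0 ->
  (forall u v, L u -> L v -> L (u + v)) -> (forall v, L v -> L (- v)) ->
  exists k : seq V, forall v, L v -> exists2 u, u \in k & exists2 l, L l & v - u = l *+ n.
Proof.
move=> n0; elim: s L => [|a s IH] L Ls L0 LD LN.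
  exists [:: 0] => v /Ls /= ->; exists 0; first by rewrite inE.
  by exists 0; rewrite // subrr mul0rn.
have LM v (m : nat) : L v -> L (v *+ m).
  by move=> Lv; elim: m => [|m IHm]; rewrite ?mulr0n// mulrS; exact: LD.
have LZ v (m : int) : L v -> L (v *~ m).
  by move=> Lv; case: m => m; [exact: LM|apply: LN; exact: LM].
pose L' v := L v /\ zspan s v.
have [k hk] : exists k : seq V, forall v, L' v ->
    exists2 u, u \in k & exists2 l, L' l & v - u = l *+ n.
  apply: IH => [v []//||u v [] ? ? [] ? ?|v [] ? ?].
  - by split => //; exact: zspan0.
  - by split; [exact: LD|exact: zspanD].
  - by split; [exact: LN|exact: zspanN].
(* Coefficients of [a] are not unique when the generators are dependent; all those that occur form a
   subgroup of the integers. *)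
pose I (c : int) := exists2 v, L v & zspan s (v - a *~ c).
have ID b c : I b -> I c -> I (b + c).
  move=> [u Lu hu] [v Lv hv]; exists (u + v); first exact: LD.
  by have := zspanD hu hv; rewrite addrACA -opprD -mulrzDr.
have IN c : I c -> I (- c).
  move=> [v Lv hv]; exists (- v); first exact: LN.
  by have := zspanN hv; rewrite opprB mulrNz opprK addrC.
have IM c (m : nat) : I c -> I (c *+ m).
  move=> Ic; elim: m => [|m IHm]; last by rewrite mulrS; exact: ID.
  by exists 0 => //; rewrite mulr0n mulr0z subr0; exact: zspan0.
have IZ c (m : int) : I c -> I (m * c).
  move=> Ic; case: m => m; first by rewrite -natz mulr_natl; exact: IM.
  by rewrite NegzE mulNr -natz mulr_natl; apply: IN; exact: IM.
have [[d d0 Id]|nI] := pselect (exists2 d : nat, (0 < d)%N & I d%:Z); last first.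
  exists k => v Lv; suff L'v : L' v.
    by have [u uk [l [Ll _] lE]] := hk _ L'v; exists u => //; exists l.
  split => //; have [c hc] := Ls _ Lv.
  suff c0 : c = 0 by move: hc; rewrite c0 mulr0z subr0.
  apply/eqP; apply: contra_notT nI => c0; exists `|c|%N; first by rewrite absz_gt0.
  have Ic : I c by exists v.
  by case: (c) Ic => // m; rewrite NegzE => /IN; rewrite opprK.
have [e e0 [Ie emin]] : exists2 e : nat, (0 < e)%N & I e%:Z /\
    forall e', (0 < e')%N -> I e'%:Z -> (e <= e')%N.
  have ex : exists e : nat, (0 < e)%N && `[< I e%:Z >].
    by exists d; rewrite d0; apply/asboolP.
  case: (ex_minnP ex) => e /andP[e0 /asboolP Ie] emin; exists e => //; split => //.
  by move=> e' e'0 Ie'; apply: emin; rewrite e'0; apply/asboolP.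
have edvd c : I c -> exists m : int, c = m * e%:Z.
  move=> Ic; exists (c %/ e%:Z)%Z.
  have e0z : e%:Z != 0 by rewrite eqz_nat -lt0n.
  have Ir : I (c %% e%:Z)%Z.
    rewrite /modz; apply: ID => //; apply: IN; exact: IZ.
  have r0 := modz_ge0 c e0z.
  have rE : (c %% e%:Z)%Z = `|(c %% e%:Z)%Z|%N by rewrite gez0_abs.
  have rlt : (`|(c %% e%:Z)%Z| < e)%N by rewrite -ltz_nat -rE ltz_pmod.
  have r00 : (c %% e%:Z)%Z = 0.
    apply/eqP; rewrite rE eqz_nat; apply/negPn/negP => rn0.
    have := emin `|(c %% e%:Z)%Z|%N; rewrite lt0n rn0 -rE => /(_ isT Ir).
    by rewrite leqNgt rlt.
  by rewrite {1}(divz_eq c e%:Z) r00 addr0.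
have [l0 Ll0 hl0] := Ie.
(* [l0] realises the generator [e] of [I]. Reducing its multiplicity [m] in [v] modulo [n] leaves
   [j < n], and the rest of [v] lies in [L']. *)
exists [seq l0 *+ j + u | j <- iota 0 n, u <- k] => v Lv.
have [c hc] := Ls _ Lv; have [m mE] := edvd c (ex_intro2 _ _ v Lv hc).
have n0z : n%:Z != 0 by rewrite eqz_nat -lt0n.
pose j := `|(m %% n%:Z)%Z|%N.
have jE : (m %% n%:Z)%Z = j by rewrite /j gez0_abs// modz_ge0.
have jn : (j < n)%N by rewrite -ltz_nat -jE ltz_pmod.
have L'v : L' (v - l0 *~ m).
  split; first by apply: LD => //; apply: LN; exact: LZ.
  have hm : zspan s (l0 *~ m - (a *~ e%:Z) *~ m).
    rewrite -mulrzBl; move: (l0 - _) hl0 => b hb; case: m {mE jE j jn} => m.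
      by elim: m => [|m IHm]; [rewrite mulr0z; exact: zspan0|
        rewrite -addn1 PoszD mulrzDr mulr1z; exact: zspanD].
    rewrite NegzE mulrNz; apply: zspanN; elim: m.+1 => [|p IHp].
      by rewrite mulr0z; exact: zspan0.
    by rewrite -addn1 PoszD mulrzDr mulr1z; exact: zspanD.
  have := zspanB hc hm; rewrite mE -mulrzA mulrC => h.
  by have -> : v - l0 *~ m = v - a *~ (e%:Z * m) - (l0 *~ m - a *~ (e%:Z * m));
    rewrite // opprB addrA subrK.
have [u uk [l [Ll _] lE]] := hk _ L'v.
exists (l0 *+ j + u); first by apply: allpairs_f => //; rewrite mem_iota.
exists (l0 *~ (m %/ n%:Z)%Z + l); first by apply: LD => //; exact: LZ.
have mE' : l0 *~ m = l0 *~ (m %/ n%:Z)%Z *+ n + l0 *+ j.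
  by rewrite {1}(divz_eq m n%:Z) jE mulrzDr mulrzA -!pmulrn.
rewrite mulrnDl -lE mE' !opprD !addrA.
by rewrite (addrAC _ v) subrr add0r.
Qed.
End ZSpan.

(** * Finite generation of periods *)

Section PeriodsFinitelyGenerated.
Variables (R : realType) (X : curve R).

Lemma finite_cover (V : X -> set X) : (forall x, open (V x)) -> (forall x, V x x) ->
  exists xs : seq X, forall y, exists2 x, x \in xs & V x y.
Proof.
move=> Vo Vx; have /compact_near_coveringP cpt := @curve_compact R X.
(* The filter of properties shared by all sufficiently large finite lists turns the near-covering
   form of compactness into a finite subcover. *)
pose F : set_system (seq X) := [set A | exists s0 : seq X,
  forall s : seq X, {subset s0 <= s} -> A s].
have FF : Filter F.
  split; first by exists [::].
    move=> A B [s hs] [t ht]; exists (s ++ t) => u su; split.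
      by apply: hs => x xs; apply: su; rewrite mem_cat xs.
    by apply: ht => x xt; apply: su; rewrite mem_cat xt orbT.
  by move=> A B AB [s hs]; exists s => t st; apply: AB; exact: hs.
have [x _|s hs] := cpt _ F (fun s y => exists2 x, x \in s & V x y) FF; last first.
  by exists s => y; apply: (hs s).
exists (V x, [set s : seq X | x \in s]); last by move=> [y s] /= [Vxy xs]; exists x.
split => /=; first by apply: open_nbhs_nbhs; split.
by exists [:: x] => s; apply; rewrite inE.
Qed.

Lemma nbhs_seq (I : eqType) (s : seq I) (A : I -> set X) (y : X) :
  (forall i, nbhs y (A i)) -> nbhs y [set z | forall i, i \in s -> A i z].
Proof.
move=> Ay; elim: s => [|i s IH]; first by apply: filterE => z i.
apply: (nbhs_sub2 (Ay i) IH) => z Az h j; rewrite inE => /orP[/eqP->//|]; exact: h.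
Qed.

Lemma nice_family x (A : set X) : nbhs x A -> exists (D : set X)
    (H : holo_form X -> X -> R[i]),
  [/\ nice D x, D `<=` A & forall (w : holo_form X) y, D y -> dprim w y (H w)].
Proof.
move=> xA; have [D nD sD] := nice_basis xA.
have /choice[H hH] : forall w : holo_form X, exists H, forall y, D y -> dprim w y H.
  by move=> w; exact: nice_primitive nD.
by exists D, H.
Qed.

(** A Cech argument: for a finite cover with a primitive of every form on each member, the
    differences of primitives on overlaps take finitely many values, one for each pair of members
    and each disc of a finer finite cover. The functional of a loop is a sum of such differences. *)
Lemma periods_zspan : exists s : seq (holo_form X -> R[i]),
  forall P, periods X P -> zspan s P.
Proof.
have : forall x : X, exists DHV : set X * (holo_form X -> X -> R[i]) * set X,
  [/\ nice DHV.1.1 x, forall (w : holo_form X) y, DHV.1.1 y -> dprim w y (DHV.1.2 w),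
     open DHV.2, DHV.2 x & closure DHV.2 `<=` DHV.1.1].
  move=> x; have [D [H [nD _ hH]]] := nice_family (@filterT _ (nbhs x) _).
  have [|B xB BD] := @compact_regular X x [set: X] (@curve_hausdorff R X)
    (@curve_compact R X) _ D (nice_nbhs_center nD); first exact: filterT.
  exists (D, H, interior B); split => //=.
  - exact: open_interior.
  - by apply: subset_trans BD; apply: closure_subset; exact: interior_subset.
move=> /choice[DHV hDHV].
pose D x := (DHV x).1.1; pose H x := (DHV x).1.2; pose V x := (DHV x).2.
have nD x : nice (D x) x by have [] := hDHV x.
have hH x (w : holo_form X) y : D x y -> dprim w y (H x w) by have [_ h _ _ _] := hDHV x; exact: h.
have Vo x : open (V x) by have [] := hDHV x.
have Vx x : V x x by have [] := hDHV x.
have VD x : closure (V x) `<=` D x by have [] := hDHV x.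
have [xs xsP] := finite_cover Vo Vx.
(* A neighbourhood of [y] inside all the [A y x] that meets [V x] must lie in [D x], so the
   primitives attached to two such [x] differ there by one constant for each form. *)
pose A y x := if pselect (closure (V x) y) then D x else ~` closure (V x).
have Ay y x : nbhs y (A y x).
  rewrite /A; case: pselect => h.
    by apply: open_nbhs_nbhs; split; [exact: nice_open (nD x)|exact: VD].
  apply: open_nbhs_nbhs; split => //.
  by apply: closed_openC; exact: closed_closure.
have /choice[N hN] : forall y, exists N, nice N y /\ forall z, N z ->
    forall x, x \in xs -> A y x z.
  by move=> y; have [N nN sN] := nice_basis (nbhs_seq xs (Ay y)); exists N.
have [ys ysP] := finite_cover (fun y => nice_open (hN y).1) (fun y => nice_center (hN y).1).
pose Z (i j y : X) (w : holo_form X) : R[i] := H i w y - H j w y.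
pose s := [seq Z p.1 p.2 y | p <- [seq (i, j) | i <- xs, j <- xs], y <- ys].
have dif i j z : i \in xs -> j \in xs -> V i z -> V j z ->
    zspan s (fun w => H i w z - H j w z).
  move=> ixs jxs Viz Vjz; have [y yys Nyz] := ysP z; have [nN NA] := hN y.
  have key k : k \in xs -> V k z -> forall u, N y u -> D k u.
    move=> kxs Vkz u Nu; have := NA _ Nyz _ kxs; have := NA _ Nu _ kxs.
    rewrite /A; case: pselect => // _ _ /=; case.
    exact: subset_closure.
  apply: zspan_mem; have -> : (fun w => H i w z - H j w z) = Z i j y.
    apply/funext => w.
    have := nice_primitive_unique nN (fun u Nu => hH i w u (key i ixs Viz u Nu))
      (fun u Nu => hH j w u (key j jxs Vjz u Nu)) (nice_center nN) Nyz.
    rewrite /Z => e; apply/eqP; rewrite -subr_eq0; apply/eqP.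
    transitivity (H i w z - H i w y - (H j w z - H j w y)); first by ring.
    by rewrite e subrr.
  apply/allpairsP; exists ((i, j), y); split => //.
  by apply/allpairsP; exists (i, j).
exists s => P /periodsP[x xP].
(* Modulo the span, the functional of a path depends only on its ends and on primitives chosen
   there. For a loop, equal choices give 0. *)
pose Q x y (P : holo_form X -> R[i]) := forall i j, i \in xs -> j \in xs ->
  V i x -> V j y -> zspan s (fun w => P w - (H j w y - H i w x)).
have /(_ x x P xP) : forall x y P, joined x y P -> Q x y P.
  apply: joined_ind => {x P xP} [x y z P P' hP hP' i j ixs jxs Vi Vj|x].
    have [k kxs Vk] := xsP y; have := zspanD (hP i k ixs kxs Vi Vk) (hP' k j kxs jxs Vk Vj).
    congr zspan; apply/funext => w; rewrite !fctE; ring.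
  have [k kxs Vk] := xsP x; exists (V k), (H k); split => //.
    by move=> w y Vy; apply: hH; apply: VD; exact: subset_closure.
  move=> y z Vy Vz i j ixs jxs Vi Vj.
  have := zspanB (dif k j z kxs jxs Vz Vj) (dif k i y kxs ixs Vy Vi).
  congr zspan; apply/funext => w; rewrite !fctE; ring.
have [k kxs Vk] := xsP x => /(_ k k kxs kxs Vk Vk).
by congr zspan; apply/funext => w; rewrite subrr subr0.
Qed.
End PeriodsFinitelyGenerated.

(** * Quotients by finite groups *)
Section OpenQuotientDerivative.
Variable R : realType.

(* Openness of [phi] at [u0] makes an inverse function theorem unnecessary. *)
Lemma cder_open_quotient (phi h k : R[i] -> R[i]) u0 p l :
  cder phi u0 p -> p != 0 -> cder h u0 l -> k (phi u0) = h u0 ->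
  (forall e : R, 0 < e -> exists2 d, 0 < d & forall v, nc (v - phi u0) < d ->
    exists u, [/\ nc (u - u0) < e, phi u = v & k v = h u]) ->
  cder k (phi u0) (l / p).
Proof.
move=> [a [<- ac aE]] a0 [b [<- bc bE]] k0 op; apply: cderI => e e0.
have abc : ccont (u0 : R[i]^o) (fun u => b u / a u).
  by apply: ccontM => //; apply: ccontV.
have /ccontP/(_ e e0)[d1 d10 h1] := abc.
have /ccontP/(_ (nc (a u0)))[] := ac; first by rewrite nc_gt0.
move=> d2 d20 h2.
have m0 : 0 < Num.min d1 d2 by rewrite lt_min d10.
have [d d0 hd] := op _ m0; exists d => // v /hd[u [um pu kv]].
move: um; rewrite lt_min => /andP[/h1 u1 /h2 u2].
have au : a u != 0 by apply: contraTneq u2 => ->; rewrite sub0r ncN ltxx.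
rewrite kv k0 bE -pu aE.
have -> : b u * (u - u0) - b u0 / a u0 * (a u * (u - u0)) =
  (b u / a u - b u0 / a u0) * (a u * (u - u0)) by field; apply/andP.
by rewrite ncM ler_wpM2r ?nc_ge0// ltW.
Qed.

Lemma disc_infinite (z : R[i]) (d : R) (n : nat) : 0 < d ->
  exists u : 'I_n -> R[i], injective u /\ forall k, nc (u k - z) < d.
Proof.
move=> d0; exists (fun k => z + (d / k.+2%:R)%:C); split.
  move=> j k /addrI /complexI /(mulfI (lt0r_neq0 d0)) /invr_inj /eqP.
  by rewrite eqr_nat => /eqP[] /val_inj.
move=> k; rewrite addrAC subrr add0r nc_real ger0_norm ?divr_ge0 ?(ltW d0)//.
by rewrite ltr_pdivrMr// ltr_pMr// ltr1n.
Qed.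
End OpenQuotientDerivative.

Section Quotient.
Variables (R : realType) (D : finGroupType) (X Z : curve R) (a : D -> X -> X).
Variables (M : {group D}) (q : X -> Z).
Hypotheses (aP : faithful_action a) (qP : is_quotient a M q).

Let a1 x : a 1%g x = x. Proof. by have [] := aP. Qed.
Let aM g h x : a (g * h)%g x = a g (a h x). Proof. by have [_ h' _ _] := aP; rewrite h'. Qed.
Let ah g : holomorphic_map (a g). Proof. by have [_ _ h _] := aP; exact: h. Qed.
Let qh : holomorphic_map q. Proof. by have [] := qP. Qed.
Let q_surj z : exists x, q x = z. Proof. by have [_ h _] := qP; exact: h. Qed.
Let q_orbit x y : q x = q y -> exists2 g, g \in M & y = a g x.
Proof. by have [_ _ h] := qP; move=> /h. Qed.
Let aK g x : a g^-1%g (a g x) = x. Proof. by rewrite -aM mulVg a1. Qed.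

Lemma quotient_invariant g x : g \in M -> q (a g x) = q x.
Proof. by move=> gM; have [_ _ h] := qP; apply/esym/h; exists g. Qed.

Let act_open g (U : set X) : open U -> open (a g @^-1` U).
Proof. by move=> Uo; apply: open_comp => // x _; exact: (ah g).1. Qed.

(** A continuous map from a compact to a Hausdorff space is closed, and the image of [U] is the
    complement of the image of the complement of its saturation [U']. *)
Lemma quotient_open (U : set X) : open U -> open (q @` U).
Proof.
move=> Uo; pose U' := \bigcup_(g in [set g | g \in M]) (a g @^-1` U).
have U'o : open U' by apply: bigcup_open => g _; exact: act_open.
have Kc : closed (~` U') by exact: open_closedC.
have -> : q @` U = ~` (q @` (~` U')).
  apply/seteqP; split=> [z [x Ux <-] [y nUy yx]|z nz].
    have [g gM xy] := q_orbit yx.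
    by apply: nUy; exists g => //=; rewrite -xy.
  have [x xz] := q_surj z; have [g gM Ug] : U' x.
    by apply: contrapT => nU; apply: nz; exists x.
  by exists (a g x) => //; rewrite quotient_invariant.
apply: closed_openC; apply: (compact_closed (@curve_hausdorff R Z)).
apply: continuous_compact.
  by apply: continuous_subspaceT; exact: qh.1.
by apply: (@subclosed_compact _ _ [set: X]) => //; exact: (@curve_compact R X).
Qed.

Lemma quotient_nbhs x (U : set X) : nbhs x U -> nbhs (q x) (q @` U).
Proof.
move=> xU; have : nbhs (q x) (q @` interior U).
  apply: open_nbhs_nbhs; split; first exact/quotient_open/open_interior.
  by exists x.
by apply: filterS => _ [y /interior_subset Uy <-]; exists y.
Qed.

Let q_nbhs x (A : set Z) : nbhs (q x) A -> nbhs x (q @^-1` A).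
Proof. by move=> h; exact: (qh.1 x A h). Qed.

Let a_nbhs g x (A : set X) : nbhs (a g x) A -> nbhs x (a g @^-1` A).
Proof. by move=> h; exact: ((ah g).1 x A h). Qed.

Lemma pullback_action_quotient g (w : holo_form Z) : g \in M ->
  pullback (a g) (pullback q w) = pullback q w.
Proof.
move=> gM; rewrite -(@pullback_comp R X X Z (a g) q q w)//.
by apply/funext => x /=; rewrite quotient_invariant.
Qed.

(* Paths lift along [q] up to homotopy: it suffices to lift, disc by disc, the
   points of a subdivision, so branch points need no special treatment. *)
Lemma joined_lift x y P : joined x y P -> forall x', q x' = x ->
  exists y' P', [/\ q y' = y, joined x' y' P' & forall w, P' (pullback q w) = P w].
Proof.
pose Q x y (P : holo_form Z -> R[i]) := forall x', q x' = x -> exists y' P',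
  [/\ q y' = y, joined x' y' P' & forall w, P' (pullback q w) = P w].
apply: (@joined_ind R Z Q) => {x y P} [x y z P P' hP hP' x' /hP|z].
  move=> [y' [S [/hP'[z' [S' [qz yz SP']]] xy SP]]].
  exists z', (fun w => S w + S' w); split => //; first exact: joined_trans xy yz.
  by move=> w; rewrite SP SP'.
have [z' z'E] := q_surj z.
have [D0 [H [nD0 _ hH]]] := nice_family (@filterT _ (nbhs z) _).
have zD0 : nbhs z' (q @^-1` D0) by apply: q_nbhs; rewrite z'E; exact: nice_nbhs_center nD0.
have [W [G [nW WD0 hG]]] := nice_family zD0.
exists (q @` W), H; split.
- exact/quotient_open/nice_open/nW.
- by exists z' => //; exact: nice_center nW.
- by move=> w _ [u Wu <-]; apply: hH; exact: WD0.
move=> _ _ [u Wu <-] [v Wv <-] x' qx'.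
(* The prescribed lift may lie on another sheet; the disc is moved there by [g]. *)
have [g gM x'E] := q_orbit (esym qx').
exists (a g v), (fun w => G (pullback (a g) w) v - G (pullback (a g) w) u); split.
- exact: quotient_invariant.
- by rewrite x'E; apply: (joined_map (ah g) (joined_nice nW hG Wu Wv)).
move=> w; rewrite pullback_action_quotient//.
have hp s : W s -> dprim (pullback q w) s (H w \o q).
  by move=> Ws; apply: (pullback_dprim qh); apply: hH; exact: WD0.
exact: (nice_primitive_unique nW (hG (pullback q w)) hp Wu Wv).
Qed.

(** A loop lifts to a path from [x] to [a g x] with [g] in [M]. The translates of the lift by the
    powers of [g] up to [#|M|] concatenate to a closed path, and each of them has the norm [P]. *)
Lemma norm_periods_finite_index P : periods Z P ->
  exists2 P', periods X P' & norm_map q P' = P *+ #|M|.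
Proof.
move=> /periodsP[z zP]; have [x xz] := q_surj z.
have [x' [P' [x'z xP' PE]]] := joined_lift zP xz.
have [g gM x'E] := q_orbit (etrans xz (esym x'z)).
pose S n (w : holo_form X) : R[i] := \sum_(k < n) P' (pullback (a (g ^+ k)%g) w).
have h n : joined x (a (g ^+ n)%g x) (S n).
  elim: n => [|n IH].
    rewrite expg0 a1; apply: joined_eq (joined_refl x) => w.
    by rewrite /S big_ord0.
  have st := joined_map (ah (g ^+ n)%g) xP'; rewrite x'E -aM -expgSr in st.
  apply: joined_eq (joined_trans IH st) => w.
  by rewrite /S big_ord_recr.
exists (S #|M|).
  apply/periodsP; exists x; have := h #|M|.
  have /eqP -> : (g ^+ #|M| == 1)%g by rewrite -order_dvdn order_dvdG.
  by rewrite a1.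
apply/funext => w; rewrite /norm_map /S.
transitivity (\sum_(k < #|M|) P w).
  by apply: eq_bigr => k _; rewrite pullback_action_quotient ?PE// groupX.
rewrite sumr_const card_ord; elim: #|M| => [|n IH]; first by rewrite !mulr0n.
by rewrite !mulrS IH.
Qed.

End Quotient.

(** * Descent of invariant forms to a quotient *)

Section Descent.
Variables (R : realType) (D : finGroupType) (X Z : curve R) (a : D -> X -> X).
Variables (M : {group D}) (q : X -> Z).
Hypotheses (aP : faithful_action a) (qP : is_quotient a M q).

Let a1 x : a 1%g x = x. Proof. by have [] := aP. Qed.
Let aM g h x : a (g * h)%g x = a g (a h x). Proof. by have [_ h' _ _] := aP; rewrite h'. Qed.
Let ah g : holomorphic_map (a g). Proof. by have [_ _ h _] := aP; exact: h. Qed.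
Let qh : holomorphic_map q. Proof. by have [] := qP. Qed.
Let q_surj z : exists x, q x = z. Proof. by have [_ h _] := qP; exact: h. Qed.
Let q_orbit x y : q x = q y -> exists2 g, g \in M & y = a g x.
Proof. by have [_ _ h] := qP; move=> /h. Qed.
Let aK g x : a g^-1%g (a g x) = x. Proof. by rewrite -aM mulVg a1. Qed.
Let q_nbhs x (A : set Z) : nbhs (q x) A -> nbhs x (q @^-1` A).
Proof. by move=> h; exact: (qh.1 x A h). Qed.
Let a_nbhs g x (A : set X) : nbhs (a g x) A -> nbhs x (a g @^-1` A).
Proof. by move=> h; exact: ((ah g).1 x A h). Qed.
Let qa g x : g \in M -> q (a g x) = q x.
Proof. exact: quotient_invariant qP _ _. Qed.

(** A fibre has at most [#|D|] points, and a coordinate disc has more. *)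
Lemma quotient_not_constant x : ~ (\forall y \near x, q y = q x).
Proof.
have [i ix] := dom_cover x => /(param_nbhs ix)[d d0 hd].
have [u [uinj ud]] := disc_infinite (chart_coord i x) #|D|.+1 d0.
have /choice[g gE] : forall k, exists g, chart_param i (u k) = a g x.
  by move=> k; have [_ _ /esym/q_orbit[g _ e]] := hd _ (ud k); exists g.
have ginj : injective g.
  move=> j k gjk; apply: uinj.
  have [_ <- _] := hd _ (ud j); have [_ <- _] := hd _ (ud k).
  by rewrite !gE gjk.
by have := leq_card g ginj; rewrite card_ord ltnn.
Qed.

Section invariant.
Variable w : holo_form X.
Hypothesis winv : forall g, g \in M -> pullback (a g) w = w.

(* A primitive of [w] near a point [x0] is invariant under the stabiliser of [x0],
   so it descends to the quotient. *)
Lemma invariant_primitive x0 : exists (W : set X) (H : X -> R[i]) (K : Z -> R[i]),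
  [/\ nice W x0, forall x, W x -> dprim w x H & forall x, W x -> K (q x) = H x].
Proof.
have [D0 nD0 _] := nice_basis (@filterT _ (nbhs x0) _).
have [H wH] := nice_primitive w nD0.
have An g : exists B : set X, nbhs x0 B /\ forall x, B x -> g \in M ->
    B (a g x) -> H (a g x) = H x.
  have [gM|gM] := boolP (g \in M); last by exists setT; split; [exact: filterT|].
  (* If [g] fixes [x0], then [H \o a g] and [H] are primitives of the same form with the same value
     at [x0]. Otherwise a small neighbourhood of [x0] is disjoint from its translate. *)
  have [gx|gx] := pselect (a g x0 = x0).
    have gD0 : nbhs x0 (a g @^-1` D0).
      by apply: a_nbhs; rewrite gx; exact: nice_nbhs_center nD0.
    have [B nB sB] := nice_basis (filterI gD0 (nice_nbhs_center nD0)).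
    exists B; split; first exact: nice_nbhs_center nB.
    move=> x Bx _ _.
    have h1 s : B s -> dprim w s (H \o a g).
      move=> Bs; rewrite -(winv gM); apply: (pullback_dprim (ah g)).
      by apply: wH; exact: (sB s Bs).1.
    have h2 s : B s -> dprim w s H by move=> Bs; apply: wH; exact: (sB s Bs).2.
    have := nice_primitive_unique nB h1 h2 (nice_center nB) Bx.
    by rewrite /= gx => /(addIr _).
  have hd : hausdorff_space X := @curve_hausdorff R X.
  have gx' : a g x0 != x0 by apply/eqP.
  rewrite open_hausdorff in hd; have [[P Q] /= [Px Qx] [Po Qo PQ]] := hd _ _ gx'.
  exists (Q `&` a g @^-1` P); split.
    apply: filterI; first by apply: open_nbhs_nbhs; split => //; rewrite -inE.
    by apply: a_nbhs; apply: open_nbhs_nbhs; split => //; rewrite -inE.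
  move=> x [Qx' Px'] _ [Qgx _]; exfalso.
  by have : (P `&` Q) (a g x) by []; rewrite (eqP PQ).
have /choice[B hB] := An.
have [W nW sW] := nice_basis (filterI (nice_nbhs_center nD0)
  (nbhs_seq (enum D) (fun g => (hB g).1))).
have HW x y : W x -> W y -> q x = q y -> H y = H x.
  move=> Wx Wy /q_orbit[g gM yE]; rewrite yE; apply: (hB g).2 => //.
    by apply: (sW x Wx).2; rewrite mem_enum.
  by rewrite -yE; apply: (sW y Wy).2; rewrite mem_enum.
exists W, H, (fun u => H (xget x0 [set x | W x /\ q x = u])); split => //.
  by move=> x /sW[D0x _]; exact: wH.
move=> x Wx; case: xgetP => [y _ [Wy qyx]|/(_ x)]; first exact: HW.
by move=> h; exfalso; apply: h; split.
Qed.

(** In charts the descended primitive is differentiable wherever the derivative of [q] is nonzero at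
    a preimage. Since [q] is not locally constant, the zeros of that derivative are isolated, and
    the possible singularity at [z] is removable by continuity. *)
Lemma local_descent (z : Z) : exists (U : set Z) (K : Z -> R[i]),
  [/\ nbhs z U, forall x, U (q x) -> dprim w x (K \o q) & forall y, U y -> hder y K].
Proof.
have [x0 x0z] := q_surj z.
have [W [H [K [nW wH KH]]]] := invariant_primitive x0.
have [j jz] := dom_cover z; have [i ix0] := dom_cover x0.
have Wq : nbhs z (q @` W) by rewrite -x0z; apply: (quotient_nbhs aP qP); exact: nice_nbhs_center nW.
(* A point over the image of [W] need not lie in [W]; it is brought there by an element of [M],
   under which [w] is invariant. *)
have dK x : (q @` W) (q x) -> dprim w x (K \o q).
  move=> [y Wy /q_orbit[g gM xE]].
  have gV : (g^-1)%g \in M by rewrite groupV.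
  rewrite -(winv gV); apply: (@dprim_near _ _ _ (H \o a g^-1%g)).
    have : nbhs x (a g^-1%g @^-1` W).
      apply: a_nbhs; rewrite xE aK; apply: open_nbhs_nbhs; split => //.
      exact: nice_open nW.
    by apply: filterS => s Ws /=; rewrite -KH// qa.
  by apply: (pullback_dprim (ah _)); apply: wH; rewrite xE aK.
have jn : nbhs (q x0) (chart_dom j).
  by rewrite x0z; apply: open_nbhs_nbhs; split => //; exact: dom_open.
have Wj : nbhs x0 (W `&` q @^-1` chart_dom j).
  by apply: filterI; [exact: nice_nbhs_center nW|exact: q_nbhs].
have [d d0 hd] := param_nbhs ix0 Wj.
pose xi := chart_coord i x0; pose phi := chart_coord j \o q \o chart_param i.
pose B (u : R[i]) := nc (u - xi) < d.
have Bo : copen B by exact: oball_open.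
have Bxi : B xi by rewrite /B subrr nc0.
have phih : holo B phi.
  move=> u /hd[iu cu [_ ju]]; have := map_cder qh iu ju; rewrite cu => h.
  by eexists; exact: h.
have [phi' phi'h phi'E] := cder_holo Bo phih.
(* If [phi'] vanished near [xi], then [phi], and with it [q], would be constant near [x0]. *)
have near_isolated : exists2 e : R, 0 < e & forall u, nc (u - xi) < e -> u != xi ->
    phi' u != 0.
  have [[e e0 he]|//] := isolated_zeros Bo phi'h Bxi.
  exfalso; apply: (@quotient_not_constant x0).
  have m0 : 0 < Num.min d e by rewrite lt_min d0.
  have : nbhs x0 (disc i x0 (Num.min d e)).
    by apply: open_nbhs_nbhs; split; [exact: disc_open|split => //; rewrite subrr nc0].
  apply: filterS => y [iy]; rewrite lt_min => /andP[yd ye].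
  have eq1 : phi (chart_coord i y) = phi xi.
    have mc := @oball_convex R xi (Num.min d e).
    have : seg (fun=> 0) xi (chart_coord i y) = phi (chart_coord i y) - phi xi.
      apply: seg_FTC => t t0 t1.
      have /andP[ud ue] : (nc (xi + t%:C * (chart_coord i y - xi) - xi) < d) &&
          (nc (xi + t%:C * (chart_coord i y - xi) - xi) < e).
        by rewrite -lt_min; apply: mc => //; rewrite ?subrr ?nc0// lt_min yd.
      by rewrite -(he _ ue); exact: phi'E.
    rewrite (@seg_FTC R _ (fun=> 0)) => [|t _ _]; last exact: cder_cst.
    by rewrite subrr => /esym/eqP; rewrite subr_eq0 => /eqP.
  have [_ _ [_ jy]] := hd _ yd; rewrite (coordK iy) in jy.
  move: eq1; rewrite /phi /= (coordK iy) /xi (coordK ix0) => eq1.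
  by rewrite -(coordK jy) eq1 coordK//; exact: nbhs_singleton jn.
have [e e0 he] := near_isolated.
have m0 : 0 < Num.min d e by rewrite lt_min d0.
pose W' := disc i x0 (Num.min d e).
have Wn : nbhs x0 W'.
  by apply: open_nbhs_nbhs; split; [exact: disc_open|split => //; rewrite subrr nc0].
have zW' : nbhs z (q @` W') by rewrite -x0z; exact: (quotient_nbhs aP qP).
have W'W y : W' y -> W y /\ chart_dom j (q y).
  move=> [iy]; rewrite lt_min => /andP[yd _].
  by have [_ _] := hd _ yd; rewrite (coordK iy).
have [c c0 hc] := param_nbhs jz (filterI zW' Wq).
pose kap := K \o chart_param j; pose ze := chart_coord j z.
pose E (v : R[i]) := nc (v - ze) < c.
have Eo : copen E by exact: oball_open.
(* Openness of [q] read in the two charts: this is the hypothesis of [cder_open_quotient], and at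
   [x0] it also yields continuity of [kap]. *)
have opn x (r : R) : W x -> chart_dom i x -> chart_dom j (q x) -> 0 < r ->
    exists2 b, 0 < b & forall v, nc (v - chart_coord j (q x)) < b ->
    exists x', [/\ W x', chart_dom i x', nc (chart_coord i x' - chart_coord i x) < r,
      chart_coord j (q x') = v & chart_param j v = q x'].
  move=> Wx ix jx r0.
  have xn : nbhs x (W `&` disc i x r).
    apply: open_nbhs_nbhs; split; last by do 2?split => //; rewrite subrr nc0.
    by apply: openI; [exact: nice_open nW|exact: disc_open].
  have [b b0 hb] := param_nbhs jx (quotient_nbhs aP qP xn).
  exists b => // v /hb[jv cv [x' [Wx' [ix' x'r]] x'v]].
  by exists x'; split => //; rewrite x'v.
have kapE x' v : W x' -> chart_dom i x' -> chart_param j v = q x' ->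
    kap v = (H \o chart_param i) (chart_coord i x').
  by move=> Wx' ix' pv; rewrite /kap /= pv KH// (coordK ix').
(* By the choice of [c] the point has a preimage in [W']. It differs from [x0] because [v] differs
   from [ze], so the derivative of [phi] is nonzero there. *)
have kap_ext v : E v -> v != ze -> exists b, cder kap v b.
  move=> /hc[jv cv [[x W'x xv] _]] vze.
  have [Wx jx] := W'W _ W'x; have [ix] := W'x; rewrite lt_min => /andP[xd xe].
  have phix : phi (chart_coord i x) = v by rewrite /phi /= (coordK ix) xv cv.
  have xne : chart_coord i x != xi.
    apply: contraNneq vze => xxi; rewrite -phix xxi /phi /xi /= (coordK ix0) x0z.
    exact: eqxx.
  eexists; rewrite -phix.
  apply: (@cder_open_quotient R phi (H \o chart_param i) kap (chart_coord i x)
    (phi' (chart_coord i x)) (w i x)).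
  - exact: phi'E.
  - exact: he.
  - exact: wH.
  - by rewrite phix; apply: kapE.
  move=> r r0; have [b b0 hb] := opn x r Wx ix jx r0.
  exists b => // v' v'b; have [|x' [Wx' ix' x'r cv' pv']] := hb v'.
    by move: v'b; rewrite /phi /= (coordK ix).
  exists (chart_coord i x'); split => //; last exact: kapE.
  by rewrite /phi /= (coordK ix').
have kap_cont : ccont (ze : R[i]^o) kap.
  apply/ccontP => r r0; have /ccontP/(_ r r0)[b b0 hb] :=
    cder_cont (wH _ (nice_center nW) i ix0).
  have [b' b'0 hb'] := opn x0 b (nice_center nW) ix0 (nbhs_singleton jn) b0.
  exists b' => // v vb'; have [|x' [Wx' ix' x'r cv' pv']] := hb' v.
    by rewrite x0z.
  rewrite (kapE x')// (@kapE x0 ze)//; first exact: hb.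
    exact: nice_center nW.
  by rewrite /ze (coordK jz) x0z.
have kaph : holo E kap := removable Eo kap_cont kap_ext.
exists ((q @` W) `&` disc j z c), K; split.
- apply: filterI => //; apply: open_nbhs_nbhs; split; first exact: disc_open.
  by split => //; rewrite subrr nc0.
- by move=> x [Wx _]; exact: dK.
- by move=> y [_ [jy /kaph[b hb]]]; exact: hder_chart hb.
Qed.

Lemma invariant_descent : exists v : holo_form Z, pullback q v = w.
Proof.
have : forall z : Z, exists UK : set Z * (Z -> R[i]), [/\ nbhs z UK.1,
    forall x, UK.1 (q x) -> dprim w x (UK.2 \o q) & forall y, UK.1 y -> hder y UK.2].
  by move=> z; have [U [K h]] := local_descent z; exists (U, K).
move=> /choice[UK hUK].
have [||y z yz|v hv] := @glue_form R Z (fun z => (UK z).2) (fun z => interior (UK z).1).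
- by move=> z; apply: nbhs_interior; have [] := hUK z.
- by move=> y z /interior_subset; have [_ _] := hUK y; apply.
(* Pulled back to a disc around a preimage of [z], both functions are primitives of [w]; openness of
   [q] brings the equality up to a constant down to [Z]. *)
- have [x xz] := q_surj z; have [_ dy _] := hUK y; have [nz dz _] := hUK z.
  have n1 : nbhs x (q @^-1` ((UK y).1 `&` (UK z).1)).
    by apply: q_nbhs; rewrite xz; apply: filterI.
  have [W nW sW] := nice_basis n1.
  exists ((UK y).2 z - (UK z).2 z).
  have : nbhs z (q @` W).
    by rewrite -xz; apply: (quotient_nbhs aP qP); exact: nice_nbhs_center nW.
  apply: filterS => _ [s Ws <-].
  have h1 t : W t -> dprim w t ((UK y).2 \o q) by move=> Wt; apply: dy; exact: (sW t Wt).1.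
  have h2 t : W t -> dprim w t ((UK z).2 \o q) by move=> Wt; apply: dz; exact: (sW t Wt).2.
  have := nice_primitive_unique nW h1 h2 (nice_center nW) Ws.
  rewrite /= xz => e; apply/eqP; rewrite -subr_eq0; apply/eqP.
  transitivity ((UK y).2 (q s) - (UK y).2 z - ((UK z).2 (q s) - (UK z).2 z)); first by ring.
  by rewrite e subrr.
exists v; apply: (pullback_eq_dprim qh) => x; have [n d _] := hUK (q x).
exists (UK (q x)).2; last by apply: d; exact: nbhs_singleton n.
by apply: hv; exact: nbhs_singleton (nbhs_interior n).
Qed.
End invariant.

Lemma pullback_inj_quotient : injective (pullback q).
Proof.
move=> u v uv; apply: holo_form_eq => z; have [x xz] := q_surj z.
have [N nN _] := nice_basis (@filterT _ (nbhs z) _).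
have [H uH] := nice_primitive u nN; have [K vK] := nice_primitive v nN.
have xN : nbhs x (q @^-1` N) by apply: q_nbhs; rewrite xz; exact: nice_nbhs_center nN.
have [W nW sW] := nice_basis xN.
have h1 t : W t -> dprim (pullback q u) t (H \o q).
  by move=> Wt; apply: (pullback_dprim qh); apply: uH; exact: sW.
have h2 t : W t -> dprim (pullback q u) t (K \o q).
  by move=> Wt; rewrite uv; apply: (pullback_dprim qh); apply: vK; exact: sW.
exists H; first exact: uH (nice_center nN).
have : nbhs z (q @` W).
  by rewrite -xz; apply: (quotient_nbhs aP qP); exact: nice_nbhs_center nW.
move=> zW; apply: (@dprim_near _ _ _ (fun t => K t + (H z - K z))).
  apply: filterS zW => _ [s Ws <-].
  have := nice_primitive_unique nW h1 h2 (nice_center nW) Ws.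
  rewrite /= xz => e; apply/eqP; rewrite -subr_eq0 -oppr_eq0; apply/eqP.
  transitivity (H (q s) - H z - (K (q s) - K z)); first by ring.
  by rewrite e subrr.
by apply: dprimDc; exact: vK (nice_center nN).
Qed.

Lemma pullback_action_comp g h (w : holo_form X) :
  pullback (a (g * h)%g) w = pullback (a h) (pullback (a g) w).
Proof.
by apply: pullback_comp => //; apply/funext => x /=; rewrite aM.
Qed.

Lemma exists_trace (w : holo_form X) :
  exists v : holo_form Z, pullback q v = \sum_(g in M) pullback (a g) w.
Proof.
apply: invariant_descent => g gM; rewrite (pullback_sum (ah g)).
under eq_bigr do rewrite -pullback_action_comp.
rewrite [RHS](reindex_inj (mulIg g)) /=; apply: eq_bigl => h.
by rewrite groupMr.
Qed.
End Descent.

(** * Connected components of kernels of norm maps *)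
Section Components.
Variable R : realType.

(** A connected subset of [R] with two points contains a segment of positive Lebesgue measure. *)
Lemma connected_countable_eq (E : set R) (x y : R) :
  connected E -> countable E -> E x -> E y -> x = y.
Proof.
move=> /connected_intervalP Ei Ec; wlog xy : x y / x <= y.
  move=> h Ex Ey; have [xy|/ltW yx] := lerP x y; first exact: h.
  by apply/esym; exact: h.
move=> Ex Ey; apply/eqP; rewrite eq_le xy /= leNgt; apply/negP => lt_xy.
have sub : `[x, y]%classic `<=` E.
  by move=> z /=; rewrite in_itv /= => zxy; exact: (Ei _ _ Ex Ey).
have c : countable (`[x, y]%classic : set R).
  by apply: sub_countable Ec; exact: subset_card_le.
have := countable_lebesgue_measure0 c.
rewrite lebesgue_measure_itv /= lte_fin lt_xy -EFinD => /eqP.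
by rewrite eqe subr_eq0 gt_eqF.
Qed.

Lemma countable_image_sub (T U : Type) (f : T -> U) (A : set T) :
  countable A -> countable (f @` A).
Proof. by apply: sub_countable; exact: card_image_le. Qed.

Variable X : curve R.

Lemma fun_mulrz (T : Type) (P : T -> R[i]) (c : int) w : (P *~ c) w = P w *~ c.
Proof.
have h n : (P *+ n) w = P w *+ n.
  by elim: n => [|n IH]; rewrite ?mulr0n// !mulrS -IH.
by case: c => n; [exact: h|rewrite !NegzE !mulrNz; congr (- _); exact: h].
Qed.

Lemma zspan_eval_countable (T : Type) (s : seq (T -> R[i])) (w : T) :
  countable [set z : R[i] | exists2 P, zspan s P & z = P w].
Proof.
pose g (c : seq int) := \sum_(k < size s) nth 0 s k w *~ nth 0 c k.
have : countable (range g) by apply: countable_image_sub; exact: countableP.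
apply: sub_countable; apply: subset_card_le => _ [P + ->].
suff h (t : seq (T -> R[i])) (Q : T -> R[i]) : zspan t Q ->
    exists c : seq int, Q w = \sum_(k < size t) nth 0 t k w *~ nth 0 c k.
  by move=> /h[c ->]; exists c.
elim: t Q => [Q ->|b t IH Q [c /IH[cs hcs]]]; first by exists [::]; rewrite big_ord0.
exists (c :: cs); rewrite big_ord_recl /= -hcs.
have -> : (Q - b *~ c) w = Q w - (b *~ c) w by [].
by rewrite fun_mulrz subrKC.
Qed.

(** Evaluation at [w] is continuous for pointwise convergence. Its real and imaginary parts map a
    connected set through 0 into a countable set of reals. *)
Lemma component0_vanish (K : set (holo_form X -> R[i]^o)) (w : holo_form X)
    (S : set R[i]) : K (fun=> 0) -> countable S -> (forall l, K l -> S (l w)) ->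
  forall l, component0 X K l -> l w = 0.
Proof.
move=> K0 Sc KS l [C [C0 CK Cc] Cl].
have key (f : R[i] -> R) : (forall z : R[i], ccont (z : R[i]^o) id ->
    {for z, continuous (f : R[i]^o -> R)}) -> f (l w) = f 0.
  move=> fc; pose ev (m : {ptws holo_form X -> R[i]^o}) := f (m w).
  have evc : continuous ev.
    move=> m; apply: (@continuous_comp _ _ _ (fun m : {ptws holo_form X -> R[i]^o} => m w) f).
      exact: (@proj_continuous (holo_form X) (fun=> R[i]^o) w m).
    by apply: fc; exact: ccont_id.
  have conn : connected (ev @` C).
    by apply: connected_continuous_connected => //; exact: continuous_subspaceT.
  apply: (connected_countable_eq conn).
  - apply: (@sub_countable _ _ _ (f @` S)); last exact: countable_image_sub.
    by apply: subset_card_le => _ [m /CK/KS Sm <-]; exists (m w).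
  - by exists l.
  - by exists (fun=> 0).
have rE : complex.Re (l w) = 0.
  by rewrite (key (@complex.Re R))// => z /continuous_Re.
have iE : complex.Im (l w) = 0.
  by rewrite (key (@complex.Im R))// => z /continuous_Im.
by rewrite (complexE (l w)) rE iE rmorph0 mulr0 addr0.
Qed.

(** The real line through [l] connects [l] to 0 inside [V]. *)
Lemma component0_linear (K V : set (holo_form X -> R[i]^o)) :
  V `<=` K -> (forall (t : R) l, V l -> V (fun w => t%:C * l w)) ->
  V `<=` component0 X K.
Proof.
move=> VK Vt l Vl.
pose p (t : R) : {ptws holo_form X -> R[i]^o} := fun w => t%:C * l w.
have pc : continuous p.
  move=> t; apply/cvg_sup => w; rewrite cvg_image; last first.
    by rewrite eqEsubset; split=> v // _; exists (cst v).
  move=> W /= Wn; exists ((fun m : holo_form X -> R[i]^o => m w) @^-1` W).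
    have : ccont t (fun s => s%:C * l w).
      by apply: ccontM; [apply: ccont_real; exact: cvg_id|exact: ccont_cst].
    by move=> /ccontE h; exact: (h _ Wn).
  by rewrite eqEsubset; split => [z [m /= Wm <-]//|z Wz]; exists (fun=> z).
exists (range p).
  split.
  - by exists 0 => //; apply/funext => w; rewrite /p rmorph0 mul0r.
  - by move=> _ [t _ <-]; apply: VK; exact: Vt.
  - apply: connected_continuous_connected.
      by apply/connected_intervalP => x y _ _ z _.
    exact: continuous_subspaceT.
by exists 1 => //; apply/funext => w; rewrite /p rmorph1 mul1r.
Qed.

End Components.

(** * Universal covers of Prym varieties as kernels of norm maps *)

Section PrymCovers.
Variable R : realType.

Lemma norm_map_linear (X Y : curve R) (f : X -> Y) l : holomorphic_map f ->
  dual_forms X l -> dual_forms Y (norm_map f l).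
Proof. by move=> fh hl c u v; rewrite /norm_map pullback_linear// hl. Qed.

Lemma dual_forms_scale (X : curve R) (c : R[i]) l : dual_forms X l ->
  dual_forms X (fun w => c * l w).
Proof. by move=> hl b u v; rewrite hl; ring. Qed.

Lemma dual_formsD (X : curve R) l m : dual_forms X l -> dual_forms X m ->
  dual_forms X (l + m).
Proof.
move=> hl hm b u v; rewrite -[LHS]/(l _ + m _) hl hm.
rewrite -[(l + m) u]/(l u + m u) -[(l + m) v]/(l v + m v); ring.
Qed.

Definition norm_kernel (X Y : curve R) (f : X -> Y) : set (holo_form X -> R[i]^o) :=
  [set l | dual_forms X l /\ forall w, norm_map f l w = 0].

Lemma norm_kernel_scale (X Y : curve R) (f : X -> Y) (c : R[i]) l :
  norm_kernel f l -> norm_kernel f (fun w => c * l w).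
Proof.
move=> [hl h0]; split; first exact: dual_forms_scale.
by move=> w; have := h0 w; rewrite /norm_map => ->; rewrite mulr0.
Qed.

Lemma period_values_countable (Y : curve R) (w : holo_form Y) :
  countable [set z : R[i] | exists2 P, periods Y P & z = P w].
Proof.
have [s hs] := periods_zspan Y.
apply: sub_countable (zspan_eval_countable s w).
by apply: subset_card_le => _ [P /hs hP ->]; exists P.
Qed.

Lemma prym_coverE (X Y : curve R) (f : X -> Y) : holomorphic_map f ->
  prym_cover f = norm_kernel f.
Proof.
move=> fh; apply/seteqP; split.
  move=> l Cl; have [hl _] := connected_component_sub Cl; split => // w.
  apply: (component0_vanish _ (period_values_countable w) _ Cl).
    split; first by move=> b u v /=; rewrite mulr0 addr0.
    exact: periods0.
  by move=> m [_ pm]; exists (norm_map f m).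
apply: component0_linear => [l [hl h0]|t l]; last exact: norm_kernel_scale.
split => //; have -> : norm_map f l = 0 by apply/funext.
exact: periods0.
Qed.

Lemma prym_inter_coverE (X Y Z : curve R) (f : X -> Y) (h : X -> Z) :
  holomorphic_map f -> holomorphic_map h ->
  component0 X (preimage_points X (prym_cover f) `&` preimage_points X (prym_cover h))
  = norm_kernel f `&` norm_kernel h.
Proof.
move=> fh hh; rewrite !prym_coverE//; apply/seteqP; split.
  move=> l Cl.
  have [[v [hv _] pv] _] := connected_component_sub Cl.
  have hl : dual_forms X l.
    rewrite -(subrK v l) addrC; apply: dual_formsD => //; exact: periods_linear.
  have key (W : curve R) (k : X -> W) : holomorphic_map k ->
      (forall m, (preimage_points X (norm_kernel f) `&`
        preimage_points X (norm_kernel h)) m -> preimage_points X (norm_kernel k) m) ->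
      forall w, norm_map k l w = 0.
    move=> kh hk w.
    apply: (component0_vanish _ (period_values_countable w) _ Cl).
      have z0 (W' : curve R) (k' : X -> W') : preimage_points X (norm_kernel k') (fun=> 0).
        exists (fun=> 0); first by split => // b u v0 /=; rewrite mulr0 addr0.
        have -> : ((fun=> 0) - (fun=> 0) : holo_form X -> R[i]) = 0 by exact: subrr.
        exact: periods0.
      by split; exact: z0.
    (* [m] is a period plus an element [v'] of the kernel, so its norm takes the values of the norm
       of a period. *)
    move=> m /hk[v' [_ v'0] pm]; exists (norm_map k (m - v')); first exact: periods_norm_map.
    have := v'0 w; rewrite /norm_map -[(m - v') _]/(m _ - v' _) => ->.
    by rewrite subr0.
  by split; split => //; apply: key => // m [].
have z0 (W' : curve R) (k' : X -> W') l : norm_kernel k' l ->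
    preimage_points X (norm_kernel k') l.
  by move=> hl; exists l => //; rewrite subrr; exact: periods0.
apply: component0_linear => [l [h1 h2]|t l [h1 h2]]; split; try exact: z0;
  exact: norm_kernel_scale.
Qed.
End PrymCovers.

(** * Isogenies *)
Section QuasiIsogenies.
Variable R : realType.
Implicit Types A B C : torus R.

(** The record [torus] carries two bare subsets; here they are a complex subspace and a subgroup of
    it. *)
Definition good_torus A : Prop :=
  [/\ torus_cover A 0,
      forall (c : R[i]) u v, torus_cover A u -> torus_cover A v ->
        torus_cover A (c *: u + v),
      torus_lattice A 0 /\ torus_lattice A `<=` torus_cover A
    & forall u v, torus_lattice A u -> torus_lattice A v -> torus_lattice A (u - v)].

(** Isogeny with a quasi-inverse. Symmetry is built in, and both composites are multiplication by
    the same integer. *)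
Definition qisog A B : Prop := [/\ good_torus A, good_torus B &
  exists F G (n : nat), [/\ @torus_hom R A B F, @torus_hom R B A G, (0 < n)%N,
    forall v, torus_cover A v -> G (F v) = v *+ n
  & forall w, torus_cover B w -> F (G w) = w *+ n]].

Section good.
Variable A : torus R.
Hypothesis gA : good_torus A.

Lemma cover0 : torus_cover A 0. Proof. by have [] := gA. Qed.
Lemma coverD u v : torus_cover A u -> torus_cover A v -> torus_cover A (u + v).
Proof.
by have [_ h _ _] := gA => Au Av; have := h 1 u v Au Av; rewrite scale1r.
Qed.
Lemma coverZ (c : R[i]) v : torus_cover A v -> torus_cover A (c *: v).
Proof.
by have [A0 h _ _] := gA => Av; have := h c v 0 Av A0; rewrite addr0.
Qed.
Lemma coverMn v n : torus_cover A v -> torus_cover A (v *+ n).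
Proof.
by move=> Av; elim: n => [|n IH]; rewrite ?mulr0n ?mulrS; [exact: cover0|exact: coverD].
Qed.
Lemma lattice0 : torus_lattice A 0. Proof. by have [_ _ [h _] _] := gA. Qed.
Lemma latticeB u v : torus_lattice A u -> torus_lattice A v -> torus_lattice A (u - v).
Proof. by have [_ _ _ h] := gA; exact: h. Qed.
Lemma latticeN v : torus_lattice A v -> torus_lattice A (- v).
Proof. by move=> Av; rewrite -sub0r; apply: latticeB => //; exact: lattice0. Qed.
Lemma latticeD u v : torus_lattice A u -> torus_lattice A v -> torus_lattice A (u + v).
Proof. by move=> Au Av; rewrite -[v]opprK; apply: latticeB => //; exact: latticeN. Qed.
Lemma latticeMn v n : torus_lattice A v -> torus_lattice A (v *+ n).
Proof.
by move=> Av; elim: n => [|n IH]; rewrite ?mulr0n ?mulrS; [exact: lattice0|exact: latticeD].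
Qed.
End good.

Section hom.
Variables (A B : torus R) (F : torus_ambient A -> torus_ambient B).
Hypotheses (gA : good_torus A) (hF : @torus_hom R A B F).

Lemma hom_linear (c : R[i]) u v : torus_cover A u -> torus_cover A v ->
  F (c *: u + v) = c *: F u + F v.
Proof. by have [_ h _] := hF; exact: h. Qed.
Lemma hom0 : F 0 = 0.
Proof.
have := hom_linear 1 (cover0 gA) (cover0 gA); rewrite !scale1r addr0.
by move/eqP; rewrite -{1}[F 0]addr0 (inj_eq (addrI _)) eq_sym => /eqP.
Qed.
Lemma homD u v : torus_cover A u -> torus_cover A v -> F (u + v) = F u + F v.
Proof. by move=> Au Av; have := hom_linear 1 Au Av; rewrite !scale1r. Qed.
Lemma homZ (c : R[i]) v : torus_cover A v -> F (c *: v) = c *: F v.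
Proof. by move=> Av; have := hom_linear c Av (cover0 gA); rewrite !addr0 hom0 addr0. Qed.
Lemma homMn v n : torus_cover A v -> F (v *+ n) = F v *+ n.
Proof.
move=> Av; elim: n => [|n IH]; first by rewrite !mulr0n hom0.
by rewrite !mulrS homD ?IH//; exact: coverMn.
Qed.
End hom.

Lemma qisog_refl A : good_torus A -> qisog A A.
Proof. by move=> gA; split => //; exists id, id, 1%N; split. Qed.

Lemma qisog_sym A B : qisog A B -> qisog B A.
Proof. by move=> [gA gB [F [G [n [hF hG n0 GF FG]]]]]; split => //; exists G, F, n. Qed.

Lemma torus_hom_comp A B C F G : @torus_hom R A B F -> @torus_hom R B C G ->
  @torus_hom R A C (G \o F).
Proof.
move=> [F1 F2 F3] [G1 G2 G3]; split => /=.
- by move=> v /F1/G1.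
- by move=> c u v Au Av; rewrite F2// G2//; exact: F1.
- by move=> v /F3/G3.
Qed.

Lemma torus_homMn A B F n : good_torus B -> @torus_hom R A B F ->
  @torus_hom R A B (fun v => F v *+ n).
Proof.
move=> gB [F1 F2 F3]; split.
- by move=> v /F1; exact: coverMn.
- by move=> c u v Au Av; rewrite F2// mulrnDl scalerMnr.
- by move=> v /F3; exact: latticeMn.
Qed.

Lemma qisog_trans A B C : qisog A B -> qisog B C -> qisog A C.
Proof.
move=> [gA gB [F [G [n [hF hG n0 GF FG]]]]] [_ gC [H [K [m [hH hK m0 KH HK]]]]].
split => //; exists (H \o F), (G \o K), (n * m)%N; split.
- exact: torus_hom_comp hF hH.
- exact: torus_hom_comp hK hG.
- by rewrite muln_gt0 n0.
- move=> v Av /=; have Fv : torus_cover B (F v) by have [h _ _] := hF; exact: h.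
  by rewrite KH// (homMn gB hG)// GF// mulrnA.
- move=> w Cw /=; have Kw : torus_cover B (K w) by have [h _ _] := hK; exact: h.
  by rewrite FG// (homMn gB hH)// HK// -mulrnA mulnC.
Qed.

Lemma good_prod A B : good_torus A -> good_torus B -> good_torus (prod_torus A B).
Proof.
move=> [A0 A1 [A2 A2'] A3] [B0 B1 [B2 B2'] B3]; split => /=.
- by split.
- by move=> c [u u'] [v v'] [/= ? ?] [/= ? ?]; split; [exact: A1|exact: B1].
- by split=> [|[u v] [/= /A2' ? /B2' ?]]; split.
- by move=> [u u'] [v v'] [/= ? ?] [/= ? ?]; split; [exact: A3|exact: B3].
Qed.

Lemma pairMn (U V : lmodType R[i]) (u : U) (v : V) n : ((u, v) : U * V) *+ n = (u *+ n, v *+ n).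
Proof.
elim: n => [|n IH]; first by rewrite !mulr0n.
by rewrite !mulrS IH.
Qed.

Lemma torus_hom_prod A B A' B' F G : @torus_hom R A A' F -> @torus_hom R B B' G ->
  @torus_hom R (prod_torus A B) (prod_torus A' B') (fun v => (F v.1, G v.2)).
Proof.
move=> [F1 F2 F3] [G1 G2 G3]; split.
- by move=> [u v] [/= /F1 ? /G1 ?]; split.
- by move=> c [u u'] [v v'] [/= ? ?] [/= ? ?]; rewrite /= F2// G2.
- by move=> [u v] [/= /F3 ? /G3 ?]; split.
Qed.

Lemma qisog_prod A B A' B' : qisog A A' -> qisog B B' ->
  qisog (prod_torus A B) (prod_torus A' B').
Proof.
move=> [gA gA' [F [G [n [hF hG n0 GF FG]]]]] [gB gB' [H [K [m [hH hK m0 KH HK]]]]].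
split; [exact: good_prod|exact: good_prod|].
(* The quasi-inverses are multiplied by [m] and [n] respectively to reach the common integer
   [n * m]. *)
exists (fun v => (F v.1, H v.2)), (fun v => (G v.1 *+ m, K v.2 *+ n)), (n * m)%N; split.
- exact: torus_hom_prod.
- by apply: (torus_hom_prod (torus_homMn _ gA hG) (torus_homMn _ gB hK)).
- by rewrite muln_gt0 n0.
- move=> [u v] [/= Au Bv]; rewrite GF// KH// -!mulrnA [(m * n)%N]mulnC.
  by rewrite [RHS]pairMn.
- move=> [u v] [/= Au Bv]; rewrite [RHS]pairMn.
  have Gu : torus_cover A (G u) by have [h _ _] := hG; exact: h.
  have Kv : torus_cover B (K v) by have [h _ _] := hK; exact: h.
  rewrite (homMn gA hF)// (homMn gB hH)// FG// HK// -!mulrnA.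
  by rewrite [(m * n)%N]mulnC.
Qed.

Definition finite_quotients A := forall n : nat, (0 < n)%N ->
  exists k : seq (torus_ambient A), forall v, torus_lattice A v ->
    exists2 u, u \in k & exists2 l, torus_lattice A l & v - u = l *+ n.

(** Covers are complex vector spaces, so [G w] may be divided by [n]; this gives surjectivity. If
    [F v] is in the lattice of [B], then [v *+ n] is in that of [A], so the kernel is bounded by the
    finite quotient of the lattice by its multiples by [n]. *)
Lemma qisog_isogenous A B : finite_quotients A -> qisog A B -> isogenous A B.
Proof.
move=> fA [gA gB [F [G [n [hF hG n0 GF FG]]]]]; exists F.
have nC : (n%:R : R[i]) != 0 by rewrite pnatr_eq0 -lt0n.
split => //.
  move=> w Bw; have Gw : torus_cover A (G w) by have [h _ _] := hG; exact: h.
  exists (n%:R^-1 *: G w); first exact: coverZ.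
  rewrite (homZ gA hF)// FG// -[w *+ n]scaler_nat scalerA mulVf// scale1r subrr.
  exact: lattice0.
have [k hk] := fA n n0; exists [seq n%:R^-1 *: u | u <- k] => v Av BFv.
have : torus_lattice A (v *+ n) by rewrite -GF//; have [_ _ h] := hG; exact: h.
move=> /hk[u uk [l Ll lE]]; exists (n%:R^-1 *: u); first exact: map_f.
suff -> : v - n%:R^-1 *: u = l by [].
apply: (scalerI nC); rewrite scalerBr scalerA divff// scale1r !scaler_nat.
exact: lE.
Qed.

End QuasiIsogenies.

(** * The rational group ring *)
Section GroupRing.
Variable D : finGroupType.
Local Notation G := [set: D]%G.
Local Notation aG := (regular_repr rat G).
Local Notation RG := (group_ring rat G).
Local Notation M := 'M[rat]_#|G|.
Implicit Types (x y z : M) (g h : D).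

Lemma regularM g h : aG (g * h)%g = aG g *m aG h.
Proof. by rewrite repr_mxM ?inE. Qed.
Lemma regular1 : aG 1%g = 1%:M. Proof. exact: repr_mx1. Qed.

Lemma ring_reg g : (aG g \in RG)%MS. Proof. by apply: envelop_mx_id; rewrite inE. Qed.
Lemma ring1 : (1%:M \in RG)%MS. Proof. exact: envelop_mx1. Qed.
Lemma ringM x y : (x \in RG)%MS -> (y \in RG)%MS -> (x *m y \in RG)%MS.
Proof. exact: envelop_mxM. Qed.
Lemma ring0 : ((0 : M) \in RG)%MS. Proof. by rewrite linear0 sub0mx. Qed.
Lemma ringD x y : (x \in RG)%MS -> (y \in RG)%MS -> (x + y \in RG)%MS.
Proof. by move=> hx hy; rewrite linearD addmx_sub. Qed.
Lemma ringZ (c : rat) x : (x \in RG)%MS -> (c *: x \in RG)%MS.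
Proof. by move=> hx; rewrite linearZ scalemx_sub. Qed.
Lemma ringN x : (x \in RG)%MS -> (- x \in RG)%MS.
Proof. by move=> hx; rewrite -scaleN1r ringZ. Qed.
Lemma ringB x y : (x \in RG)%MS -> (y \in RG)%MS -> (x - y \in RG)%MS.
Proof. by move=> hx hy; rewrite ringD ?ringN. Qed.
Lemma ring_sum (I : Type) (r : seq I) (P : pred I) (F : I -> M) :
  (forall i, P i -> (F i \in RG)%MS) -> (\sum_(i <- r | P i) F i \in RG)%MS.
Proof. move=> h; elim/big_rec: _ => [|i y Pi hy]; [exact: ring0|by rewrite ringD ?h]. Qed.

Definition gcoef x g : rat := gring_row x 0 (gring_index G g).

Lemma gcoef_linear (c : rat) x y g : gcoef (c *: x + y) g = c * gcoef x g + gcoef y g.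
Proof. by rewrite /gcoef linearP !mxE. Qed.
Lemma gcoefD x y g : gcoef (x + y) g = gcoef x g + gcoef y g.
Proof. by have := gcoef_linear 1 x y g; rewrite scale1r mul1r. Qed.
Lemma gcoef0 g : gcoef 0 g = 0.
Proof. by rewrite /gcoef linear0 mxE. Qed.
Lemma gcoefZ (c : rat) x g : gcoef (c *: x) g = c * gcoef x g.
Proof. by have := gcoef_linear c x 0 g; rewrite gcoef0 !addr0. Qed.
Lemma gcoef_reg g h : gcoef (aG g) h = (h == g)%:R.
Proof.
rewrite /gcoef /gring_row !mxE eqxx /= gring_indexK ?inE// mul1g.
congr (nat_of_bool _)%:R; apply/eqP/eqP => [e|-> //].
by rewrite -(@gring_indexK D G h) ?inE// e gring_indexK ?inE.
Qed.

Lemma ring_sumE x : (x \in RG)%MS -> x = \sum_g gcoef x g *: aG g.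
Proof.
move=> /envelop_mxP[c xE].
have xE' : x = \sum_g c g *: aG g.
  by rewrite {1}xE; apply: eq_bigl => g; rewrite inE.
rewrite {1}xE'; apply: eq_bigr => g _; congr (_ *: _).
rewrite xE' (big_morph (gcoef^~ g) (fun x y => gcoefD x y g) (gcoef0 g)).
rewrite (bigD1 g)//= big1 ?addr0 => [|h hg]; first by rewrite gcoefZ gcoef_reg eqxx mulr1.
by rewrite gcoefZ gcoef_reg eq_sym (negPf hg) mulr0.
Qed.

Lemma gring_op_sum n (U : mx_representation rat G n) x : (x \in RG)%MS ->
  gring_op U x = \sum_g gcoef x g *: U g.
Proof.
move=> /ring_sumE {1}->; rewrite linear_sum; apply: eq_bigr => g _.
by rewrite linearZ /= gring_opG ?inE.
Qed.

Lemma gring_opMr n (U : mx_representation rat G n) x y : (y \in RG)%MS ->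
  gring_op U (x *m y) = gring_op U x *m gring_op U y.
Proof. exact: gring_opM. Qed.

Lemma card_neq0 (N : {group D}) : (#|N|%:R : rat) != 0.
Proof. by rewrite pnatr_eq0 -lt0n cardG_gt0. Qed.

(* By Maschke, the regular representation is a sum of irreducible ones. *)
Lemma ring_eq0 x : (x \in RG)%MS ->
  (forall k (U : mx_representation rat G k), mx_irreducible U -> gring_op U x = 0) ->
  x = 0.
Proof.
move=> Rx h; have red : mx_completely_reducible aG 1%:M.
  by apply: mx_Maschke_pchar; rewrite /pgroup pcharf'_nat; exact: card_neq0.
have ss := mx_reducible_semisimple (mxmodule1 aG) red.
apply/eqP; apply: ss => -[I W /= simW defW _]; apply/eqP.
have Wx i : W i *m x = 0.
  have [modW _ _] := simW i.
  have irr : mx_irreducible (submod_repr modW) by apply/submod_mx_irr.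
  have := h _ _ irr; rewrite gring_op_sum// => op0.
  have J m (y : 'M[rat]_(m, \rank (W i))) :
      val_submod (y *m (\sum_g gcoef x g *: submod_repr modW g)) = val_submod y *m x.
    rewrite {2}(ring_sumE Rx) mulmx_sumr linear_sum mulmx_sumr.
    apply: eq_bigr => g _; rewrite -!scalemxAr linearZ /=; congr (_ *: _).
    by rewrite val_submodJ ?inE.
  have := J _ (in_submod (W i) (W i)); rewrite op0 mulmx0 linear0 in_submodK//.
have : ((1%:M : M) <= \sum_(i : I) W i)%MS by rewrite -defW.
move=> /sub_sumsmxP[u uE]; rewrite -[x]mul1mx uE mulmx_suml big1// => i _.
by rewrite -mulmxA Wx mulmx0.
Qed.

Lemma gring_op_rsim_scalar n m (U : mx_representation rat G n)
    (W : mx_representation rat G m) g (c : rat) :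
  mx_rsim U W -> W g = c%:M -> U g = c%:M.
Proof.
move=> [B eqn Bfree Bhom] Wg; apply: (row_free_inj Bfree).
by rewrite Bhom ?inE// Wg mul_mx_scalar mul_scalar_mx.
Qed.

(** Tested on irreducible representations: on those similar to [W] the element [g] acts by [c], and
    on all others [e] acts by 0. *)
Lemma simple_factor_scalar m (W : mx_representation rat G m) e g (c : rat) :
  simple_factor W e -> W g = c%:M -> aG g *m e = c *: e /\ e *m aG g = c *: e.
Proof.
move=> [Re he] Wg; have Rg := ring_reg g.
have key y : (y \in RG)%MS -> (forall n (U : mx_representation rat G n),
    gring_op U e = 0 \/ U g = c%:M -> gring_op U y = c *: gring_op U e) -> y = c *: e.
  move=> Ry hy; apply/eqP; rewrite -subr_eq0; apply/eqP; apply: ring_eq0.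
    by rewrite ringB ?ringZ.
  move=> n U irrU; rewrite linearB linearZ /= hy ?subrr//.
  have [UW|nUW] := pselect (mx_rsim U W); last by left; exact: he.
  by right; exact: gring_op_rsim_scalar Wg.
split; apply: key => [|n U]; try by rewrite ringM.
  rewrite gring_opMr// gring_opG ?inE// => -[->|->].
    by rewrite mulmx0 scaler0.
  by rewrite mul_scalar_mx.
rewrite gring_opMr// gring_opG ?inE// => -[->|->].
  by rewrite mul0mx scaler0.
by rewrite mul_mx_scalar.
Qed.

Lemma ring_eigen_left e z (chi : D -> rat) : (e \in RG)%MS ->
  (forall g, aG g *m z = chi g *: z) -> exists c, e *m z = c *: z.
Proof.
move=> Re hz; exists (\sum_g gcoef e g * chi g).
rewrite {1}(ring_sumE Re) mulmx_suml scaler_suml; apply: eq_bigr => g _.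
by rewrite -scalemxAl hz scalerA.
Qed.

(** Left multiplication by the group moves [z] only by scalars, so [e = e *m z] is a multiple of
    [z]; idempotency forces the scalar to be 1. *)
Lemma eigen_idempotent_eq e z (chi : D -> rat) : (e \in RG)%MS -> e *m e = e ->
  e != 0 -> e *m z = e -> (forall g, aG g *m z = chi g *: z) -> e = z.
Proof.
move=> Re ee e0 ez hz; have [c cE] := ring_eigen_left Re hz.
rewrite ez in cE; have : c *: e = e by rewrite -{1}ez -[in RHS]ee {3}cE scalemxAr.
move/eqP; rewrite -subr_eq0 -{2}[e]scale1r -scalerBl scaler_eq0 (negPf e0) orbF.
by rewrite subr_eq0 => /eqP c1; rewrite cE c1 scale1r.
Qed.

Definition avg (N : {group D}) : M := #|N|%:R^-1 *: \sum_(g in N) aG g.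

Lemma ring_avg N : (avg N \in RG)%MS.
Proof. by rewrite ringZ// ring_sum// => g _; exact: ring_reg. Qed.

Lemma avg_fix_mul (N : {group D}) m (y : 'M[rat]_(#|G|, m)) : (forall g, g \in N -> aG g *m y = y) ->
  avg N *m y = y.
Proof.
move=> h; rewrite /avg -scalemxAl mulmx_suml (eq_bigr (fun=> y)) => [|g gN]; last exact: h.
by rewrite sumr_const -scaler_nat scalerA mulVf ?scale1r// card_neq0.
Qed.

Lemma avg_mul_fix (N : {group D}) m (y : 'M[rat]_(m, #|G|)) : (forall g, g \in N -> y *m aG g = y) ->
  y *m avg N = y.
Proof.
move=> h; rewrite /avg -scalemxAr mulmx_sumr (eq_bigr (fun=> y)) => [|g gN]; last exact: h.
by rewrite sumr_const -scaler_nat scalerA mulVf ?scale1r// card_neq0.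
Qed.

Lemma avg_regl (N : {group D}) g : g \in N -> aG g *m avg N = avg N.
Proof.
move=> gN; rewrite /avg -scalemxAr mulmx_sumr; congr (_ *: _).
rewrite [RHS](reindex_inj (mulgI g)); apply: eq_big => [h|h _].
  by rewrite groupMl.
by rewrite regularM.
Qed.

Lemma avg_regr (N : {group D}) g : g \in N -> avg N *m aG g = avg N.
Proof.
move=> gN; rewrite /avg -scalemxAl mulmx_suml; congr (_ *: _).
rewrite [RHS](reindex_inj (mulIg g)); apply: eq_big => [h|h _].
  by rewrite groupMr.
by rewrite regularM.
Qed.

Lemma gen_fixl (A : {set D}) (y : M) g : (forall h, h \in A -> aG h *m y = y) ->
  g \in <<A>>%g -> aG g *m y = y.
Proof.
move=> hA; pose S := [set g | aG g *m y == y]%SET.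
have gS : group_set S.
  apply/group_setP; split; first by rewrite inE regular1 mul1mx.
  by move=> h k; rewrite !inE regularM -mulmxA => /eqP hh /eqP ->; rewrite hh.
suff : (<<A>> \subset Group gS)%g by move=> /fintype.subsetP h /h; rewrite inE => /eqP.
by rewrite gen_subG; apply/fintype.subsetP => h /hA e; rewrite inE e.
Qed.

Lemma gen_fixr (A : {set D}) (y : M) g : (forall h, h \in A -> y *m aG h = y) ->
  g \in <<A>>%g -> y *m aG g = y.
Proof.
move=> hA; pose S := [set g | y *m aG g == y]%SET.
have gS : group_set S.
  apply/group_setP; split; first by rewrite inE regular1 mulmx1.
  by move=> h k; rewrite !inE regularM mulmxA => /eqP -> /eqP ->.
suff : (<<A>> \subset Group gS)%g by move=> /fintype.subsetP h /h; rewrite inE => /eqP.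
by rewrite gen_subG; apply/fintype.subsetP => h /hA e; rewrite inE e.
Qed.

End GroupRing.

(** * Complexification of rational representations *)

Section RationalForms.
Variables (R : realType) (D : finGroupType).
Local Notation G := [set: D]%G.
Local Notation aG := (regular_repr rat G).
Local Notation RG := (group_ring rat G).
Local Notation toC := (ratr : {rmorphism rat -> R[i]}).

(** The action of a rational group ring element on a complex representation. *)
Definition cop d (V : mx_representation R[i] G d) (x : 'M[rat]_#|G|) : 'M[R[i]]_d :=
  \sum_g toC (gcoef x g) *: V g.

Lemma cop_dadd (U V : representation R[i] G) x :
  cop (dadd_grepr U V) x = block_mx (cop U x) 0 0 (cop V x).
Proof.
rewrite /cop; apply: (big_rec3 (fun a b c => a = block_mx b 0 0 c)) => [|g a b c _ ->].
  by rewrite block_mx0.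
by rewrite /= scale_block_mx add_block_mx !scaler0 !addr0.
Qed.

Lemma cop_big (I : eqType) (l : seq I) (V : I -> representation R[i] G) x :
  cop (\big[dadd_grepr/grepr0]_(i <- l) V i) x = 0 <->
  forall i, i \in l -> cop (V i) x = 0.
Proof.
elim: l => [|i l IH]; first by rewrite big_nil; split=> // _; apply/matrixP => -[].
rewrite big_cons cop_dadd; split.
  rewrite -[RHS](@block_mx0 _ (rdegree (V i)) _ (rdegree (V i))) => /eq_block_mx[Vi _ _ Vl].
  by move=> j; rewrite inE => /orP[/eqP->//|]; exact: (proj1 IH).
move=> h; rewrite (h i) ?inE ?eqxx// (proj2 IH) ?block_mx0// => j jl.
by rewrite h// inE jl orbT.
Qed.

Lemma cop_map n (W : mx_representation rat G n) x : (x \in RG)%MS ->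
  cop (map_repr toC W) x = map_mx toC (gring_op W x).
Proof.
move=> Rx; rewrite gring_op_sum// raddf_sum /cop; apply: eq_bigr => g _ /=.
by rewrite map_mxZ.
Qed.

Lemma cop_rsim n m (U : mx_representation R[i] G n) (V : mx_representation R[i] G m) x :
  mx_rsim U V -> cop U x = 0 <-> cop V x = 0.
Proof.
move=> [B eqn Bfree Bhom].
have e : cop U x *m B = B *m cop V x.
  rewrite /cop mulmx_suml mulmx_sumr; apply: eq_bigr => g _.
  by rewrite -scalemxAl -scalemxAr Bhom ?inE.
split=> h; rewrite h in e.
  have Bfull : row_full B by move: Bfree; rewrite /row_free /row_full => /eqP ->; apply/eqP.
  apply: (row_full_inj Bfull); by rewrite -e mul0mx mulmx0.
by apply: (row_free_inj Bfree); rewrite e mulmx0 mul0mx.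
Qed.

(** Annihilators are invariant under similarity and under the injective base change from the
    rationals, and the annihilator of a direct sum is the intersection of those of the summands. *)
Lemma rational_formP (r s : D) (w : R[i]) m k n (W : mx_representation rat G n) :
  is_rational_form r s w m k W ->
  exists2 V : nat -> mx_representation R[i] G 2,
    forall i, (1 <= i <= m)%N -> is_V r s w (k i) (V i)
  & forall x, (x \in RG)%MS -> gring_op W x = 0 <->
      forall i, (1 <= i <= m)%N -> cop (V i) x = 0.
Proof.
move=> [_ [V Vk WV]]; exists V => // x Rx.
have := cop_rsim x WV; rewrite cop_map// => e1.
have := @cop_big nat (index_iota 1 m.+1) (fun i => Representation (V i)) x => e2.
have e3 : map_mx toC (gring_op W x) = 0 <-> gring_op W x = 0.
  split=> [h|->]; last exact: map_mx0.
  by apply: (@map_mx_inj _ _ toC); rewrite h map_mx0.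
rewrite -e3 e1 e2; split=> h i.
  by move=> hi; apply: h; rewrite mem_index_iota ltnS.
by rewrite mem_index_iota ltnS => hi; exact: h.
Qed.

Section polynomials.
Variables r : D.

Definition gpoly (K : {poly rat}) : 'M[rat]_#|G| :=
  \sum_(j < size K) K`_j *: aG (r ^+ j)%g.

Lemma gpolyE n (K : {poly rat}) : (size K <= n)%N ->
  gpoly K = \sum_(j < n) K`_j *: aG (r ^+ j)%g.
Proof.
move=> Kn; rewrite /gpoly (big_ord_widen n (fun j => K`_j *: aG (r ^+ j)%g))//.
rewrite big_mkcond; apply: eq_bigr => j _; case: ltnP => // h.
by rewrite nth_default// scale0r.
Qed.

Lemma gpoly_linear (c : rat) K L : gpoly (c *: K + L) = c *: gpoly K + gpoly L.
Proof.
pose n := maxn (size (c *: K + L)) (maxn (size K) (size L)).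
rewrite !(@gpolyE n) ?leq_max ?leqnn ?orbT// scaler_sumr -big_split.
by apply: eq_bigr => j _ /=; rewrite coefD coefZ scalerDl scalerA.
Qed.
Lemma gpoly0 : gpoly 0 = 0. Proof. by rewrite /gpoly size_poly0 big_ord0. Qed.
Lemma gpolyD K L : gpoly (K + L) = gpoly K + gpoly L.
Proof. by have := gpoly_linear 1 K L; rewrite !scale1r. Qed.
Lemma gpolyZ (c : rat) K : gpoly (c *: K) = c *: gpoly K.
Proof. by have := gpoly_linear c K 0; rewrite gpoly0 !addr0. Qed.
Lemma gpolyN K : gpoly (- K) = - gpoly K.
Proof. by rewrite -scaleN1r gpolyZ scaleN1r. Qed.
Lemma gpolyB K L : gpoly (K - L) = gpoly K - gpoly L.
Proof. by rewrite gpolyD gpolyN. Qed.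
Lemma gpolyC (c : rat) : gpoly c%:P = c%:M.
Proof.
rewrite (@gpolyE 1) ?size_polyC_leq1// big_ord_recl big_ord0 addr0 coefC eqxx.
by rewrite expg0 regular1 scalemx1.
Qed.
Lemma gpoly1 : gpoly 1 = 1%:M. Proof. exact: gpolyC. Qed.
Lemma gpolyMX K : gpoly (K * 'X) = gpoly K *m aG r.
Proof.
have sz : (size (K * 'X)%R <= (size K).+1)%N.
  by have [->|K0] := eqVneq K 0; rewrite ?mul0r ?size_poly0// size_mulX.
rewrite (gpolyE sz) big_ord_recl coefMX eqxx scale0r add0r /gpoly mulmx_suml.
apply: eq_bigr => j _; rewrite coefMX /= -scalemxAl /bump leq0n add1n /=.
by rewrite expgSr regularM.
Qed.
Lemma gpolyM K L : gpoly (K * L) = gpoly K *m gpoly L.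
Proof.
elim/poly_ind: L => [|L c IH]; first by rewrite mulr0 gpoly0 mulmx0.
rewrite mulrDr mulrA !gpolyD !gpolyMX IH mulmxDr gpolyC mulmxA; congr (_ + _).
by rewrite mulrC mul_polyC gpolyZ mul_mx_scalar.
Qed.
End polynomials.

Lemma copD d (V : mx_representation R[i] G d) x y : cop V (x + y) = cop V x + cop V y.
Proof.
rewrite /cop -big_split; apply: eq_bigr => g _ /=.
by rewrite gcoefD rmorphD scalerDl.
Qed.
Lemma copZ d (V : mx_representation R[i] G d) c x : cop V (c *: x) = toC c *: cop V x.
Proof.
rewrite /cop scaler_sumr; apply: eq_bigr => g _ /=.
by rewrite gcoefZ rmorphM scalerA.
Qed.
Lemma cop_reg d (V : mx_representation R[i] G d) g : cop V (aG g) = V g.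
Proof.
rewrite /cop (bigD1 g)//= gcoef_reg eqxx rmorph1 scale1r big1 ?addr0// => h hg.
by rewrite gcoef_reg (negPf hg) rmorph0 scale0r.
Qed.
Lemma cop0 d (V : mx_representation R[i] G d) : cop V 0 = 0.
Proof. by rewrite /cop big1// => h _; rewrite gcoef0 rmorph0 scale0r. Qed.
Lemma cop_sum d (V : mx_representation R[i] G d) (I : Type) (l : seq I) F :
  cop V (\sum_(i <- l) F i) = \sum_(i <- l) cop V (F i).
Proof. exact: (big_morph (cop V) (copD V) (cop0 V)). Qed.
Lemma copMreg d (V : mx_representation R[i] G d) x g : (x \in RG)%MS ->
  cop V (x *m aG g) = cop V x *m V g.
Proof.
move=> /ring_sumE ->; rewrite mulmx_suml !cop_sum mulmx_suml; apply: eq_bigr => h _.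
by rewrite -!scalemxAl !copZ -regularM !cop_reg repr_mxM ?inE// scalemxAl.
Qed.

Lemma ring_gpoly r K : (gpoly r K \in RG)%MS.
Proof. by apply: ring_sum => j _; rewrite ringZ// ring_reg. Qed.

Lemma cop_gpoly (r s : D) (w : R[i]) k (V : mx_representation R[i] G 2) K :
  is_V r s w k V ->
  cop V (gpoly r K) = diag_mx (\row_j (map_poly toC K).[if j == 0 then w ^+ k else w ^- k]).
Proof.
move=> [Vr _]; elim/poly_ind: K => [|K c IH].
  rewrite gpoly0 rmorph0 cop0.
  by apply/matrixP => i j; rewrite !mxE horner0 mul0rn.
rewrite gpolyD gpolyMX gpolyC copD (copMreg _ _ (ring_gpoly r K)) IH Vr.
rewrite -scalemx1 -(regular1 D) copZ cop_reg repr_mx1.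
apply/matrixP => i j; rewrite mul_diag_mx !mxE rmorphD rmorphM /= map_polyX map_polyC /=.
rewrite !hornerE eq_sym; have [->|] := eqVneq i j; last by rewrite !mulr0 addr0.
by rewrite /= !mulr1n mulr1.
Qed.
End RationalForms.

(** * The group ring of the dihedral group *)
Section Dihedral.
Variables (D : finGroupType) (p : nat) (r s : D).
Hypotheses (p_prime : prime p) (p_gt3 : (3 < p)%N).
Hypothesis D_dihedral : dihedral_presentation (2 * p) r s.
Local Notation G := [set: D]%G.
Local Notation aG := (regular_repr rat G).
Local Notation RG := (group_ring rat G).
Local Notation M := 'M[rat]_#|G|.
Implicit Types (x y z : M) (g h : D).

Lemma dihedral_rot : (r ^+ (2 * p) = 1)%g. Proof. by have [_ _ ->] := D_dihedral. Qed.
Lemma dihedral_sq : (s * s = 1)%g. Proof. by have [_ _ _ + _] := D_dihedral; rewrite expgS expg1. Qed.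
Lemma dihedral_swap j : (s * r ^+ j = r ^- j * s)%g.
Proof.
have sr : (s * r = r^-1 * s)%g.
  have [_ _ _ _ ] := D_dihedral; rewrite expgS expg1 => e.
  apply: (mulgI r); apply: (mulIg s).
  by rewrite mulKVg dihedral_sq -e !mulgA.
elim: j => [|j IH]; first by rewrite expg0 invg1 mulg1 mul1g.
by rewrite expgSr mulgA IH -mulgA sr mulgA -invMg -expgS -expgSr.
Qed.
Lemma dihedral_rotV j : (r ^- j = r ^+ ((2 * p).-1 * j))%g.
Proof.
apply: (mulgI (r ^+ j)%g); rewrite mulgV -expgD.
have -> : (j + (2 * p).-1 * j = 2 * p * j)%N.
  by rewrite -mulSn prednK// muln_gt0 /= (prime_gt0 p_prime).
by rewrite expgM dihedral_rot expg1n.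
Qed.
Lemma dihedral_elt g : exists j b, (g = r ^+ j * s ^+ b)%g.
Proof.
pose S := [set g | `[< exists j b, (g = r ^+ j * s ^+ b)%g >]]%SET.
have inS k : reflect (exists j b, (k = r ^+ j * s ^+ b)%g) (k \in S).
  by rewrite finset.in_set; exact: asboolP.
have gS : group_set S.
  apply/group_setP; split; first by apply/inS; exists 0%N, 0%N; rewrite !expg0 mulg1.
  move=> g1 g2 /inS[i [b ->]] /inS[j [c ->]]; apply/inS.
  elim: b => [|b [k [d IH]]].
    by exists (i + j)%N, c; rewrite expg0 mulg1 mulgA expgD.
  have [k' k'E] : exists k', (s ^+ b.+1 * r ^+ j = r ^+ k' * s ^+ b.+1)%g.
    elim: b.+1 => [|n [k' h]]; first by exists j; rewrite !expg0 mul1g mulg1.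
    exists ((2 * p).-1 * k')%N.
    by rewrite !expgS -mulgA h mulgA dihedral_swap dihedral_rotV -mulgA.
  exists (i + k')%N, (b.+1 + c)%N.
  by rewrite -mulgA [(s ^+ _ * (_ * _))%g]mulgA k'E !mulgA -expgD -mulgA -expgD.
have : (<<[set r; s]%SET>> \subset Group gS)%g.
  rewrite gen_subG; apply/fintype.subsetP => h; rewrite finset.in_set2 => /orP[] /eqP->; apply/inS.
    by exists 1%N, 0%N; rewrite expg0 expg1 mulg1.
  by exists 0%N, 1%N; rewrite expg0 expg1 mul1g.
have [-> _ _ _ _] := D_dihedral.
by move=> /fintype.subsetP/(_ g); rewrite finset.in_setT => /(_ isT)/inS.
Qed.

Local Notation A := (aG r).
Local Notation B := (aG s).
Local Notation C := (aG (r ^+ p)%g).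
Local Notation rotations2 := <<[set (r ^+ 2)%g]%SET>>%G.

Lemma generated_comm x : x *m A = A *m x -> x *m B = B *m x ->
  forall y, (y \in RG)%MS -> x *m y = y *m x.
Proof.
move=> xA xB y /ring_sumE ->; rewrite mulmx_sumr mulmx_suml; apply: eq_bigr => g _.
rewrite -scalemxAr -scalemxAl; congr (_ *: _).
have pw h j : x *m aG h = aG h *m x -> x *m aG (h ^+ j)%g = aG (h ^+ j)%g *m x.
  move=> e; elim: j => [|j IH]; first by rewrite expg0 regular1 mulmx1 mul1mx.
  by rewrite expgSr regularM mulmxA IH -!mulmxA e.
have [j [b ->]] := dihedral_elt g.
by rewrite regularM mulmxA pw// -!mulmxA; congr (_ *m _); exact: pw.
Qed.

Lemma C_comm y : (y \in RG)%MS -> C *m y = y *m C.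
Proof.
apply: generated_comm; rewrite -!regularM.
  by rewrite -expgSr -expgS.
have rV : (r ^- p = r ^+ p)%g.
  by apply: (mulgI (r ^+ p)%g); rewrite mulgV -expgD addnn -mul2n dihedral_rot.
by rewrite dihedral_swap rV.
Qed.

Definition rot2 : M := avg rotations2.
Local Notation n := rot2.

Lemma rot2_mem : (r ^+ 2)%g \in rotations2.
Proof. by apply: mem_gen; rewrite inE. Qed.
Lemma rot2_even j : (r ^+ (2 * j))%g \in rotations2.
Proof. by rewrite expgM groupX// rot2_mem. Qed.
Lemma ring_rot2 : (n \in RG)%MS. Proof. exact: ring_avg. Qed.
Lemma rot2_fixl (y : M) : aG (r ^+ 2)%g *m y = y -> n *m y = y.
Proof.
move=> h; apply: avg_fix_mul => g; apply: gen_fixl => k.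
by rewrite inE => /eqP ->.
Qed.
Lemma rot2_fixr (y : M) : y *m aG (r ^+ 2)%g = y -> y *m n = y.
Proof.
move=> h; apply: avg_mul_fix => g; apply: gen_fixr => k.
by rewrite inE => /eqP ->.
Qed.
Lemma rot2K : n *m n = n. Proof. by apply: rot2_fixl; apply: avg_regl; exact: rot2_mem. Qed.
Lemma rot2_comm y : (y \in RG)%MS -> n *m y = y *m n.
Proof.
have key h g : g \in rotations2 -> ((r ^+ 2 * h = h * g)%g) -> n *m (aG h *m n) = aG h *m n.
  move=> gr e; apply: rot2_fixl; rewrite mulmxA -regularM e regularM -mulmxA.
  by rewrite avg_regl.
have key' h g : g \in rotations2 -> ((h * r ^+ 2 = g * h)%g) -> (n *m aG h) *m n = n *m aG h.
  move=> gr e; apply: rot2_fixr; rewrite -mulmxA -regularM e regularM mulmxA.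
  by rewrite avg_regr.
apply: generated_comm.
  rewrite -(key r (r ^+ 2)%g) ?rot2_mem -?expgS -?expgSr//.
  by rewrite mulmxA (key' r (r ^+ 2)%g) ?rot2_mem -?expgS -?expgSr.
rewrite -(key s (r ^- 2)%g) ?groupV ?rot2_mem//.
  by rewrite mulmxA (key' s (r ^- 2)%g) ?groupV ?rot2_mem// dihedral_swap.
apply: (mulIg (r ^+ 2)%g); by rewrite -mulgA dihedral_swap mulKVg mulgKV.
Qed.

Lemma odd_p : odd p.
Proof. by have [e|] := even_prime p_prime; first by move: p_gt3; rewrite e. Qed.

(** [p] is odd, so [r ^+ p] and [r] differ by a power of [r ^+ 2], which [n] absorbs. *)
Lemma rot2_C : C *m n = A *m n.
Proof.
have -> : p = (1 + 2 * p./2)%N by rewrite -{1}(odd_double_half p) odd_p -mul2n.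
by rewrite expgD expg1 regularM -mulmxA avg_regl// rot2_even.
Qed.

(* An idempotent when [g] is an involution and [c] is 1 or -1. *)
Definition sign_half g (c : rat) : M := 2^-1 *: (1%:M + c *: aG g).
Local Notation h := (sign_half (r ^+ p)%g).
Local Notation t := (sign_half s).

Lemma ring_half g c : (sign_half g c \in RG)%MS.
Proof. by rewrite ringZ// ringD ?ring1// ringZ// ring_reg. Qed.

Section half.
Variables (g : D) (c : rat).
Hypotheses (gg : (g * g = 1)%g) (cc : c * c = 1).

Lemma sign_half_regl : aG g *m sign_half g c = c *: sign_half g c.
Proof.
rewrite /sign_half -scalemxAr mulmxDr mulmx1 -scalemxAr -regularM gg regular1.
rewrite [RHS]scalerA [c * _]mulrC -[RHS]scalerA; congr (_ *: _).
by rewrite scalerDr scalerA cc scale1r addrC.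
Qed.
Lemma sign_half_fixl m (y : 'M[rat]_(#|G|, m)) : aG g *m y = c *: y -> sign_half g c *m y = y.
Proof.
move=> e; rewrite /sign_half -scalemxAl mulmxDl mul1mx -scalemxAl e scalerA cc scale1r.
by rewrite -mulr2n -scaler_nat scalerA mulVf ?scale1r.
Qed.
Lemma sign_half_fixr m (y : 'M[rat]_(m, #|G|)) : y *m aG g = c *: y -> y *m sign_half g c = y.
Proof.
move=> e; rewrite /sign_half -scalemxAr mulmxDr mulmx1 -scalemxAr e scalerA cc scale1r.
by rewrite -mulr2n -scaler_nat scalerA mulVf ?scale1r.
Qed.
Lemma sign_halfK : sign_half g c *m sign_half g c = sign_half g c.
Proof. exact: sign_half_fixl sign_half_regl. Qed.
Lemma sign_halfD : sign_half g c + sign_half g (- c) = 1%:M.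
Proof.
rewrite /sign_half -scalerDr addrACA -scalerDl subrr scale0r addr0 -mulr2n -scaler_nat.
by rewrite scalerA mulVf ?scale1r.
Qed.
End half.

End Dihedral.

(** * Averages over subgroups as products of commuting idempotents *)

Section DihedralAverages.
Variables (D : finGroupType) (p : nat) (r s : D).
Hypotheses (p_prime : prime p) (p_gt3 : (3 < p)%N).
Hypothesis D_dihedral : dihedral_presentation (2 * p) r s.
Local Notation G := [set: D]%G.
Local Notation aG := (regular_repr rat G).
Local Notation RG := (group_ring rat G).
Local Notation M := 'M[rat]_#|G|.
Local Notation A := (aG r).
Local Notation B := (aG s).
Local Notation C := (aG (r ^+ p)%g).
Local Notation n := (rot2 r).
Local Notation h := (sign_half (r ^+ p)%g).
Local Notation t := (sign_half s).

Lemma sign_half_comm g c y : (aG g *m y = y *m aG g) -> sign_half g c *m y = y *m sign_half g c.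
Proof.
move=> e; rewrite /sign_half -scalemxAl -scalemxAr mulmxDl mulmxDr mul1mx mulmx1.
by rewrite -scalemxAl -scalemxAr e.
Qed.
Lemma halfC_comm c y : (y \in RG)%MS -> h c *m y = y *m h c.
Proof. by move=> Ry; apply: sign_half_comm; exact: (C_comm p_prime D_dihedral). Qed.
Lemma n_comm y : (y \in RG)%MS -> n *m y = y *m n.
Proof. exact: (rot2_comm p_prime D_dihedral). Qed.

Lemma CC1 : (r ^+ p * r ^+ p = 1)%g.
Proof. by rewrite -expgD addnn -mul2n (dihedral_rot D_dihedral). Qed.
Lemma ss1 : (s * s = 1)%g. Proof. exact: dihedral_sq D_dihedral. Qed.

Lemma A_nh c : c * c = 1 -> A *m (n *m h c) = c *: (n *m h c).
Proof.
move=> cc; rewrite mulmxA -(rot2_C r p_prime p_gt3) -mulmxA.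
by rewrite mulmxA (C_comm p_prime D_dihedral) ?ring_rot2// -mulmxA sign_half_regl ?CC1// scalemxAr.
Qed.

(** The product [avg N *m y] equals [y] when the generators fix [y], and equals [avg N] when [avg N]
    absorbs the factors of [y]. The elements of [N] need not be listed. *)
Lemma avg_eq (N : {group D}) (S : {set D}) y : N \subset <<S>>%g ->
  (forall k, k \in S -> aG k *m y = y) -> avg N *m y = avg N -> avg N = y.
Proof.
move=> NS hS <-; apply: avg_fix_mul => g gN.
by apply: gen_fixl hS _; exact: (fintype.subsetP NS).
Qed.

Lemma avg_half (N : {group D}) g : (g * g = 1)%g -> g \in N ->
  avg N *m sign_half g 1 = avg N.
Proof. by move=> gg gN; rewrite sign_half_fixr ?mul1r// scale1r avg_regr. Qed.
Lemma avg_n (N : {group D}) : (r ^+ 2)%g \in N -> avg N *m n = avg N.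
Proof. by move=> gN; rewrite rot2_fixr// avg_regr. Qed.

Lemma sign_half_reg1 g : (g * g = 1)%g -> aG g *m sign_half g 1 = sign_half g 1.
Proof. by move=> gg; rewrite sign_half_regl ?mul1r// scale1r. Qed.

Lemma avg_rot : avg <<[set r]%SET>>%G = n *m h 1.
Proof.
have rN : r \in <<[set r]%SET>>%G by rewrite mem_gen// finset.in_set1.
apply: (@avg_eq _ [set r]%SET) => // [k|].
  by rewrite finset.in_set1 => /eqP ->; rewrite A_nh ?mul1r// scale1r.
by rewrite mulmxA avg_n ?groupX// avg_half ?groupX// CC1.
Qed.

Lemma B_comm (x y : M) : (x \in RG)%MS -> (forall z, (z \in RG)%MS -> x *m z = z *m x) ->
  B *m (x *m y) = x *m (B *m y).
Proof. by move=> Rx hx; rewrite mulmxA -hx ?ring_reg// mulmxA. Qed.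

Lemma ring_nh c : (n *m h c \in RG)%MS.
Proof. by rewrite ringM ?ring_half ?ring_rot2. Qed.
Lemma nh_comm c y : (y \in RG)%MS -> (n *m h c) *m y = y *m (n *m h c).
Proof. by move=> Ry; rewrite -mulmxA halfC_comm// mulmxA n_comm// -mulmxA. Qed.

Lemma avg_all : avg G = n *m h 1 *m t 1.
Proof.
apply: (@avg_eq _ [set r; s]%SET).
- by have [-> _ _ _ _] := D_dihedral.
- move=> k; rewrite finset.in_set2 => /orP[] /eqP->.
    by rewrite mulmxA A_nh ?mul1r// scale1r.
  by rewrite B_comm ?ring_nh// ?sign_half_reg1 ?ss1//; exact: nh_comm.
- by rewrite !mulmxA avg_n ?inE// avg_half ?CC1 ?inE// avg_half ?ss1 ?inE.
Qed.

Lemma n_reg2 : aG (r ^+ 2)%g *m n = n.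
Proof. by rewrite avg_regl// rot2_mem. Qed.

Lemma avg_rot2 g : (g * g = 1)%g ->
  avg <<[set g; (r ^+ 2)%g]%SET>>%G = n *m sign_half g 1.
Proof.
move=> gg; apply: (@avg_eq _ [set g; (r ^+ 2)%g]%SET) => // [k|].
  rewrite finset.in_set2 => /orP[] /eqP->.
    by rewrite mulmxA -n_comm ?ring_reg// -mulmxA sign_half_reg1.
  by rewrite mulmxA n_reg2.
rewrite mulmxA avg_n ?avg_half//; last by rewrite mem_gen// finset.in_set2 eqxx orbT.
by rewrite mem_gen// finset.in_set2 eqxx.
Qed.

Lemma avg_refl : avg <<[set s]%SET>>%G = t 1.
Proof.
apply: (@avg_eq _ [set s]%SET) => // [k|].
  by rewrite finset.in_set1 => /eqP ->; rewrite sign_half_reg1// ss1.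
by rewrite avg_half ?ss1// mem_gen// finset.in_set1.
Qed.

Lemma avg_klein : avg <<[set 1%g; s; (r ^+ p)%g; (r ^+ p * s)%g]%SET>>%G = h 1 *m t 1.
Proof.
have Cfix : C *m (h 1 *m t 1) = h 1 *m t 1 by rewrite mulmxA sign_half_reg1// CC1.
have Bfix : B *m (h 1 *m t 1) = h 1 *m t 1.
  by rewrite B_comm ?ring_half// ?sign_half_reg1 ?ss1//; exact: halfC_comm.
apply: (@avg_eq _ [set 1%g; s; (r ^+ p)%g; (r ^+ p * s)%g]%SET) => // [k|].
  rewrite !finset.in_setU !finset.in_set1 => /orP[/orP[/orP[]|]|] /eqP-> //.
    by rewrite regular1 mul1mx.
  by rewrite regularM -mulmxA Bfix.
rewrite mulmxA avg_half ?CC1 ?avg_half ?ss1// mem_gen//.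
  by rewrite !finset.in_setU !finset.in_set1 eqxx !orbT.
by rewrite !finset.in_setU !finset.in_set1 eqxx !orbT.
Qed.

Lemma reflection_sq : (r ^+ p * s * (r ^+ p * s) = 1)%g.
Proof.
rewrite -mulgA [(s * _)%g]mulgA (dihedral_swap D_dihedral) -mulgA ss1 mulg1.
by rewrite mulgV.
Qed.

(** For commuting involutions, [g * k] acts by 1 exactly where [g] and [k] act by the same sign; the
    identity itself is a formal expansion. *)
Lemma sign_half_mul (g k : D) :
  sign_half (g * k)%g 1 = sign_half g 1 *m sign_half k 1 + sign_half g (-1) *m sign_half k (-1).
Proof.
rewrite /sign_half -!scalemxAl -!scalemxAr !mulmxDl !mulmxDr !mul1mx !mulmx1.
rewrite !scaleN1r !scale1r mulNmx mulmxN opprK -regularM.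
by apply/matrixP => i j; rewrite !mxE; field.
Qed.

(** As [r] and [s] act on the factor of [W] by the signs [c] and [d], the idempotent [e] absorbs
    [n], [h c] and [t d]. Their product is a common eigenvector of the group, so
    [eigen_idempotent_eq] applies. *)
Lemma linear_idempotent (W : mx_representation rat G 1) (c d : rat) e :
  c * c = 1 -> d * d = 1 -> W r = c%:M -> W s = d%:M ->
  primitive_idempotent W e -> e = n *m h c *m t d.
Proof.
move=> cc dd Wr Ws [Qe ee e0 _].
have [_ eA] := simple_factor_scalar Qe Wr; have [_ eB] := simple_factor_scalar Qe Ws.
have Re : (e \in RG)%MS by case: Qe.
have eAX j : e *m aG (r ^+ j)%g = c ^+ j *: e.
  elim: j => [|j IH]; first by rewrite expg0 regular1 mulmx1 expr0 scale1r.
  by rewrite expgSr regularM mulmxA IH -scalemxAl eA scalerA exprSr.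
have cp : c ^+ p = c.
  by rewrite -(odd_double_half p) (odd_p p_prime p_gt3) -mul2n exprS exprM expr2 cc expr1n mulr1.
have en : e *m n = e by rewrite rot2_fixr// eAX expr2 cc scale1r.
have eh : e *m h c = e by rewrite sign_half_fixr// eAX cp.
have et : e *m t d = e by rewrite sign_half_fixr.
have zr : A *m (n *m h c *m t d) = c *: (n *m h c *m t d).
  by rewrite mulmxA A_nh// -scalemxAl.
have zs : B *m (n *m h c *m t d) = d *: (n *m h c *m t d).
  by rewrite B_comm ?ring_nh//; [rewrite sign_half_regl ?ss1// -scalemxAr|exact: nh_comm].
have zg g : exists b, aG g *m (n *m h c *m t d) = b *: (n *m h c *m t d).
  have [j [b ->]] := dihedral_elt p_prime D_dihedral g; exists (c ^+ j * d ^+ b).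
  have pw k u i : aG k *m (n *m h c *m t d) = u *: (n *m h c *m t d) ->
      aG (k ^+ i)%g *m (n *m h c *m t d) = u ^+ i *: (n *m h c *m t d).
    move=> ke; elim: i => [|i IH]; first by rewrite expg0 regular1 mul1mx scale1r.
    by rewrite expgS regularM -[LHS]mulmxA IH -scalemxAr ke scalerA exprSr.
  rewrite regularM -[LHS]mulmxA (pw _ _ _ zs) -scalemxAr (pw _ _ _ zr) scalerA.
  by rewrite mulrC.
have [chi chiE] := choice zg.
by apply: (eigen_idempotent_eq Re ee e0 _ chiE); rewrite !mulmxA en eh.
Qed.

End DihedralAverages.

(** * Equivalent idempotents and inverses in the group ring *)

Section ConjugateIdempotents.
Variable D : finGroupType.
Local Notation RG := (group_ring rat [set: D]%G).

Definition conj_idem (e f : 'M[rat]_#|[set: D]%G|) : Prop :=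
  exists x y, [/\ (x \in RG)%MS, (y \in RG)%MS, x *m y = f & y *m x = e].

Lemma conj_idem_sym e f : conj_idem e f -> conj_idem f e.
Proof. by move=> [x [y [? ? ? ?]]]; exists y, x. Qed.

End ConjugateIdempotents.

(** In the Cayley-Hamilton identity the constant term is the determinant up to sign; dividing by it
    expresses the inverse as a polynomial in [U]. *)
Lemma unitmx_inverse_poly (F : fieldType) n (U : 'M[F]_n.+1) : U \in unitmx ->
  exists q : {poly F}, U *m horner_mx U q = 1%:M.
Proof.
move=> Uu; have d0 : \det U != 0 by rewrite -unitfE -unitmxE.
have := Cayley_Hamilton U; set P := char_poly U.
have P0 : P`_0 = (-1) ^+ n.+1 * \det U by rewrite char_poly_det.
have P0n : P`_0 != 0 by rewrite P0 mulf_neq0// signr_eq0.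
rewrite -(poly_take_drop 1 P) expr1.
have -> : take_poly 1 P = (P`_0)%:P.
  apply/polyP => i; rewrite coef_take_poly coefC.
  by case: i => [|i].
rewrite [drop_poly _ _ * _]mulrC rmorphD rmorphM /= horner_mx_X horner_mx_C => e.
exists (- (P`_0)^-1 *: drop_poly 1 P).
rewrite linearZ /= -scalemxAr.
have -> : U *m horner_mx U (drop_poly 1 P) = - (P`_0)%:M.
  by apply/eqP; rewrite -addr_eq0 addrC -e.
by rewrite scaleNr scalerN opprK scale_scalar_mx mulVf.
Qed.

(** Writing the inverse as a polynomial in [K] keeps it among the polynomials in [r] and lets it
    inherit what commutes with [K]. *)
Lemma gring_op_inverse_poly (D : finGroupType) (r : D) d
    (W : mx_representation rat [set: D]%G d) K :
  gring_op W (gpoly r K) \in unitmx ->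
  exists q : {poly rat}, gring_op W (gpoly r (1 - K * (q \Po K))) = 0.
Proof.
case: d W => [|d] W Ku; first by exists 0; apply/matrixP => -[].
have [q hq] := unitmx_inverse_poly Ku; exists q.
have e (q' : {poly rat}) : gring_op W (gpoly r (q' \Po K)) = horner_mx (gring_op W (gpoly r K)) q'.
  elim/poly_ind: q' => [|q' c IH]; first by rewrite comp_poly0 gpoly0 !linear0.
  rewrite comp_poly_MXaddC gpolyD gpolyM gpolyC linearD /= gring_opMr ?ring_gpoly// IH.
  rewrite rmorphD rmorphM /= horner_mx_X horner_mx_C; congr (_ + _).
  by rewrite -scalemx1 linearZ /= gring_op1 scalemx1.
by rewrite gpolyB gpoly1 gpolyM linearB /= gring_op1 gring_opMr ?ring_gpoly// e hq subrr.
Qed.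

(* The vectors killed by all the [W g *m y] form a submodule. *)
Lemma irr_mul_neq0 (D : finGroupType) d (W : mx_representation rat [set: D]%G d)
    (x y : 'M[rat]_d) : mx_irreducible W -> x != 0 -> y != 0 ->
  exists g, x *m W g *m y != 0.
Proof.
move=> irrW x0 y0; apply: contrapT => /forallNP h.
have {}h g : x *m W g *m y = 0 by apply/eqP/negPn/negP/h.
have [_ hW] := (proj1 (mx_irrP W)) irrW.
pose N := (\bigcap_(g : D) kermx (W g *m y))%MS.
have NW g : N *m W g *m y = 0.
  by apply/eqP; rewrite -mulmxA -sub_kermx; apply: (sub_bigcapmxP (submx_refl N)).
have xN : (x <= N)%MS.
  by apply/sub_bigcapmxP => g _; rewrite sub_kermx mulmxA h.
have Nfull : row_full N.
  apply: hW; last by apply: contraNneq x0 => N0; rewrite N0 submx0 in xN.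
  apply/mxmoduleP => k _; apply/sub_bigcapmxP => g _; rewrite sub_kermx.
  by rewrite -mulmxA [W k *m _]mulmxA -repr_mxM ?inE// mulmxA NW.
move/eqP: y0; apply; apply: (row_full_inj Nfull).
by have := NW 1%g; rewrite repr_mx1 mulmx1 mulmx0.
Qed.

(** * The simple factor of a rational form of two-dimensional representations *)

Section RationalComponent.
Variables (R : realType) (D : finGroupType) (p : nat) (r s : D).
Hypotheses (p_prime : prime p) (p_gt3 : (3 < p)%N).
Hypothesis D_dihedral : dihedral_presentation (2 * p) r s.
Local Notation G := [set: D]%G.
Local Notation aG := (regular_repr rat G).
Local Notation RG := (group_ring rat G).
Local Notation M := 'M[rat]_#|G|.
Local Notation toC := (ratr : {rmorphism rat -> R[i]}).
Local Notation A := (aG r).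
Local Notation B := (aG s).
Local Notation C := (aG (r ^+ p)%g).
Local Notation n := (rot2 r).
Local Notation h := (sign_half (r ^+ p)%g).
Local Notation t := (sign_half s).
Implicit Types K : {poly rat}.

(* [roots] lists the eigenvalues of [r] on the complexification of [W]. *)
Variables (sg : rat) (roots : seq R[i]) (d : nat) (W : mx_representation rat G d).
Hypotheses (sgK : sg * sg = 1) (roots_uniq : uniq roots) (roots_size : size roots = p.-1).
Hypothesis roots_pow : forall z, z \in roots -> z ^+ p = toC sg.
Hypothesis roots_sq : forall z, z \in roots -> z ^+ 2 != 1.
Hypothesis W_irr : mx_irreducible W.
Hypothesis W_gpoly : forall K, gring_op W (gpoly r K) = 0 <->
  forall z, z \in roots -> root (map_poly toC K) z.

Let p_gt0 : (0 < p)%N. Proof. exact: prime_gt0. Qed.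
Let sg0 : sg != 0.
Proof. by apply/eqP => e; move/eqP: sgK; rewrite e mulr0 eq_sym oner_eq0. Qed.
Let sgp : sg ^+ p = sg.
Proof.
by rewrite -(odd_double_half p) (odd_p p_prime p_gt3) -mul2n exprS exprM expr2 sgK expr1n mulr1.
Qed.

(** The cyclotomic polynomial of order [p] at [sg X]: of order [p] for [sg = 1] and of order [2 p]
    for [sg = -1]. *)
Definition cyclo : {poly rat} := \poly_(j < p) sg ^+ j.

Lemma cycloE : cyclo = \sum_(j < p) (sg *: 'X) ^+ j.
Proof. by rewrite /cyclo poly_def; apply: eq_bigr => j _; rewrite exprZn. Qed.
Lemma cyclo_geom : (1 - sg *: 'X) * cyclo = 1 - sg *: 'X^p.
Proof. have -> : sg *: 'X^p = (sg *: 'X) ^+ p :> {poly rat} by rewrite exprZn sgp.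
by rewrite cycloE -[1 - sg *: 'X]opprB mulNr -subrX1 opprB. Qed.
Lemma size_cyclo : size cyclo = p.
Proof. by rewrite size_poly_eq// expf_neq0. Qed.

Lemma cyclo_root z : z \in roots -> root (map_poly toC cyclo) z.
Proof.
move=> zr; have := congr1 (fun q => (map_poly toC q).[z]) cyclo_geom.
rewrite !rmorphM !rmorphB /= !linearZ /= !rmorph1 map_polyXn map_polyX !hornerE.
rewrite (roots_pow zr) !mulrN -rmorphM sgK rmorph1 subrr => /eqP.
rewrite mulf_eq0 => /orP[|//]; rewrite subr_eq0 => /eqP e.
have := roots_sq zr; rewrite -[z]mul1r -(rmorph1 toC) -sgK rmorphM -mulrA -e mulr1.
by rewrite expr2 -rmorphM sgK rmorph1 eqxx.
Qed.

(** The [p.-1] distinct eigenvalues exhaust the roots of [cyclo], so it splits over [R[i]] into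
    factors dividing [K]; divisibility of rational polynomials can be checked after the
    extension. *)
Lemma cyclo_dvd K : gring_op W (gpoly r K) = 0 -> cyclo %| K.
Proof.
move=> /W_gpoly hK; rewrite -(dvdp_map toC).
have ur : uniq_roots roots by rewrite uniq_rootsE.
rewrite (@all_roots_prod_XsubC _ (map_poly toC cyclo) roots)//.
- rewrite dvdpZl ?lead_coef_eq0 ?map_poly_eq0 -?size_poly_gt0 ?size_cyclo//.
  by apply: uniq_roots_dvdp ur; apply/allP.
- by rewrite size_map_poly size_cyclo roots_size prednK.
- by apply/allP; exact: cyclo_root.
Qed.

Lemma gpolyXn j : gpoly r 'X^j = aG (r ^+ j)%g.
Proof.
elim: j => [|j IH]; first by rewrite expr0 gpoly1 expg0 regular1.
by rewrite exprSr gpolyMX IH expgSr regularM.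
Qed.

Lemma gpoly_sum (I : Type) (l : seq I) (F : I -> {poly rat}) :
  gpoly r (\sum_(i <- l) F i) = \sum_(i <- l) gpoly r (F i).
Proof. exact: (big_morph (gpoly r) (gpolyD r) (gpoly0 r)). Qed.

Definition rot2_poly : {poly rat} := p%:R^-1 *: \sum_(j < p) 'X^2 ^+ j.

Lemma rot2_gpoly : n = gpoly r rot2_poly.
Proof.
have p0 : (p%:R : rat) != 0 by rewrite pnatr_eq0 -lt0n.
apply: (@avg_eq _ _ [set (r ^+ 2)%g]%SET) => // [k|].
  rewrite finset.in_set1 => /eqP ->; apply/eqP; rewrite -subr_eq0.
  rewrite -{2}[gpoly r _]mul1mx -mulmxBl -gpolyXn -(gpoly1 r) -gpolyB -gpolyM.
  rewrite /rot2_poly -scalerAr -subrX1 -exprM gpolyZ gpolyB gpolyXn gpoly1.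
  by rewrite (dihedral_rot D_dihedral) regular1 subrr scaler0.
rewrite /rot2_poly gpolyZ gpoly_sum -scalemxAr mulmx_sumr (eq_bigr (fun=> n)) => [|j _].
  by rewrite sumr_const card_ord -scaler_nat scalerA mulVf// scale1r.
by rewrite -exprM gpolyXn avg_regr// rot2_even.
Qed.

(** The central idempotent of the simple factor of [W]: [sg = -1] for [W5] and [sg = 1] for [W6].
    Locking keeps it opaque in rewriting. *)
Definition comp_idem : M := locked ((1%:M - n) *m h sg).
Lemma comp_idemE : comp_idem = (1%:M - n) *m h sg.
Proof. by rewrite /comp_idem -lock. Qed.
Local Notation eps := comp_idem.
Definition comp_poly : {poly rat} := (1 - rot2_poly) * (2^-1 *: (1 + sg *: 'X^p)).

Lemma comp_gpoly : gpoly r comp_poly = eps.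
Proof.
by rewrite comp_idemE gpolyM gpolyB gpoly1 -rot2_gpoly gpolyZ gpolyD gpolyZ gpoly1 gpolyXn.
Qed.

Lemma ring_comp : (eps \in RG)%MS. Proof. by rewrite -comp_gpoly ring_gpoly. Qed.
Lemma comp_comm y : (y \in RG)%MS -> eps *m y = y *m eps.
Proof.
move=> Ry; rewrite comp_idemE -mulmxA (halfC_comm p_prime D_dihedral)// !mulmxA; congr (_ *m _).
by rewrite mulmxBl mulmxBr mul1mx mulmx1 (n_comm p_prime D_dihedral).
Qed.
Lemma comp_idemK : eps *m eps = eps.
Proof.
rewrite {1}comp_idemE -mulmxA -(comp_comm (ring_half _ _)) comp_idemE -mulmxA.
rewrite sign_halfK ?(CC1 D_dihedral)// mulmxA mulmxBl mul1mx mulmxBr mulmx1 rot2K.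
by rewrite subrr subr0.
Qed.

Definition ev (z : R[i]) K : R[i] := (map_poly toC K).[z].
Lemma evD z K L : ev z (K + L) = ev z K + ev z L.
Proof. by rewrite /ev rmorphD hornerD. Qed.
Lemma evN z K : ev z (- K) = - ev z K.
Proof. by rewrite /ev rmorphN hornerN. Qed.
Lemma evM z K L : ev z (K * L) = ev z K * ev z L.
Proof. by rewrite /ev rmorphM hornerM. Qed.
Lemma evZ z c K : ev z (c *: K) = toC c * ev z K.
Proof. by rewrite /ev (map_polyZ toC) hornerZ. Qed.
Lemma ev1 z : ev z 1 = 1.
Proof. by rewrite /ev rmorph1 hornerC. Qed.
Lemma evXn z j : ev z 'X^j = z ^+ j.
Proof. by rewrite /ev map_polyXn hornerXn. Qed.

Lemma op_comp : gring_op W (1%:M - eps) = 0.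
Proof.
rewrite -comp_gpoly -(gpoly1 r) -gpolyB; apply/W_gpoly => z zr.
have z2p : z ^+ (2 * p) = 1 by rewrite mulnC exprM (roots_pow zr) expr2 -rmorphM sgK rmorph1.
apply/eqP; rewrite -/(ev z _).
rewrite /comp_poly evD evN ev1 evM.
(* [z ^+ 2] is different from 1 and its [p]-th power is 1, so the geometric sum vanishes and [n]
   acts by 0. *)
have -> : ev z (1 - rot2_poly) = 1.
  rewrite /rot2_poly evD evN ev1 evZ.
  suff -> : ev z (\sum_(j < p) 'X^2 ^+ j) = 0 by rewrite mulr0 subr0.
  have := congr1 (ev z) (subrX1 ('X^2 : {poly rat}) p).
  rewrite evD evN ev1 -exprM evXn z2p subrr evM evD evN evXn ev1 => /esym/eqP.
  by rewrite mulf_eq0 subr_eq0 (negPf (roots_sq zr)) => /eqP.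
rewrite evZ evD evZ evXn (roots_pow zr) ev1 -rmorphM sgK rmorph1.
by rewrite fmorphV rmorph_nat mul1r mulVf ?subrr// pnatr_eq0.
Qed.

Lemma gring_op_rsim k (U : mx_representation rat G k) x : (x \in RG)%MS ->
  mx_rsim U W -> gring_op W x = 0 -> gring_op U x = 0.
Proof.
move=> Rx [b _ bfree bhom]; rewrite !gring_op_sum// => Wx; apply: (row_free_inj bfree).
rewrite mul0mx mulmx_suml (eq_bigr (fun g => b *m (gcoef x g *: W g))).
  by rewrite -mulmx_sumr Wx mulmx0.
by move=> g _; rewrite -scalemxAl -scalemxAr bhom ?inE.
Qed.

Lemma factor_eq0 x : simple_factor W x -> gring_op W x = 0 -> x = 0.
Proof.
move=> [Rx hx] Wx; apply: ring_eq0 => // k U irrU.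
have [UW|nUW] := pselect (mx_rsim U W); last exact: hx.
exact: gring_op_rsim UW Wx.
Qed.

Lemma factorMl x y : (y \in RG)%MS -> simple_factor W x -> simple_factor W (y *m x).
Proof.
move=> Ry [Rx hx]; split; first exact: ringM.
by move=> k U irrU nUW; rewrite gring_opMr// hx// mulmx0.
Qed.

Lemma factor_comp x : simple_factor W x -> eps *m x = x.
Proof.
move=> Qx; apply/eqP; rewrite eq_sym -subr_eq0; apply/eqP; rewrite -{1}[x]mul1mx -mulmxBl.
have R1 : (1%:M - eps \in RG)%MS by rewrite ringB ?ring1 ?ring_comp.
apply: factor_eq0; first exact: factorMl.
by rewrite gring_opMr ?op_comp ?mul0mx//; case: Qx.
Qed.

Lemma gpoly_comm K L : gpoly r K *m gpoly r L = gpoly r L *m gpoly r K.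
Proof. by rewrite -!gpolyM mulrC. Qed.

(** [K] is a multiple of [cyclo]. The product of [gpoly r cyclo] with [h sg] is an eigenvector of
    [r] for [sg], hence fixed by [r ^+ 2] and by [n], and so it is killed by [1%:M - n]. *)
Lemma gpoly_comp_eq0 K : gring_op W (gpoly r K) = 0 -> gpoly r K *m eps = 0.
Proof.
move=> /cyclo_dvd/dvdpP[q ->]; rewrite gpolyM -mulmxA; suff -> : gpoly r cyclo *m eps = 0.
  by rewrite mulmx0.
pose y := gpoly r cyclo *m h sg.
have Ay : A *m y = sg *: y.
  have : (1%:M - sg *: A) *m y = 0.
    rewrite /y mulmxA -{1}[r]expg1 -gpolyXn -(gpoly1 r) -gpolyZ -gpolyB -gpolyM expr1 cyclo_geom.
    rewrite gpolyB gpoly1 gpolyZ gpolyXn mulmxBl mul1mx -scalemxAl.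
    by rewrite sign_half_regl ?(CC1 D_dihedral)// scalerA sgK scale1r subrr.
  rewrite mulmxBl mul1mx -scalemxAl => /eqP; rewrite subr_eq0 => /eqP e.
  by rewrite [in RHS]e scalerA sgK scale1r.
have ny : n *m y = y.
  apply: rot2_fixl; rewrite expgS expg1 regularM -mulmxA Ay -scalemxAr Ay scalerA sgK.
  by rewrite scale1r.
rewrite comp_idemE mulmxA mulmxBr mulmx1 mulmxBl -(n_comm p_prime D_dihedral (ring_gpoly r _)).
by rewrite -mulmxA ny subrr.
Qed.

Lemma dim_gt0 : (0 < d)%N. Proof. by have [] := (proj1 (mx_irrP W)) W_irr. Qed.

(** Commuting with [s] makes [gpoly r K] central, so Schur's lemma inverts it on [W]. The inverse is
    a polynomial in [K], and an identity between polynomials in [r] on [W] holds in the group ring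
    after multiplication by [eps]. *)
Lemma gpoly_inverse K : gpoly r K *m B = B *m gpoly r K -> gring_op W (gpoly r K) != 0 ->
  exists L, gpoly r L *m B = B *m gpoly r L /\ gpoly r K *m gpoly r L *m eps = eps.
Proof.
move=> KB WK.
have AC : gpoly r K *m A = A *m gpoly r K by rewrite -{1 2}[r]expg1 -gpolyXn gpoly_comm.
have Ku : gring_op W (gpoly r K) \in unitmx.
  apply: (mx_Schur W_irr) WK; apply/centgmxP => g _.
  rewrite -!(gring_opG W) ?inE// -!gring_opMr ?ring_reg ?ring_gpoly//.
  by rewrite (generated_comm p_prime D_dihedral AC KB)// ring_reg.
have [q /gpoly_comp_eq0 hq] := gring_op_inverse_poly Ku.
exists (q \Po K); split.
  elim/poly_ind: q {hq} => [|q c IH]; first by rewrite comp_poly0 gpoly0 mul0mx mulmx0.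
  rewrite comp_poly_MXaddC gpolyD gpolyM gpolyC mulmxDl mulmxDr -mulmxA KB !mulmxA IH.
  by rewrite mul_mx_scalar mul_scalar_mx.
move/eqP: hq; rewrite gpolyB gpoly1 gpolyM mulmxBl mul1mx subr_eq0 => /eqP <-.
by [].
Qed.

Local Notation f c := (eps *m t c).

Lemma ring_refl_idem c : (f c \in RG)%MS.
Proof. by rewrite ringM ?ring_comp ?ring_half. Qed.
Lemma refl_idemK c : c * c = 1 -> f c *m f c = f c.
Proof.
move=> cc; rewrite -mulmxA [t c *m _]mulmxA -comp_comm ?ring_half// -mulmxA.
by rewrite sign_halfK ?(ss1 D_dihedral)// mulmxA comp_idemK.
Qed.
Lemma comp_refl c : eps *m f c = f c.
Proof. by rewrite mulmxA comp_idemK. Qed.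
Lemma reg_refl c : c * c = 1 -> B *m f c = c *: f c.
Proof.
move=> cc; rewrite mulmxA -comp_comm ?ring_reg// -mulmxA sign_half_regl ?(ss1 D_dihedral)//.
by rewrite scalemxAr.
Qed.
Lemma refl_sum : f 1 + f (-1) = eps.
Proof. by rewrite -mulmxDr sign_halfD mulmx1. Qed.

Lemma rotV_gpoly j : aG (r ^- j)%g = gpoly r 'X^((2 * p).-1 * j).
Proof. by rewrite gpolyXn (dihedral_rotV p_prime D_dihedral). Qed.
Lemma reg_swap j : B *m aG (r ^+ j)%g = aG (r ^- j)%g *m B.
Proof. by rewrite -!regularM (dihedral_swap D_dihedral). Qed.
Lemma reg_swapV j : B *m aG (r ^- j)%g = aG (r ^+ j)%g *m B.
Proof.
by rewrite (dihedral_rotV p_prime D_dihedral) reg_swap -(dihedral_rotV p_prime D_dihedral) invgK.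
Qed.

Lemma refl_corner x : (x \in RG)%MS ->
  exists K, gpoly r K *m B = B *m gpoly r K /\ f 1 *m x *m f 1 = gpoly r K *m f 1.
Proof.
move=> /ring_sumE ->.
have hg g : exists K, gpoly r K *m B = B *m gpoly r K /\ f 1 *m aG g *m f 1 = gpoly r K *m f 1.
  have [j [b ->]] := dihedral_elt p_prime D_dihedral g.
  (* On the right [f 1] absorbs the power of [s], and on the left averaging over [s] symmetrises
     [r ^+ j] with its inverse, which is the power [(2 * p).-1 * j]. *)
  exists (2^-1 *: ('X^j + 'X^((2 * p).-1 * j))); rewrite gpolyZ gpolyD -rotV_gpoly gpolyXn.
  split.
    by rewrite -scalemxAl -scalemxAr mulmxDl mulmxDr reg_swap reg_swapV addrC.
  have Bf i : aG (s ^+ i)%g *m f 1 = f 1.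
    elim: i => [|i IH]; first by rewrite expg0 regular1 mul1mx.
    by rewrite expgSr regularM -mulmxA reg_refl ?mulr1// scale1r IH.
  have Bf1 : B *m f 1 = f 1 by rewrite -{1}[s]expg1 Bf.
  have tj : t 1 *m aG (r ^+ j)%g = 2^-1 *: (aG (r ^+ j)%g + aG (r ^- j)%g *m B).
    by rewrite /sign_half scale1r -scalemxAl mulmxDl mul1mx reg_swap.
  transitivity (eps *m ((t 1 *m aG (r ^+ j)%g) *m (aG (s ^+ b)%g *m f 1))).
    by rewrite regularM !mulmxA.
  rewrite Bf tj -[in LHS]scalemxAl [in LHS]mulmxDl -[_ *m B *m _]mulmxA Bf1 -mulmxDl -scalemxAr.
  by rewrite [eps *m (_ *m _)]mulmxA comp_comm ?ringD ?ring_reg// -mulmxA comp_refl scalemxAl.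
have [K hK] := choice hg.
set y := \sum_g _; exists (\sum_g gcoef x g *: K g).
have KE : gpoly r (\sum_g gcoef x g *: K g) = \sum_g gcoef x g *: gpoly r (K g).
  by rewrite gpoly_sum; apply: eq_bigr => g _; rewrite gpolyZ.
rewrite KE; split.
  rewrite mulmx_suml mulmx_sumr; apply: eq_bigr => g _.
  by rewrite -scalemxAl -scalemxAr (proj1 (hK g)).
rewrite mulmx_sumr !mulmx_suml; apply: eq_bigr => g _.
by rewrite -scalemxAr -!scalemxAl (proj2 (hK g)).
Qed.

(* Multiplication by [r - r^-1] exchanges the two eigenspaces of [s]. *)
Definition rot_diff : {poly rat} := 'X - 'X^((2 * p).-1).
Local Notation T := (gpoly r rot_diff).

Lemma rot_diffE : T = A - aG r^-1%g.
Proof.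
have e : (r^-1 = r ^+ (2 * p).-1)%g.
  by have := dihedral_rotV p_prime D_dihedral 1; rewrite expg1 muln1.
by rewrite gpolyB -{1}['X]expr1 !gpolyXn expg1 e.
Qed.
Lemma rot_diff_swap : B *m T = - (T *m B).
Proof.
have := reg_swap 1; have := reg_swapV 1; rewrite !expg1 rot_diffE => e1 e2.
by rewrite mulmxBr mulmxBl e1 e2 opprB.
Qed.
Lemma refl_swap c : f c *m T = T *m f (- c).
Proof.
rewrite -mulmxA /sign_half -scalemxAl mulmxDl mul1mx -scalemxAl rot_diff_swap.
rewrite scalerN -scaleNr mulmxA -comp_comm ?ring_gpoly// -mulmxA; congr (_ *m _).
by rewrite -scalemxAr mulmxDr mulmx1 -scalemxAr.
Qed.

(** [T] anticommutes with [s], so its square commutes with [s]. It is nonzero on [W] because an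
    eigenvalue equal to its inverse would have square 1. *)
Lemma rot_diff_inverse : exists L, gpoly r L *m B = B *m gpoly r L /\ gpoly r L *m (T *m T) *m eps = eps.
Proof.
rewrite -gpolyM.
suff [L [LB]] : exists L, gpoly r L *m B = B *m gpoly r L /\
    gpoly r (rot_diff * rot_diff) *m gpoly r L *m eps = eps.
  by rewrite gpoly_comm => e; exists L.
apply: gpoly_inverse.
  by rewrite gpolyM -mulmxA -[T *m B]opprK -rot_diff_swap mulmxN mulmxA -[T *m B]opprK -rot_diff_swap mulNmx opprK -mulmxA.
have : (0 < size roots)%N by rewrite roots_size; move: p_gt3; lia.
case E: roots => [//|z l] _; have zr : z \in roots by rewrite E inE eqxx.
apply/eqP => /W_gpoly/(_ z zr); rewrite /root -/(ev z _) evM mulf_eq0 orbb /rot_diff.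
rewrite -['X]expr1 evD evN !evXn expr1 subr_eq0 => /eqP e.
have := roots_sq zr; rewrite expr2 {2}e -exprS prednK ?muln_gt0//.
by rewrite mulnC exprM (roots_pow zr) expr2 -rmorphM sgK rmorph1 eqxx.
Qed.

Lemma central_gpoly L y : gpoly r L *m B = B *m gpoly r L -> (y \in RG)%MS ->
  gpoly r L *m y = y *m gpoly r L.
Proof.
move=> LB; apply: (generated_comm p_prime D_dihedral) => //.
by rewrite -{1 2}[r]expg1 -gpolyXn gpoly_comm.
Qed.

(** [T] carries one eigenspace of [s] into the other; the way back is [T] followed by the central
    inverse of its square. *)
Lemma conj_refl : conj_idem (f (-1)) (f 1).
Proof.
have [L [LB TL]] := rot_diff_inverse.
have NN : (-1) * (-1) = 1 :> rat by rewrite mulrNN mulr1.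
have [RT RL] := (ring_gpoly r rot_diff, ring_gpoly r L).
exists (T *m f (-1)), (gpoly r L *m T *m f 1); split.
- exact: ringM (ring_refl_idem _).
- exact: ringM (ringM _ _) (ring_refl_idem _).
- have -> : T *m f (-1) *m (gpoly r L *m T *m f 1) = f 1 *m ((T *m gpoly r L) *m T *m eps *m t 1).
    by rewrite -(refl_swap 1) !mulmxA.
  by rewrite [T *m gpoly r L]gpoly_comm -[_ *m T *m T]mulmxA TL refl_idemK ?mulr1.
- have -> : gpoly r L *m T *m f 1 *m (T *m f (-1)) = gpoly r L *m T *m (f 1 *m T) *m f (-1).
    by rewrite !mulmxA.
  rewrite refl_swap -!mulmxA [eps *m (t (-1) *m _)]mulmxA (refl_idemK NN).
  by rewrite !mulmxA -[_ *m T *m T]mulmxA TL.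
Qed.

(** The equivalent idempotents [f 1] and [f (-1)] vanish on [W] together, while their sum acts as
    the identity. *)
Lemma op_refl_neq0 : gring_op W (f 1) != 0.
Proof.
have [x [y [Rx Ry xy yx]]] := conj_refl.
have NN : (-1) * (-1) = 1 :> rat by rewrite mulrNN mulr1.
have Rf := ring_refl_idem 1; apply/eqP => Wf.
have e : f (-1) = y *m f 1 *m x.
  by rewrite -(refl_idemK NN) -{1 2}yx -xy !mulmxA.
have Wf' : gring_op W (f (-1)) = 0.
  by rewrite e (gring_opMr _ _ Rx) (gring_opMr _ _ Rf) Wf mulmx0 mul0mx.
have := op_comp; rewrite -refl_sum linearB linearD /= Wf Wf' addr0 subr0 gring_op1 => /eqP.
by apply/negP; case: (d) dim_gt0 => // n' _; exact: matrix_nonzero1.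
Qed.

(** Irreducibility makes the product of some nonzero [x] in [f 1 Q[D] e], a group element and [f 1]
    nonzero on [W]. It lies in the corner of [f 1], where it can be inverted; this gives [y] with
    [x *m y = f 1]. Then [y *m x] is a nonzero idempotent below [e], hence equal to [e] by
    primitivity. *)
Theorem primitive_conj_refl e : primitive_idempotent W e -> conj_idem e (f 1).
Proof.
move=> [Qe ee e0 prim]; have Re : (e \in RG)%MS by case: Qe.
have Rf := ring_refl_idem 1; have Rf' := ring_refl_idem (-1).
have NN : (-1) * (-1) = 1 :> rat by rewrite mulrNN mulr1.
(* If [f 1] kills [e], then [f (-1)] fixes it, and [T] transports this nonzero element to the range
   of [f 1]. *)
have [b Rb fbe0] : exists2 b, (b \in RG)%MS & f 1 *m b *m e != 0.
  have [fe|fe] := eqVneq (f 1 *m e) 0; last first.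
    by exists 1%:M; rewrite ?ring1// mulmx1.
  exists T; first exact: ring_gpoly.
  rewrite refl_swap; apply: contra_neq e0 => Tfe.
  have [L [_ TL]] := rot_diff_inverse.
  have f'e : f (-1) *m e = 0.
    transitivity (gpoly r L *m (T *m (T *m f (-1) *m e))); last by rewrite Tfe !mulmx0.
    by rewrite -{1}TL !mulmxA.
  by rewrite -(factor_comp Qe) -refl_sum mulmxDl fe f'e addr0.
pose x := f 1 *m b *m e.
have Qx : simple_factor W x by apply: factorMl => //; exact: ringM.
have Wx : gring_op W x != 0.
  by apply: contra_neq fbe0 => Wx; exact: factor_eq0.
have [g Wxgf] := irr_mul_neq0 W_irr Wx op_refl_neq0.
have Rg := ring_reg g.
have Rbeg : (b *m e *m aG g \in RG)%MS by rewrite !ringM.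
have [K [KB fKf]] := refl_corner Rbeg.
have WK : gring_op W (gpoly r K) != 0.
  apply: contra_neq Wxgf => WK.
  have -> : gring_op W x *m W g *m gring_op W (f 1) = gring_op W (gpoly r K *m f 1).
    rewrite -fKf (gring_opMr _ _ Rf) -(gring_opG W) ?inE// -(gring_opMr _ _ Rg).
    by rewrite /x !mulmxA.
  by rewrite (gring_opMr _ _ Rf) WK mul0mx.
have [L [LB KL]] := gpoly_inverse KB WK.
pose y := e *m aG g *m f 1 *m gpoly r L.
have RL := ring_gpoly r L.
have Ry : (y \in RG)%MS by do 3![apply: ringM => //].
have xy : x *m y = f 1.
  transitivity (f 1 *m (b *m e *m aG g) *m f 1 *m gpoly r L).
    by rewrite -[in RHS]ee /x /y !mulmxA.
  by rewrite fKf -mulmxA -(central_gpoly LB Rf) !mulmxA KL.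
have yf : y *m f 1 = y.
  by rewrite /y -mulmxA (central_gpoly LB Rf) mulmxA -[_ *m f 1 *m f 1]mulmxA refl_idemK ?mulr1.
have eyx : e *m (y *m x) = y *m x by rewrite /y !mulmxA ee.
have yxe : (y *m x) *m e = y *m x by rewrite /x -!mulmxA ee.
have yxK : (y *m x) *m (y *m x) = y *m x by rewrite -mulmxA [x *m _]mulmxA xy mulmxA yf.
have Qyx : simple_factor W (y *m x) by exact: factorMl.
have Qe2 : simple_factor W (e - y *m x).
  split; first by rewrite ringB//; case: Qyx.
  by move=> k U irrU nUW; rewrite linearB /= (proj2 Qe)// (proj2 Qyx)// subr0.
exists x, y; split => //; first by case: Qx.
case: (prim (y *m x) (e - y *m x) Qyx Qe2 yxK) => //.
- by rewrite mulmxBl !mulmxBr ee eyx yxe yxK subrr subr0.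
- by rewrite mulmxBr yxe yxK subrr.
- by rewrite mulmxBl eyx yxK subrr.
- by rewrite subrKC.
- move=> yx0; have : f 1 = 0 :> M.
    by rewrite -(refl_idemK (mulr1 1)) -{1}xy -{1}xy mulmxA -[_ *m y *m x]mulmxA yx0 mulmx0 mul0mx.
  by move=> f0; case/eqP: op_refl_neq0; rewrite f0 linear0.
- by move/eqP; rewrite subr_eq0 => /eqP.
Qed.
End RationalComponent.

(** * Eigenvalues of the rotation on [W5] and [W6] *)

Section RationalFormIdempotents.
Variables (R : realType) (D : finGroupType) (p : nat) (r s : D).
Hypotheses (p_prime : prime p) (p_gt3 : (3 < p)%N).
Hypothesis D_dihedral : dihedral_presentation (2 * p) r s.
Local Notation G := [set: D]%G.
Local Notation toC := (ratr : {rmorphism rat -> R[i]}).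
Variables (w : R[i]) (k : nat -> nat) (sg : rat) (d : nat) (W : mx_representation rat G d).
Local Notation m := (p.-1)./2.
Hypothesis w_root : (2 * p).-primitive_root w.
Hypothesis k_inj : forall i j, (1 <= i <= m)%N -> (1 <= j <= m)%N -> k i = k j -> i = j.
Hypothesis k_bound : forall i, (1 <= i <= m)%N -> (0 < k i < p)%N.
Hypothesis k_sign : forall i, (1 <= i <= m)%N -> (-1) ^+ k i = sg.
Hypothesis W_rational : is_rational_form r s w m k W.

(** On [V_(k i)] the rotation has the eigenvalues [w ^+ k i] and its inverse, here with exponent
    [2 p - k i]. The two halves of the list lie on either side of [p], so the exponents are
    distinct. *)
Let exponents := map k (iota 1 m) ++ map (fun i => (2 * p - k i)%N) (iota 1 m).
Let roots := [seq w ^+ j | j <- exponents].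

Let p_gt0 : (0 < p)%N. Proof. exact: prime_gt0. Qed.

Let exponentsP j : j \in exponents ->
  exists2 i, (1 <= i <= m)%N & j = k i \/ j = (2 * p - k i)%N.
Proof.
rewrite mem_cat => /orP[] /mapP[i0]; rewrite mem_iota add1n ltnS => hi ->; exists i0 => //.
  by left.
by right.
Qed.

Let exponents_bound j : j \in exponents -> (0 < j < 2 * p)%N /\ j != p.
Proof.
move=> /exponentsP[i hi]; have := k_bound hi => hk [->|->]; split; lia.
Qed.

Let exponents_uniq : uniq exponents.
Proof.
have mem i : i \in iota 1 m -> (1 <= i <= m)%N by rewrite mem_iota add1n ltnS.
rewrite cat_uniq; apply/and3P; split.
- by rewrite map_inj_in_uniq ?iota_uniq// => i j /mem hi /mem hj; exact: k_inj.
- apply/hasPn => j /mapP[i /mem hi ->]; apply/negP => /seq.mapP[i' /mem hi'].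
  by have := k_bound hi; have := k_bound hi'; lia.
- rewrite map_inj_in_uniq ?iota_uniq// => i j /mem hi /mem hj e.
  by apply: k_inj => //; have := k_bound hi; have := k_bound hj; lia.
Qed.

Let roots_uniq : uniq roots.
Proof.
rewrite map_inj_in_uniq// => i j /exponents_bound[hi _] /exponents_bound[hj _] /eqP.
rewrite (eq_prim_root_expr w_root) !modn_small; [by move=> /eqP| |]; lia.
Qed.

Let roots_size : size roots = p.-1.
Proof.
rewrite size_map size_cat !size_map !size_iota addnn.
have [e|o] := even_prime p_prime; first by move: p_gt3; rewrite e.
by rewrite halfK; move: o p_gt0; case: p => // q; rewrite /= => /negPf ->; rewrite subn0.
Qed.

Let w_pow : w ^+ p = -1.
Proof.
have := prim_expr_order w_root; rewrite mulnC exprM => /eqP; rewrite sqrf_eq1.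
move=> /orP[|/eqP//]; rewrite -(prim_order_dvd w_root) => /dvdn_leq.
by move=> /(_ p_gt0); lia.
Qed.

Let sg_sq : sg * sg = 1.
Proof.
(* As [p > 3], the index 1 occurs, and [sg] is a power of -1. *)
have h : (1 <= 1 <= m)%N by move: p_gt3; case: p => [|[|[|[|q]]]].
by rewrite -(k_sign h) -expr2 sqrr_sign.
Qed.

Let roots_pow z : z \in roots -> z ^+ p = toC sg.
Proof.
move=> /mapP[j /exponentsP[i hi je] ->]; rewrite exprAC w_pow.
rewrite -(k_sign hi) rmorphXn rmorphN1; case: je => -> //.
rewrite -signr_odd -[RHS]signr_odd oddB ?mul2n ?odd_double//.
by have := k_bound hi; lia.
Qed.

Let roots_sq z : z \in roots -> z ^+ 2 != 1.
Proof.
move=> /mapP[j /exponents_bound[hj jp] ->]; rewrite -exprM -(prim_order_dvd w_root).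
rewrite [(j * 2)%N]mulnC dvdn_pmul2l//; apply/negP => /dvdnP[c cE]; move: hj jp; rewrite cE.
by case: c {cE} => [|[|c]]; rewrite ?mul0n ?mul1n ?eqxx// !mulSn; lia.
Qed.

Let W_gpoly K : gring_op W (gpoly r K) = 0 <->
  forall z, z \in roots -> root (map_poly toC K) z.
Proof.
have [V Vk WV] := rational_formP W_rational; rewrite (WV _ (ring_gpoly r K)).
have ki i : (1 <= i <= m)%N -> w ^- k i = w ^+ (2 * p - k i).
  move=> hi; have w0 j : w ^+ j != 0.
    rewrite expf_neq0//; apply/eqP => w00; have /eqP := prim_expr_order w_root.
    by rewrite w00 expr0n muln_eq0 /= -leqn0 leqNgt p_gt0 /= eq_sym oner_eq0.
  apply: (mulfI (w0 (k i))); rewrite divff// -exprD subnKC ?prim_expr_order//.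
  by have := k_bound hi; lia.
split=> [h z /mapP[j /exponentsP[i hi je] ->]|h i hi].
  have := h i hi; rewrite (cop_gpoly K (Vk i hi)) => /matrixP e.
  have := e 0 0; have := e 1 1; rewrite !mxE /= !mulr1n => e1 e0.
  by case: je => ->; apply/eqP; rewrite // -ki.
have mem i' : (1 <= i' <= m)%N -> i' \in iota 1 m by rewrite mem_iota add1n ltnS.
rewrite (cop_gpoly K (Vk i hi)); apply/matrixP => a b; rewrite !mxE.
have -> : (map_poly toC K).[if a == 0 then w ^+ k i else w ^- k i] = 0; last exact: mul0rn.
apply/eqP/(h _); apply/seq.mapP; case: (a == 0).
  by exists (k i) => //; rewrite mem_cat map_f ?mem.
by exists (2 * p - k i)%N; rewrite ?ki// mem_cat [X in _ || X]map_f ?mem ?orbT.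
Qed.

Lemma rational_form_idempotent e : primitive_idempotent W e ->
  conj_idem e (comp_idem p r sg *m sign_half s 1).
Proof.
have [W_irr _] := W_rational.
exact: (primitive_conj_refl p_prime p_gt3 D_dihedral sg_sq roots_uniq roots_size).
Qed.

Lemma rational_form_conj :
  conj_idem (comp_idem p r sg *m sign_half s (-1)) (comp_idem p r sg *m sign_half s 1).
Proof.
have [W_irr _] := W_rational.
exact: (conj_refl p_prime p_gt3 D_dihedral sg_sq roots_uniq roots_size roots_pow roots_sq W_irr).
Qed.

End RationalFormIdempotents.

(** * The action on the Jacobian *)
Section GroupRingAction.
Variables (R : realType) (D : finGroupType) (X : curve R) (a : D -> X -> X).
Hypothesis aP : faithful_action a.
Local Notation G := [set: D]%G.
Local Notation aG := (regular_repr rat G).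
Local Notation RG := (group_ring rat G).
Local Notation M := 'M[rat]_#|G|.
Local Notation toC := (ratr : {rmorphism rat -> R[i]}).
Local Notation V := (holo_form X -> R[i]^o).
Implicit Types (x y e f : M) (l m : V).

Definition gring_act x l : V := locked (\sum_g toC (gcoef x g) *: norm_map (a g) l).
Lemma gring_actE x l : gring_act x l = \sum_g toC (gcoef x g) *: norm_map (a g) l.
Proof. by rewrite /gring_act -lock. Qed.

Lemma action_holomorphic g : holomorphic_map (a g). Proof. by have [_ _ h _] := aP. Qed.

(** Pullback reverses products and transposition reverses them again, so the group ring acts from
    the left. *)
Lemma norm_map_actionM g k l : norm_map (a (g * k)%g) l = norm_map (a g) (norm_map (a k) l).
Proof. by apply/funext => w; rewrite /norm_map (pullback_action_comp aP). Qed.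

Lemma gring_act_linear x (c : R[i]) l m : gring_act x (c *: l + m) = c *: gring_act x l + gring_act x m.
Proof.
rewrite !gring_actE scaler_sumr -big_split; apply: eq_bigr => g _ /=.
by rewrite -[norm_map _ _]/(c *: norm_map (a g) l + norm_map (a g) m) scalerDr !scalerA mulrC.
Qed.
Lemma gring_act0r x : gring_act x 0 = 0.
Proof. by have := gring_act_linear x (-1) 0 0; rewrite scaler0 addr0 scaleN1r addNr. Qed.
Lemma gring_actDr x l m : gring_act x (l + m) = gring_act x l + gring_act x m.
Proof. by have := gring_act_linear x 1 l m; rewrite !scale1r. Qed.
Lemma gring_actZr x (c : R[i]) l : gring_act x (c *: l) = c *: gring_act x l.
Proof. by have := gring_act_linear x c l 0; rewrite gring_act0r !addr0. Qed.
Lemma gring_act_sumr x (T : finType) (F : T -> V) : gring_act x (\sum_i F i) = \sum_i gring_act x (F i).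
Proof. exact: (big_morph (gring_act x) (gring_actDr x) (gring_act0r x)). Qed.

Lemma gring_actD x y l : gring_act (x + y) l = gring_act x l + gring_act y l.
Proof.
rewrite !gring_actE -big_split; apply: eq_bigr => g _ /=.
by rewrite gcoefD rmorphD scalerDl.
Qed.
Lemma gring_actZ (c : rat) x l : gring_act (c *: x) l = toC c *: gring_act x l.
Proof.
rewrite !gring_actE scaler_sumr; apply: eq_bigr => g _ /=.
by rewrite gcoefZ rmorphM scalerA.
Qed.
Lemma gring_act0 l : gring_act 0 l = 0.
Proof. by rewrite gring_actE big1// => g _; rewrite gcoef0 rmorph0 scale0r. Qed.
Lemma gring_act_sum (T : finType) (F : T -> M) l : gring_act (\sum_i F i) l = \sum_i gring_act (F i) l.
Proof. exact: (big_morph (gring_act^~ l) (fun x y => gring_actD x y l) (gring_act0 l)). Qed.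
Lemma gring_act_reg g l : gring_act (aG g) l = norm_map (a g) l.
Proof.
rewrite gring_actE (bigD1 g)//= gcoef_reg eqxx rmorph1 scale1r big1 ?addr0// => h hg.
by rewrite gcoef_reg (negPf hg) rmorph0 scale0r.
Qed.

Lemma gring_actM x y l : (x \in RG)%MS -> (y \in RG)%MS -> gring_act (x *m y) l = gring_act x (gring_act y l).
Proof.
move=> /ring_sumE -> /ring_sumE ->; rewrite mulmx_suml !gring_act_sum; apply: eq_bigr => g _.
rewrite -scalemxAl mulmx_sumr !gring_actZ; congr (_ *: _).
rewrite !gring_act_sum gring_act_sumr; apply: eq_bigr => h _.
by rewrite -scalemxAr !gring_actZ gring_actZr -regularM !gring_act_reg norm_map_actionM.
Qed.

Lemma gring_act1 l : gring_act 1%:M l = l.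
Proof.
rewrite -(regular1 D) gring_act_reg; apply/funext => w; rewrite /norm_map pullback_id//.
  exact: action_holomorphic.
by have [h _ _ _] := aP.
Qed.

Lemma dual_forms0 : dual_forms X 0.
Proof. by move=> c u v /=; rewrite -[LHS]/(0 : R[i]) -[0 u]/(0 : R[i]) -[0 v]/(0 : R[i]) mulr0 addr0. Qed.

Lemma gring_act_dual x l : dual_forms X l -> dual_forms X (gring_act x l).
Proof.
move=> hl; rewrite gring_actE; elim/big_rec: _ => [|g m _ hm]; first exact: dual_forms0.
apply: dual_formsD => //; apply: dual_forms_scale; apply: norm_map_linear => //.
exact: action_holomorphic.
Qed.

Definition integral x := forall g, exists c : int, gcoef x g = c%:~R.

Lemma periodsMz (Y : curve R) P (c : int) : periods Y P -> periods Y (P *~ c).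
Proof.
move=> YP; have h n : periods Y (P *+ n).
  by elim: n => [|n IH]; rewrite ?mulr0n ?mulrS; [exact: periods0|exact: periodsD].
by case: c => n; [exact: h|rewrite NegzE mulrNz; apply: periodsN; exact: h].
Qed.

Lemma gring_act_periods x P : integral x -> periods X P -> periods X (gring_act x P).
Proof.
move=> ix XP; rewrite gring_actE; elim/big_rec: _ => [|g m _ hm]; first exact: periods0.
apply: periodsD => //; have [c ->] := ix g; rewrite rmorph_int scaler_int.
by apply: periodsMz; apply: periods_norm_map XP; exact: action_holomorphic.
Qed.

Lemma integral_scale x : exists2 n, (0 < n)%N & integral (n%:R *: x).
Proof.
exists (\prod_g absz (denq (gcoef x g)))%N.
  by rewrite prodn_gt0// => g; rewrite absz_gt0 denq_neq0.
move=> g; rewrite gcoefZ (bigD1 g)//= natrM mulrAC.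
have -> : (absz (denq (gcoef x g)))%:R * gcoef x g = (numq (gcoef x g))%:~R.
  by rewrite numqE natr_absz ger0_norm ?denq_ge0// mulrC.
exists (numq (gcoef x g) * (\prod_(i | i != g) absz (denq (gcoef x i)))%N%:Z).
by rewrite intrM.
Qed.

Lemma good_subtorus (Y : curve R) (K : set (holo_form Y -> R[i]^o)) : K 0 ->
  (forall (c : R[i]) u v, K u -> K v -> K (c *: u + v)) -> good_torus (subtorus Y K).
Proof.
move=> K0 Kl; split => //=.
- by split; [split => //; exact: periods0|move=> v []].
- move=> u v [Ku Pu] [Kv Pv]; split; last by apply: periodsD => //; exact: periodsN.
  by rewrite addrC -scaleN1r; exact: Kl.
Qed.

Lemma subtorus_finite_quotients (Y : curve R) (K : set (holo_form Y -> R[i]^o)) : K 0 ->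
  (forall (c : R[i]) u v, K u -> K v -> K (c *: u + v)) -> finite_quotients (subtorus Y K).
Proof.
move=> K0 Kl n n0; have [s hs] := periods_zspan Y.
apply: (zspan_finite_quotient n0 (s := s) (L := K `&` periods Y)).
- by move=> v [_ /hs].
- by split => //; exact: periods0.
- move=> u v [Ku Pu] [Kv Pv]; split; last exact: periodsD.
  by rewrite -[u]scale1r; exact: Kl.
- move=> v [Kv Pv]; split; last exact: periodsN.
  by rewrite -[- v]addr0 -scaleN1r; exact: Kl.
Qed.

Definition act_image e : set V := gring_act e @` dual_forms X.
(** The abelian subvariety cut out by a rational [e]. A positive integral multiple of [e] has the
    same image on the complex space of dual forms, which is what relates it to [group_image]. *)
Definition torus_of e : torus R := subtorus X (act_image e).

Lemma act_image0 e : act_image e 0.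
Proof. by exists 0; rewrite ?gring_act0r//; exact: dual_forms0. Qed.
Lemma act_image_linear e (c : R[i]) u v :
  act_image e u -> act_image e v -> act_image e (c *: u + v).
Proof.
move=> [l hl <-] [m hm <-]; exists (c *: l + m); last by rewrite gring_act_linear.
by apply: dual_formsD => //; exact: dual_forms_scale.
Qed.
Lemma act_image_dual e l : act_image e l -> dual_forms X l.
Proof. by move=> [m hm <-]; exact: gring_act_dual. Qed.
Lemma act_image_fix e l : (e \in RG)%MS -> e *m e = e -> act_image e l -> gring_act e l = l.
Proof. by move=> Re ee [m _ <-]; rewrite -(gring_actM _ Re Re) ee. Qed.
Lemma act_imageM x e l : (x \in RG)%MS -> (e \in RG)%MS -> dual_forms X l ->
  act_image x (gring_act (x *m e) l).
Proof. by move=> Rx Re hl; rewrite gring_actM//; exists (gring_act e l) => //; exact: gring_act_dual. Qed.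

Lemma good_torus_of e : good_torus (torus_of e).
Proof. exact: good_subtorus (act_image0 e) (@act_image_linear e). Qed.
Lemma torus_of_finite_quotients e : finite_quotients (torus_of e).
Proof. exact: subtorus_finite_quotients (act_image0 e) (@act_image_linear e). Qed.

Lemma torus_of_act e f x : integral x -> (e \in RG)%MS -> e *m e = e ->
  (forall l, act_image e l -> act_image f (gring_act x l)) ->
  @torus_hom R (torus_of e) (torus_of f) (gring_act x).
Proof.
move=> ix Re ee ef; split => /=; first exact: ef.
- by move=> c u v _ _; exact: gring_act_linear.
- by move=> v [ev Pv]; split; [exact: ef|exact: gring_act_periods].
Qed.

Lemma qisog_conj e f : (e \in RG)%MS -> e *m e = e -> (f \in RG)%MS -> f *m f = f ->
  conj_idem e f -> qisog (torus_of e) (torus_of f).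
Proof.
move=> Re ee Rf ff [x [y [Rx Ry xy yx]]].
have [N N0 Nx] := integral_scale x; have [K K0 Ky] := integral_scale y.
split; [exact: good_torus_of|exact: good_torus_of|].
exists (gring_act (N%:R *: x)), (gring_act (K%:R *: y)), (K * N)%N.
have im z u v (c : rat) l : (z \in RG)%MS -> (u \in RG)%MS -> (v \in RG)%MS -> u *m u = u ->
    z *m u = v *m z -> act_image u l -> act_image v (gring_act (c *: z) l).
  move=> Rz Ru Rv uu zu ul; rewrite gring_actZ -[_ *: _]addr0.
  apply: act_image_linear; last exact: act_image0.
  rewrite -(act_image_fix Ru uu ul) -gring_actM// zu; apply: act_imageM => //.
  exact: act_image_dual ul.
have ye : y *m f = e *m y by rewrite -xy -yx mulmxA.
have xe : x *m e = f *m x by rewrite -xy -yx mulmxA.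
split.
- by apply: torus_of_act => // l; exact: im.
- by apply: torus_of_act => // l; exact: im.
- by rewrite muln_gt0 K0.
- move=> l el; rewrite !gring_actZ !gring_actZr -gring_actM// yx (act_image_fix Re ee el).
  by rewrite scalerA !rmorph_nat -natrM scaler_nat.
- move=> l fl; rewrite !gring_actZ !gring_actZr -gring_actM// xy (act_image_fix Rf ff fl).
  by rewrite scalerA !rmorph_nat -natrM scaler_nat mulnC.
Qed.

Lemma gring_act_split n u v l m : (u \in RG)%MS -> (v \in RG)%MS -> u *m u = u -> v *m v = v ->
  u *m v = 0 -> act_image u l -> act_image v m -> gring_act (n%:R *: u) (l + m) = l *+ n.
Proof.
move=> Ru Rv uu vv uv ul vm; rewrite gring_actZ rmorph_nat gring_actDr (act_image_fix Ru uu ul).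
rewrite -(act_image_fix Rv vv vm) -(gring_actM _ Ru Rv) uv gring_act0 addr0.
exact: scaler_nat.
Qed.

Definition pair_sum (lm : V * V) : V := lm.1 + lm.2.
Lemma pair_sum_linear (c : R[i]) (x y : V * V) :
  pair_sum (c *: x + y) = c *: pair_sum x + pair_sum y.
Proof. by case: x y => [l l'] [m m']; rewrite /pair_sum /= scalerDr addrACA. Qed.

Section split.
Variables u v : M.
Hypotheses (Ru : (u \in RG)%MS) (Rv : (v \in RG)%MS) (uu : u *m u = u) (vv : v *m v = v).
Hypotheses (uv : u *m v = 0) (vu : v *m u = 0).
Let Re : (u + v \in RG)%MS. Proof. exact: ringD. Qed.
Let ee : (u + v) *m (u + v) = u + v.
Proof. by rewrite mulmxDl !mulmxDr uu vv uv vu addr0 add0r. Qed.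

Lemma split_hom n : integral (n%:R *: u) -> integral (n%:R *: v) ->
  @torus_hom R (torus_of (u + v)) (prod_torus (torus_of u) (torus_of v))
    (fun l => (gring_act (n%:R *: u) l, gring_act (n%:R *: v) l)).
Proof.
move=> iu iv; have im z l (c : rat) : (z \in RG)%MS -> dual_forms X l -> act_image z (gring_act (c *: z) l).
  by move=> Rz hl; rewrite gring_actZ -gring_actZr; exists (toC c *: l) => //; exact: dual_forms_scale.
split => /=.
- by move=> l /act_image_dual hl; split; exact: im.
- by move=> c l m _ _; rewrite !gring_act_linear.
- move=> l [/act_image_dual hl Pl]; split; split; try exact: im; exact: gring_act_periods.
Qed.

Lemma sum_hom : @torus_hom R (prod_torus (torus_of u) (torus_of v)) (torus_of (u + v))
  pair_sum.
Proof.
have inc z l : (z \in RG)%MS -> z *m z = z -> (u + v) *m z = z -> act_image z l ->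
    act_image (u + v) l.
  move=> Rz zz ez zl; rewrite -(act_image_fix Rz zz zl) -ez; apply: act_imageM => //.
  exact: act_image_dual zl.
have eu : (u + v) *m u = u by rewrite mulmxDl uu vu addr0.
have ev : (u + v) *m v = v by rewrite mulmxDl vv uv add0r.
have eD l m : act_image (u + v) l -> act_image (u + v) m -> act_image (u + v) (l + m).
  by move=> el em; rewrite -[l]scale1r; exact: act_image_linear.
have sum (lm : V * V) : act_image u lm.1 -> act_image v lm.2 -> act_image (u + v) (pair_sum lm).
  by move=> ul vm; apply: eD; [exact: inc ul|exact: inc vm].
split.
- by move=> lm [ul vm]; exact: sum.
- by move=> c x y _ _; exact: pair_sum_linear.
- move=> lm [[ul Pl] [vm Pm]]; split; first exact: sum.
  exact: (periodsD Pl Pm).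
Qed.

Lemma qisog_split : qisog (torus_of (u + v)) (prod_torus (torus_of u) (torus_of v)).
Proof.
have [N N0 Nu] := integral_scale u; have [K K0 Kv] := integral_scale v.
(* One multiple has to clear the denominators of both [u] and [v], so that the two components are
   scaled equally. *)
have iu : integral ((K * N)%:R *: u).
  move=> g; have [c hc] := Nu g; exists (K%:Z * c).
  by rewrite natrM -scalerA gcoefZ hc intrM.
have iv : integral ((K * N)%:R *: v).
  move=> g; have [c hc] := Kv g; exists (N%:Z * c).
  by rewrite mulnC natrM -scalerA gcoefZ hc intrM.
have GF (l : V) : act_image (u + v) l ->
    gring_act ((K * N)%:R *: u) l + gring_act ((K * N)%:R *: v) l = l *+ (K * N).
  move=> el; rewrite -gring_actD -scalerDr gring_actZ (act_image_fix Re ee el).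
  rewrite rmorph_nat; exact: scaler_nat.
have FG (lm : V * V) : act_image u lm.1 -> act_image v lm.2 ->
    (gring_act ((K * N)%:R *: u) (pair_sum lm), gring_act ((K * N)%:R *: v) (pair_sum lm)) = lm *+ (K * N).
  case: lm => l m /= ul vm; have El := gring_act_split (K * N) Ru Rv uu vv uv ul vm.
  by have := gring_act_split (K * N) Rv Ru vv uu vu vm ul; rewrite /pair_sum /= addrC El pairMn => ->.
split; [exact: good_torus_of|by apply: good_prod; exact: good_torus_of|].
exists (fun l => (gring_act ((K * N)%:R *: u) l, gring_act ((K * N)%:R *: v) l)), pair_sum, (K * N)%N.
split; [exact: split_hom|exact: sum_hom|by rewrite muln_gt0 K0|exact: GF|].
by move=> lm [ul vm]; exact: FG.
Qed.
End split.

Lemma jacobian_torus_of : jacobian_variety X = torus_of 1%:M.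
Proof.
have e : act_image 1%:M = dual_forms X.
  apply/seteqP; split=> [l|l hl]; first exact: act_image_dual.
  by exists l => //; exact: gring_act1.
rewrite /torus_of e /subtorus /jacobian_variety; congr (Torus _ _).
by apply/seteqP; split=> [P XP|P []//]; split => //; exact: periods_linear.
Qed.

Lemma group_image_torus_of e n (c : D -> int) : integral_multiple e n c ->
  group_image a c = torus_of e.
Proof.
move=> [n0 hc]; rewrite /group_image /torus_of; congr (subtorus X _).
have cE l : \sum_g (c g)%:~R *: norm_map (a g) l = n%:R *: gring_act e l.
  rewrite !gring_actE scaler_sumr; apply: eq_bigr => g _; rewrite scalerA; congr (_ *: _).
  by rewrite -(rmorph_int toC (c g)) hc rmorphM rmorph_nat.
have nC : (n%:R : R[i]) != 0 by rewrite pnatr_eq0 -lt0n.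
apply/seteqP; split=> _ [l hl <-].
  by rewrite cE -gring_actZr; exists (n%:R *: l) => //; exact: dual_forms_scale.
exists (n%:R^-1 *: l); first exact: dual_forms_scale.
by rewrite cE gring_actZr scalerA divff// scale1r.
Qed.

End GroupRingAction.

(** * Norm and transfer between a curve and its quotient *)

Section Transfer.
Variables (R : realType) (D : finGroupType) (X : curve R) (a : D -> X -> X).
Variables (Z : curve R) (M : {group D}) (q : X -> Z).
Hypotheses (aP : faithful_action a) (qP : is_quotient a M q).
Local Notation RG := (group_ring rat [set: D]%G).
Local Notation V := (holo_form X -> R[i]^o).
Local Notation VZ := (holo_form Z -> R[i]^o).
Local Notation gring_act := (gring_act a).
Local Notation act_image := (act_image a).
Local Notation k := (#|M|%:R : R[i]).

Definition form_trace (w : holo_form X) : holo_form Z := projT1 (cid (exists_trace aP qP w)).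
Lemma traceE w : pullback q (form_trace w) = \sum_(g in M) pullback (a g) w.
Proof. by rewrite /form_trace; case: cid. Qed.

(** The analytic representation of the pullback of divisor classes from [Z] to [X]. *)
Definition dual_transfer (l : VZ) : V := fun w => l (form_trace w).

Let q_holo : holomorphic_map q. Proof. by have [] := qP. Qed.
Let a_holo g : holomorphic_map (a g). Proof. by have [_ _ h _] := aP. Qed.

Lemma trace_linear (c : R[i]) u v : form_trace (c *: u + v) = c *: form_trace u + form_trace v.
Proof.
apply: (pullback_inj_quotient aP qP); rewrite (pullback_linear q_holo) !traceE scaler_sumr -big_split.
by apply: eq_bigr => g _; rewrite (pullback_linear (a_holo g)).
Qed.

Lemma trace_pullback v : form_trace (pullback q v) = k *: v.
Proof.
apply: (pullback_inj_quotient aP qP); rewrite (pullbackZ q_holo) traceE.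
rewrite (eq_bigr (fun=> pullback q v)) => [|g gM]; last exact: (pullback_action_quotient aP qP).
by rewrite sumr_const scaler_nat.
Qed.

Lemma transfer_linear (c : R[i]) l m : dual_transfer (c *: l + m) = c *: dual_transfer l + dual_transfer m.
Proof. by []. Qed.

Lemma transfer_dual l : dual_forms Z l -> dual_forms X (dual_transfer l).
Proof. by move=> hl c u v; rewrite /dual_transfer trace_linear hl. Qed.

Lemma dual_scale (Y : curve R) (c : R[i]) u (l : holo_form Y -> R[i]^o) : dual_forms Y l ->
  l (c *: u) = c * l u.
Proof.
move=> hl; have l0 : l 0 = 0.
  by have := hl (-1) 0 0; rewrite scaler0 addr0 mulN1r addNr.
by have := hl c u 0; rewrite !addr0 l0 addr0.
Qed.

Lemma norm_transfer l : dual_forms Z l -> norm_map q (dual_transfer l) = k *: l.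
Proof.
by move=> hl; apply/funext => v; rewrite /norm_map /dual_transfer trace_pullback dual_scale.
Qed.

Lemma dual_sum (Y : curve R) (T : finType) (P : pred T) (F : T -> holo_form Y) l :
  dual_forms Y l -> l (\sum_(i | P i) F i) = \sum_(i | P i) l (F i).
Proof.
move=> hl; apply: (big_morph l) => [u v|].
  by have := hl 1 u v; rewrite scale1r mul1r.
by have := dual_scale 0 0 hl; rewrite scale0r mul0r.
Qed.

Lemma gring_act_avg (N : {group D}) l : #|N|%:R *: gring_act (avg N) l = \sum_(g in N) norm_map (a g) l.
Proof.
rewrite /avg gring_actZ scalerA fmorphV rmorph_nat divff ?scale1r ?pnatr_eq0 -?lt0n ?cardG_gt0//.
rewrite (big_morph (gring_act^~ l) (fun x y => gring_actD a x y l) (gring_act0 a l)).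
by apply: eq_bigr => g _; rewrite gring_act_reg.
Qed.

Lemma fun_sumE (T : finType) (P : pred T) (F : T -> V) w :
  (\sum_(i | P i) F i) w = \sum_(i | P i) F i w.
Proof. by elim/big_rec2: _ => // i y z _ <-. Qed.

Lemma transfer_norm l : dual_forms X l -> dual_transfer (norm_map q l) = k *: gring_act (avg M) l.
Proof.
move=> hl; apply/funext => w; rewrite gring_act_avg fun_sumE /dual_transfer /norm_map traceE.
by rewrite dual_sum.
Qed.

(** The multiple of [P] by [#|M|] is the norm of a period [Q] of [X], and the transfer of a norm is
    the sum of the translates of [Q]. This is the origin of the factor [k] here and of [#|M| * #|M|]
    in [qisog_quotient]. *)
Lemma transfer_periods P : periods Z P -> periods X (k *: dual_transfer P).
Proof.
move=> ZP; have [Q XQ QP] := norm_periods_finite_index aP qP ZP.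
have -> : k *: dual_transfer P = \sum_(g in M) norm_map (a g) Q.
  rewrite -gring_act_avg -(transfer_norm (periods_linear XQ)) QP.
  by have -> : P *+ #|M| = k *: (P : VZ) by apply/esym; exact: scaler_nat.
elim/big_rec: _ => [|g m _ hm]; first exact: periods0.
by apply: periodsD => //; apply: periods_norm_map XQ; exact: a_holo.
Qed.

Lemma avg_transfer l : dual_forms Z l -> gring_act (avg M) (dual_transfer l) = dual_transfer l.
Proof.
move=> hl; have k0 : k != 0 by rewrite pnatr_eq0 -lt0n cardG_gt0.
apply: (scalerI k0); rewrite -(transfer_norm (transfer_dual hl)) norm_transfer//.
Qed.

Lemma norm_act_avg (N : {group D}) (Y : curve R) (h : X -> Y) l :
  (forall g, g \in N -> forall w, pullback (a g) (pullback h w) = pullback h w) ->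
  norm_map h (gring_act (avg N) l) = norm_map h l.
Proof.
move=> hN; have k0 : (#|N|%:R : R[i]) != 0 by rewrite pnatr_eq0 -lt0n cardG_gt0.
apply: (scalerI k0); rewrite -[_ *: norm_map h _]/(norm_map h (#|N|%:R *: _)) gring_act_avg.
apply/funext => w; rewrite /norm_map fun_sumE (eq_bigr (fun=> l (pullback h w))) => [|g gN].
  by rewrite sumr_const -[RHS]/(#|N|%:R * _) mulr_natl.
by rewrite /norm_map hN.
Qed.

(** The common form of the comparisons with Jacobians, Prym varieties and their intersections. [K]
    is the cover of the subtorus on the quotient side; the last two hypotheses match it with the
    image of [e] under the norm and the transfer. *)
Theorem qisog_quotient e (K : set VZ) : (e \in RG)%MS -> e *m e = e -> avg M *m e = e ->
  K `<=` dual_forms Z -> K 0 ->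
  (forall (c : R[i]) u v, K u -> K v -> K (c *: u + v)) ->
  (forall l, dual_forms X l -> gring_act e l = l -> K (norm_map q l)) ->
  (forall l, dual_forms X l -> gring_act (avg M) l = l -> K (norm_map q l) -> gring_act e l = l) ->
  qisog (torus_of a e) (subtorus Z K).
Proof.
move=> Re ee Me Kd K0 Kl eK Ke.
have KZ (c : R[i]) u : K u -> K (c *: u).
  by move=> Ku; rewrite -[_ *: _]addr0; exact: Kl.
have nK l : act_image e l -> K (norm_map q l).
  by move=> el; apply: eK; [exact: act_image_dual el|exact: act_image_fix el].
have Kt l : K l -> act_image e (dual_transfer l).
  move=> Kl'; have hl := Kd _ Kl'; exists (dual_transfer l); first exact: transfer_dual.
  by apply: Ke; [exact: transfer_dual|exact: avg_transfer|rewrite norm_transfer//; exact: KZ].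
split; [exact: good_torus_of|exact: good_subtorus|].
exists (norm_map q), (fun l => k *: dual_transfer l), (#|M| * #|M|)%N; split.
- split => //= l [el Pl]; split; first exact: nK.
  exact: periods_norm_map.
- split => /=.
  + by move=> l Kl'; rewrite -[_ *: _]addr0; apply: act_image_linear; [exact: Kt|exact: act_image0].
  + by move=> c u v _ _; rewrite transfer_linear scalerDr !scalerA mulrC.
  + move=> l [Kl' Pl]; split; last exact: transfer_periods.
    by rewrite -[_ *: _]addr0; apply: act_image_linear; [exact: Kt|exact: act_image0].
- by rewrite muln_gt0 cardG_gt0.
- move=> l el; rewrite (transfer_norm (act_image_dual aP el)).
  rewrite -{1}(act_image_fix aP Re ee el) -(gring_actM aP _ (ring_avg M) Re) Me (act_image_fix aP Re ee el).
  by rewrite scalerA -natrM; exact: scaler_nat.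
- move=> l Kl'; have hl := Kd _ Kl'.
  rewrite -[norm_map q _]/(k *: norm_map q (dual_transfer l)) norm_transfer//.
  by rewrite scalerA -natrM; exact: scaler_nat.
Qed.
End Transfer.

(** * Isogeny decomposition *)
Section Assembly.
Variable R : realType.

Lemma jacobian_subtorus (Y : curve R) : jacobian_variety Y = subtorus Y (dual_forms Y).
Proof.
rewrite /subtorus /jacobian_variety; congr (Torus _ _).
by apply/seteqP; split=> [P YP|P []//]; split => //; exact: periods_linear.
Qed.

Lemma qisog_prodA (A B C : torus R) : good_torus A -> good_torus B -> good_torus C ->
  qisog (prod_torus (prod_torus A B) C) (prod_torus A (prod_torus B C)).
Proof.
move=> gA gB gC; split; [by do 2![apply: good_prod => //]|by do 2![apply: good_prod => //]|].
exists (fun v => (v.1.1, (v.1.2, v.2))), (fun v => ((v.1, v.2.1), v.2.2)), 1%N; split => //.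
- split => //= [v [[? ?] ?]|v [[? ?] ?]]; by split.
- split => //= [v [? [? ?]]|v [? [? ?]]]; by split.
- by move=> [[? ?] ?].
- by move=> [? [? ?]].
Qed.

Lemma qisog_prod_right_nested (A B C A' Q : torus R) :
  good_torus A -> good_torus B -> good_torus C -> good_torus A' -> good_torus Q ->
  qisog (prod_torus (prod_torus (prod_torus A B) (prod_torus C A')) Q)
    (prod_torus A (prod_torus B (prod_torus C (prod_torus A' Q)))).
Proof.
move=> gA gB gC gA' gQ.
have [gAB gCA'] := (good_prod gA gB, good_prod gC gA').
have [gCQ gA'Q] := (good_prod gCA' gQ, good_prod gA' gQ).
apply: (qisog_trans (qisog_prodA gAB gCA' gQ)); apply: (qisog_trans (qisog_prodA gA gB gCQ)).
apply: (qisog_prod (qisog_refl gA)); apply: (qisog_prod (qisog_refl gB)).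
exact: qisog_prodA.
Qed.

Section curve.
Variables (D : finGroupType) (X : curve R) (a : D -> X -> X).
Hypothesis aP : faithful_action a.
Local Notation aG := (regular_repr rat [set: D]%G).
Local Notation RG := (group_ring rat [set: D]%G).
Local Notation T := (torus_of a).

Lemma qisog_sign_half x g : (x \in RG)%MS -> x *m x = x -> (g * g = 1)%g ->
  aG g *m x = x *m aG g -> forall c : rat, c * c = 1 ->
  qisog (T x) (prod_torus (T (x *m sign_half g c)) (T (x *m sign_half g (- c)))).
Proof.
move=> Rx xx gg gx c cc.
have cc' : (- c) * (- c) = 1 by rewrite mulrNN.
have Rh d : (sign_half g d \in RG)%MS := ring_half g d.
have hx d : sign_half g d *m x = x *m sign_half g d by exact: sign_half_comm.
have orth d : d * d = 1 -> sign_half g d *m sign_half g (- d) = 0.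
  move=> dd; rewrite {1}/sign_half -scalemxAl mulmxDl mul1mx -scalemxAl sign_half_regl//.
    by rewrite scalerA mulrN dd scaleN1r subrr scaler0.
  by rewrite mulrNN.
have mul d d' : (x *m sign_half g d) *m (x *m sign_half g d') =
    x *m (sign_half g d *m sign_half g d').
  by rewrite -mulmxA [sign_half g d *m (x *m _)]mulmxA hx !mulmxA xx.
have := @qisog_split R D X a aP (x *m sign_half g c) (x *m sign_half g (- c)).
rewrite -mulmxDr sign_halfD mulmx1; apply.
- exact: ringM.
- exact: ringM.
- by rewrite mul sign_halfK.
- by rewrite mul sign_halfK.
- by rewrite mul orth ?mulmx0.
- by rewrite mul -{2}[c]opprK orth ?mulmx0.
Qed.

Section quotients.
Variables (XM XN : curve R) (M N : {group D}) (q : X -> XM) (qN : X -> XN) (f : XM -> XN).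
Hypotheses (qP : is_quotient a M q) (qNP : is_quotient a N qN).
Hypotheses (f_holo : holomorphic_map f) (fq : forall x, f (q x) = qN x).

(** The composite norm is that of [qN]. Its kernel is the kernel of [avg N]: the transfer turns the
    norm into a multiple of [avg N], and the norm does not change when [avg N] is applied first. *)
Lemma norm_kernel_quotient l : dual_forms X l ->
  norm_kernel f (norm_map q l) <-> gring_act a (avg N) l = 0.
Proof.
move=> hl; have q_holo : holomorphic_map q by have [] := qP.
have qN_holo : holomorphic_map qN by have [] := qNP.
have comp w : norm_map f (norm_map q l) w = norm_map qN l w.
  by rewrite /norm_map -(pullback_comp _ q_holo f_holo qN_holo)//; apply/funext.
have k0 : (#|N|%:R : R[i]) != 0 by rewrite pnatr_eq0 -lt0n cardG_gt0.
have actN : norm_map qN (gring_act a (avg N) l) = norm_map qN l.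
  by apply: norm_act_avg => g gN w; exact: (pullback_action_quotient aP qNP).
split=> [[_ h]|h].
  apply: (scalerI k0); rewrite -(transfer_norm aP qNP hl) scaler0.
  by apply/funext => w; rewrite /dual_transfer -comp h.
split=> [|w]; first exact: norm_map_linear.
by rewrite comp -actN h.
Qed.
End quotients.

Lemma norm_kernel0 (Y Z : curve R) (f : Y -> Z) : norm_kernel f 0.
Proof. by split; [exact: dual_forms0|]. Qed.

Lemma norm_kernel_linear (Y Z : curve R) (f : Y -> Z) (c : R[i]) u v :
  norm_kernel f u -> norm_kernel f v -> norm_kernel f (c *: u + v).
Proof.
move=> [hu u0] [hv v0]; split; first by apply: dual_formsD => //; exact: dual_forms_scale.
move=> w; rewrite -[LHS]/(c * norm_map f u w + norm_map f v w) u0 v0.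
by rewrite mulr0 addr0.
Qed.

Lemma avg_mul_sub (M N : {group D}) : M \subset N -> avg M *m avg N = avg N.
Proof.
move=> /fintype.subsetP MN; apply: avg_fix_mul => g /MN; exact: avg_regl.
Qed.
Lemma avg_mul_sup (M N : {group D}) : M \subset N -> avg N *m avg M = avg N.
Proof.
move=> /fintype.subsetP MN; apply: avg_mul_fix => g /MN; exact: avg_regr.
Qed.
Lemma avgK (M : {group D}) : avg M *m avg M = avg M.
Proof. exact: avg_mul_sub. Qed.

Lemma gring_actB x y l : gring_act a (x - y) l = gring_act a x l - gring_act a y l.
Proof. by rewrite gring_actD -scaleN1r gring_actZ rmorphN1 scaleN1r. Qed.

Lemma qisog_jacobian_quotient (M : {group D}) (Y : curve R) (q : X -> Y) :
  is_quotient a M q -> qisog (T (avg M)) (jacobian_variety Y).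
Proof.
move=> qP; rewrite jacobian_subtorus.
apply: (qisog_quotient aP qP (ring_avg M) (avgK M) (avgK M)) => //.
- exact: dual_forms0.
- by move=> c u v hu hv; apply: dual_formsD => //; exact: dual_forms_scale.
- by move=> l hl _; apply: norm_map_linear => //; have [] := qP.
Qed.

Section prym.
Variables (M : {group D}) (XM : curve R) (q : X -> XM).
Hypothesis qP : is_quotient a M q.

Lemma qisog_prym (N : {group D}) (XN : curve R) (qN : X -> XN) (f : XM -> XN) :
  is_quotient a N qN -> holomorphic_map f -> (forall x, f (q x) = qN x) -> M \subset N ->
  qisog (T (avg M - avg N)) (prym f).
Proof.
move=> qNP fh fq MN; rewrite /prym (prym_coverE fh).
have [MavgN avgNM] := (avg_mul_sub MN, avg_mul_sup MN).
apply: (qisog_quotient aP qP).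
- by rewrite ringB ?ring_avg.
- by rewrite mulmxBl !mulmxBr !avgK MavgN avgNM subrr subr0.
- by rewrite mulmxBr avgK MavgN.
- by move=> l [].
- exact: norm_kernel0.
- exact: norm_kernel_linear.
- move=> l hl <-; apply/(norm_kernel_quotient qP qNP fh fq); first exact: gring_act_dual.
  by rewrite -(gring_actM aP) ?ringB ?ring_avg// mulmxBr avgK avgNM subrr gring_act0.
- move=> l hl lM /(norm_kernel_quotient qP qNP fh fq hl) lN.
  by rewrite gring_actB lM lN subr0.
Qed.

(** The idempotent is the product of [avg M - avg N] and [avg M - avg N']. Since the averages
    commute, its image is the part of the image of [avg M] killed by both. *)
Lemma qisog_prym_inter (N N' : {group D}) (XN XN' : curve R) (qN : X -> XN) (qN' : X -> XN')
    (f : XM -> XN) (f' : XM -> XN') :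
  is_quotient a N qN -> is_quotient a N' qN' -> holomorphic_map f -> holomorphic_map f' ->
  (forall x, f (q x) = qN x) -> (forall x, f' (q x) = qN' x) ->
  M \subset N -> M \subset N' -> avg N *m avg N' = avg N' *m avg N ->
  qisog (T (avg M - avg N - avg N' + avg N *m avg N')) (prym_inter f f').
Proof.
move=> qNP qNP' fh fh' fq fq' MN MN' NN'; rewrite /prym_inter (prym_inter_coverE fh fh').
pose e := avg M - avg N - avg N' + avg N *m avg N'; rewrite -/e.
have [[RM RN] RN'] := (ring_avg M, ring_avg N, ring_avg N').
have Re : (e \in RG)%MS by rewrite ringD ?ringB ?ringM.
have Ne : avg N *m e = 0.
  rewrite /e mulmxDr !mulmxBr (avg_mul_sup MN) avgK mulmxA avgK.
  by rewrite subrr sub0r addNr.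
have Ne' : avg N' *m e = 0.
  rewrite /e mulmxDr !mulmxBr (avg_mul_sup MN') avgK NN' mulmxA avgK.
  by rewrite addrAC subrK subrr.
have Me : avg M *m e = e.
  by rewrite /e mulmxDr !mulmxBr avgK mulmxA (avg_mul_sub MN) (avg_mul_sub MN').
apply: (qisog_quotient aP qP) => //.
- by rewrite {1}/e mulmxDl !mulmxBl Me -mulmxA Ne Ne' mulmx0 addr0 !subr0.
- by move=> l [[]].
- by split; exact: norm_kernel0.
- by move=> c u v [? ?] [? ?]; split; exact: norm_kernel_linear.
- move=> l hl <-; have hel := gring_act_dual aP e hl; split.
    by apply/(norm_kernel_quotient qP qNP fh fq) => //; rewrite -(gring_actM aP)// Ne gring_act0.
  by apply/(norm_kernel_quotient qP qNP' fh' fq') => //; rewrite -(gring_actM aP)// Ne' gring_act0.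
- move=> l hl lM [/(norm_kernel_quotient qP qNP fh fq hl) lN].
  move=> /(norm_kernel_quotient qP qNP' fh' fq' hl) lN'.
  by rewrite gring_actD !gring_actB lM lN lN' !subr0 gring_actM// lN' gring_act0r addr0.
Qed.
End prym.

End curve.
End Assembly.

(** * The primitive idempotents as combinations of averages *)

Section IdempotentAverages.
Variables (D : finGroupType) (p : nat) (r s : D).
Hypotheses (p_prime : prime p) (p_gt3 : (3 < p)%N).
Hypothesis D_dihedral : dihedral_presentation (2 * p) r s.
Local Notation G := [set: D]%G.
Local Notation RG := (group_ring rat G).
Local Notation n := (rot2 r).
Local Notation h := (sign_half (r ^+ p)%g).
Local Notation t := (sign_half s).

Lemma sign_half_sub g (x : 'M[rat]_#|G|) : x - x *m sign_half g 1 = x *m sign_half g (-1).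
Proof. by rewrite -{1}[x]mulmx1 -(sign_halfD g 1) mulmxDr addrC addKr. Qed.

Lemma n_h_t c d : n *m t d *m h c = n *m h c *m t d.
Proof. by rewrite -!mulmxA (halfC_comm p_prime D_dihedral) ?ring_half. Qed.

Lemma rotation_component : avg <<[set r]%SET>>%G - avg G = n *m h 1 *m t (-1).
Proof.
by rewrite (avg_rot p_prime p_gt3 D_dihedral) (avg_all p_prime p_gt3 D_dihedral) sign_half_sub.
Qed.

Lemma dihedral_component :
  avg <<[set s; (r ^+ 2)%g]%SET>>%G - avg G = n *m h (-1) *m t 1.
Proof.
rewrite (avg_rot2 p_prime D_dihedral (ss1 D_dihedral)) (avg_all p_prime p_gt3 D_dihedral).
by rewrite -n_h_t sign_half_sub n_h_t.
Qed.

(** The reflection [r ^+ p * s] acts by 1 where [r ^+ p] and [s] have equal signs; removing the part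
    where both are 1 leaves the part where both are -1. *)
Lemma dihedral_component' :
  avg <<[set (r ^+ p * s)%g; (r ^+ 2)%g]%SET>>%G - avg G = n *m h (-1) *m t (-1).
Proof.
rewrite (avg_rot2 p_prime D_dihedral (reflection_sq D_dihedral)).
by rewrite (avg_all p_prime p_gt3 D_dihedral) sign_half_mul mulmxDr !mulmxA addrC addKr.
Qed.

Lemma klein_component :
  avg <<[set 1%g; s; (r ^+ p)%g; (r ^+ p * s)%g]%SET>>%G - avg G = comp_idem p r 1 *m t 1.
Proof.
rewrite (avg_klein p_prime D_dihedral) (avg_all p_prime p_gt3 D_dihedral) comp_idemE.
by rewrite mulmxBl mul1mx mulmxBl.
Qed.

Lemma avg_rot2_klein :
  avg <<[set s; (r ^+ 2)%g]%SET>>%G *m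
    avg <<[set 1%g; s; (r ^+ p)%g; (r ^+ p * s)%g]%SET>>%G = n *m h 1 *m t 1.
Proof.
rewrite (avg_rot2 p_prime D_dihedral (ss1 D_dihedral)) (avg_klein p_prime D_dihedral).
by rewrite mulmxA n_h_t -mulmxA sign_halfK ?(ss1 D_dihedral) ?mulr1.
Qed.

Lemma avg_klein_rot2 :
  avg <<[set 1%g; s; (r ^+ p)%g; (r ^+ p * s)%g]%SET>>%G *m
    avg <<[set s; (r ^+ 2)%g]%SET>>%G = n *m h 1 *m t 1.
Proof.
rewrite (avg_rot2 p_prime D_dihedral (ss1 D_dihedral)) (avg_klein p_prime D_dihedral).
rewrite mulmxA -(n_comm p_prime D_dihedral) ?ringM ?ring_half//.
by rewrite -!mulmxA sign_halfK ?(ss1 D_dihedral) ?mulr1.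
Qed.

(** In terms of the three basic idempotents this is the expansion of [(1 - n) (1 - h 1) t 1], and
    [1 - h 1 = h (-1)]. *)
Lemma reflection_component :
  avg <<[set s]%SET>>%G - avg <<[set s; (r ^+ 2)%g]%SET>>%G
    - avg <<[set 1%g; s; (r ^+ p)%g; (r ^+ p * s)%g]%SET>>%G
    + avg <<[set s; (r ^+ 2)%g]%SET>>%G *m
      avg <<[set 1%g; s; (r ^+ p)%g; (r ^+ p * s)%g]%SET>>%G
  = comp_idem p r (-1) *m t 1.
Proof.
rewrite avg_rot2_klein (avg_refl D_dihedral) (avg_rot2 p_prime D_dihedral (ss1 D_dihedral)).
rewrite (avg_klein p_prime D_dihedral) comp_idemE -sign_half_sub.
by rewrite !mulmxBl !mul1mx opprB addrA addrAC.
Qed.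

End IdempotentAverages.

(** * The splitting of the Jacobian into eight pieces *)

Section JacobianDecomposition.
Variables (R : realType) (D : finGroupType) (p : nat) (r s : D).
Hypotheses (p_prime : prime p) (p_gt3 : (3 < p)%N).
Hypothesis D_dihedral : dihedral_presentation (2 * p) r s.
Variables (X : curve R) (a : D -> X -> X).
Hypothesis aP : faithful_action a.
Local Notation aG := (regular_repr rat [set: D]%G).
Local Notation RG := (group_ring rat [set: D]%G).
Local Notation n := (rot2 r).
Local Notation h := (sign_half (r ^+ p)%g).
Local Notation t := (sign_half s).
Local Notation T := (torus_of a).
Local Notation "A ** B" := (prod_torus A B) (at level 40, left associativity).

Let one1 : 1 * 1 = 1 :> rat. Proof. exact: mulr1. Qed.
Let NN : (-1) * (-1) = 1 :> rat. Proof. by rewrite mulrNN mulr1. Qed.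

Lemma jacobian_decomposition : qisog (jacobian_variety X)
  (T (n *m h 1 *m t 1) ** (T (n *m h 1 *m t (-1)) **
    (T (n *m h (-1) *m t 1) ** (T (n *m h (-1) *m t (-1)) **
    (T (comp_idem p r (-1) *m t 1) ** T (comp_idem p r (-1) *m t (-1)) **
    (T (comp_idem p r 1 *m t 1) ** T (comp_idem p r 1 *m t (-1)))))))).
Proof.
have [[Rn nn] R1] := (ring_rot2 r, rot2K r, ring1 D).
have [ss cc] := (ss1 D_dihedral, CC1 D_dihedral).
have Rn' : (1%:M - n \in RG)%MS by rewrite ringB.
have nn' : (1%:M - n) *m (1%:M - n) = 1%:M - n.
  by rewrite mulmxBl !mulmxBr !mul1mx mulmx1 nn subrr subr0.
have gT e : good_torus (T e) by exact: good_torus_of.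
have step0 : qisog (T 1%:M) (T n ** T (1%:M - n)).
  have := @qisog_split R D X a aP n (1%:M - n); rewrite subrKC; apply => //.
    by rewrite mulmxBr mulmx1 nn subrr.
  by rewrite mulmxBl mul1mx nn subrr.
have stepC x : (x \in RG)%MS -> x *m x = x -> forall c : rat, c * c = 1 ->
    qisog (T x) (T (x *m h c) ** T (x *m h (- c))).
  by move=> Rx xx; apply: (qisog_sign_half aP) => //; exact: (C_comm p_prime D_dihedral).
have nhK c : c * c = 1 -> (n *m h c) *m (n *m h c) = n *m h c.
  move=> c1; rewrite -mulmxA (halfC_comm p_prime D_dihedral) ?ring_nh//.
  by rewrite -[n *m h c *m h c]mulmxA sign_halfK// mulmxA nn.
have stepB x c : (x \in RG)%MS -> x *m x = x -> (forall y, (y \in RG)%MS -> x *m y = y *m x) ->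
    c * c = 1 -> qisog (T x) (T (x *m t c) ** T (x *m t (- c))).
  by move=> Rx xx xC; apply: (qisog_sign_half aP) => //; rewrite xC// ring_reg.
have step_nh c : c * c = 1 -> qisog (T (n *m h c)) (T (n *m h c *m t 1) ** T (n *m h c *m t (-1))).
  move=> c1; apply: stepB; rewrite ?ring_nh ?nhK// => y; exact: (nh_comm p_prime D_dihedral).
have step_comp c : c * c = 1 ->
    qisog (T (comp_idem p r c)) (T (comp_idem p r c *m t 1) ** T (comp_idem p r c *m t (-1))).
  move=> c1; apply: stepB => //; rewrite ?(ring_comp p_prime D_dihedral)//.
    exact: (comp_idemK p_prime D_dihedral).
  by move=> y; exact: (comp_comm p_prime D_dihedral).
rewrite (jacobian_torus_of aP); apply: (qisog_trans step0).
have stepn : qisog (T n) ((T (n *m h 1 *m t 1) ** T (n *m h 1 *m t (-1))) **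
    (T (n *m h (-1) *m t 1) ** T (n *m h (-1) *m t (-1)))).
  by apply: (qisog_trans (stepC _ Rn nn 1 one1)); apply: qisog_prod; apply: step_nh.
have stepn' : qisog (T (1%:M - n)) ((T (comp_idem p r (-1) *m t 1) ** T (comp_idem p r (-1) *m t (-1))) **
    (T (comp_idem p r 1 *m t 1) ** T (comp_idem p r 1 *m t (-1)))).
  (* Taking the sign -1 first puts the pieces of [W5] before those of [W6], in the order of the
     theorem. *)
  apply: (qisog_trans (stepC _ Rn' nn' (-1) NN)).
  by rewrite opprK -!comp_idemE; apply: qisog_prod; apply: step_comp.
apply: (qisog_trans (qisog_prod stepn stepn')).
by apply: qisog_prod_right_nested; do ?apply: good_prod; exact: gT.
Qed.

End JacobianDecomposition.

End Decomposition.
Import Decomposition.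

Local Open Scope ring_scope.

Theorem mainTheorem8 (R : realType) (p : nat) (p_prime : prime p)
  (p_gt3 : (3 < p)%N)
  (D : finGroupType) (r s : D) (D_dihedral : dihedral_presentation (2 * p) r s)
  (X : curve R) (gX : nat) (X_genus : has_genus X gX) (gX_ge2 : (2 <= gX)%N)
  (a : D -> X -> X) (a_action : faithful_action a)
  (* The quotients X/M and the maps X/M -> X/N for M <= N. *)
  (XM : {group D} -> curve R) (q : forall M : {group D}, X -> XM M)
  (q_quotient : forall M : {group D}, is_quotient a M (q M))
  (f : forall M N : {group D}, XM M -> XM N)
  (f_holomorphic : forall M N : {group D}, M \subset N ->
     holomorphic_map (f M N))
  (f_factor : forall M N : {group D}, M \subset N ->
     forall x, f M N (q M x) = q N x)
  (W2 W3 W4 : mx_representation rat [set: D]%G 1)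
  (W2_r : W2 r = 1%:M) (W2_s : W2 s = (-1)%:M)
  (W3_r : W3 r = (-1)%:M) (W3_s : W3 s = 1%:M)
  (W4_r : W4 r = (-1)%:M) (W4_s : W4 s = (-1)%:M)
  (w : R[i]) (w_root : (2 * p).-primitive_root w)
  (n5 : nat) (W5 : mx_representation rat [set: D]%G n5)
  (W5_rational : is_rational_form r s w (p.-1)./2 (fun i => (2 * i).-1) W5)
  (n6 : nat) (W6 : mx_representation rat [set: D]%G n6)
  (W6_rational : is_rational_form r s w (p.-1)./2 (fun i => (2 * i)%N) W6)
  (e2 e3 e4 e5 e6 : 'M[rat]_#|[set: D]%G|)
  (e2_primitive : primitive_idempotent W2 e2)
  (e3_primitive : primitive_idempotent W3 e3)
  (e4_primitive : primitive_idempotent W4 e4)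
  (e5_primitive : primitive_idempotent W5 e5)
  (e6_primitive : primitive_idempotent W6 e6)
  (m2 m3 m4 m5 m6 : nat) (c2 c3 c4 c5 c6 : D -> int)
  (c2_multiple : integral_multiple e2 m2 c2)
  (c3_multiple : integral_multiple e3 m3 c3)
  (c4_multiple : integral_multiple e4 m4 c4)
  (c5_multiple : integral_multiple e5 m5 c5)
  (c6_multiple : integral_multiple e6 m6 c6) :
  let G := [set: D]%G in
  let C_r := <<[set r]>>%G in
  let C_s := <<[set s]>>%G in
  let D_p := <<[set s; (r ^+ 2)%g]>>%G in
  let D_p' := <<[set (r ^+ p * s)%g; (r ^+ 2)%g]>>%G in
  let D_2 := <<[set 1%g; s; (r ^+ p)%g; (r ^+ p * s)%g]>>%G in
  let B2 := group_image a c2 in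
  let B3 := group_image a c3 in
  let B4 := group_image a c4 in
  let B5 := group_image a c5 in
  let B6 := group_image a c6 in
  isogenous (jacobian_variety X)
    (prod_torus (jacobian_variety (XM G))
    (prod_torus B2 (prod_torus B3 (prod_torus B4
    (prod_torus (prod_torus B5 B5) (prod_torus B6 B6)))))) /\
  isogenous B2 (prym (f C_r G)) /\
  isogenous B3 (prym (f D_p G)) /\
  isogenous B4 (prym (f D_p' G)) /\
  isogenous B6 (prym (f D_2 G)) /\
  isogenous B5 (prym_inter (f C_s D_p) (f C_s D_2)).
Proof.
move=> G C_r C_s D_p D_p' D_2 B2 B3 B4 B5 B6.
have NN : (-1) * (-1) = 1 :> rat by rewrite mulrNN mulr1.
have odd_p : odd p := odd_p p_prime p_gt3.
(* For odd [p] the bound on [i] gives [2 i <= p - 1], which keeps the exponents of both families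
   strictly between 0 and [p]. *)
have bound i : (1 <= i <= p.-1./2)%N -> (0 < i /\ 2 * i < p)%N.
  by have := odd_double_half p.-1; lia.
have [b5 s5 j5] : [/\ forall i, (1 <= i <= p.-1./2)%N -> (0 < (2 * i).-1 < p)%N,
    forall i, (1 <= i <= p.-1./2)%N -> (-1) ^+ (2 * i).-1 = -1 :> rat &
    forall i j, (1 <= i <= p.-1./2)%N -> (1 <= j <= p.-1./2)%N ->
      (2 * i).-1 = (2 * j).-1 -> i = j].
  split=> [i /bound|i /bound[i0 _]|i j /bound[i0 _] /bound[j0 _]]; [lia| |lia].
  by rewrite -signr_odd (_ : odd (2 * i).-1 = true)//; lia.
have [b6 s6 j6] : [/\ forall i, (1 <= i <= p.-1./2)%N -> (0 < 2 * i < p)%N,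
    forall i, (1 <= i <= p.-1./2)%N -> (-1) ^+ (2 * i)%N = 1 :> rat &
    forall i j, (1 <= i <= p.-1./2)%N -> (1 <= j <= p.-1./2)%N ->
      (2 * i)%N = (2 * j)%N -> i = j].
  split=> [i /bound|i _|i j _ _]; [lia| |lia].
  by rewrite exprM sqrrN expr1n.
pose T := torus_of a.
have BT e m c : integral_multiple e m c -> group_image a c = T e.
  exact: group_image_torus_of.
have e2E := linear_idempotent p_prime p_gt3 D_dihedral (mulr1 1) NN W2_r W2_s e2_primitive.
have e3E := linear_idempotent p_prime p_gt3 D_dihedral NN (mulr1 1) W3_r W3_s e3_primitive.
have e4E := linear_idempotent p_prime p_gt3 D_dihedral NN NN W4_r W4_s e4_primitive.
have conj5 := rational_form_conj p_prime p_gt3 D_dihedral w_root j5 b5 s5 W5_rational.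
have conj6 := rational_form_conj p_prime p_gt3 D_dihedral w_root j6 b6 s6 W6_rational.
have conje5 := rational_form_idempotent p_prime p_gt3 D_dihedral w_root j5 b5 s5 W5_rational
  e5_primitive.
have conje6 := rational_form_idempotent p_prime p_gt3 D_dihedral w_root j6 b6 s6 W6_rational
  e6_primitive.
have Rf c d : (comp_idem p r c *m sign_half s d \in group_ring rat G)%MS.
  by rewrite ringM ?(ring_comp p_prime D_dihedral) ?ring_half.
have Kf c d : c * c = 1 -> d * d = 1 -> (comp_idem p r c *m sign_half s d) *m
    (comp_idem p r c *m sign_half s d) = comp_idem p r c *m sign_half s d.
  by move=> cc dd; exact: (refl_idemK p_prime D_dihedral).
have [[[R5 _] K5 _ _] [[R6 _] K6 _ _]] := (e5_primitive, e6_primitive).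
have q5 : qisog (T e5) (T (comp_idem p r (-1) *m sign_half s 1)).
  by apply: qisog_conj => //; apply: Kf => //; exact: mulr1.
have q6 : qisog (T e6) (T (comp_idem p r 1 *m sign_half s 1)).
  by apply: qisog_conj => //; apply: Kf => //; exact: mulr1.
(* The pieces with [s = 1] and [s = -1] are both isogenous to [B5]; this is where its square comes
   from, and likewise for [B6]. *)
have q5' : qisog (T e5) (T (comp_idem p r (-1) *m sign_half s (-1))).
  apply: (qisog_trans q5); apply: qisog_conj => //; last exact: conj_idem_sym.
    by apply: Kf => //; exact: mulr1.
  exact: Kf.
have q6' : qisog (T e6) (T (comp_idem p r 1 *m sign_half s (-1))).
  apply: (qisog_trans q6); apply: qisog_conj => //; last exact: conj_idem_sym.
    by apply: Kf => //; exact: mulr1.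
  by apply: Kf => //; exact: mulr1.
have toG (M : {group D}) : M \subset G := finset.subsetT M.
have prymG (M : {group D}) : qisog (T (avg M - avg G)) (prym (f M G)).
  exact: (qisog_prym a_action (q_quotient M) (q_quotient G) (f_holomorphic _ _ (toG M))
    (f_factor _ _ (toG M)) (toG M)).
have iso e B : qisog (T e) B -> isogenous (T e) B.
  by apply: qisog_isogenous; exact: torus_of_finite_quotients.
rewrite /B2 /B3 /B4 /B5 /B6 (BT _ _ _ c2_multiple) (BT _ _ _ c3_multiple).
rewrite (BT _ _ _ c4_multiple) (BT _ _ _ c5_multiple) (BT _ _ _ c6_multiple).
have gT e : good_torus (T e) by exact: good_torus_of.
split.
  have jd := jacobian_decomposition p_prime D_dihedral a_action.
  rewrite (jacobian_torus_of a_action) in jd *; apply: iso; apply: (qisog_trans jd).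
  rewrite -(avg_all p_prime p_gt3 D_dihedral) -e2E -e3E -e4E.
  apply: qisog_prod; first exact: (qisog_jacobian_quotient a_action (q_quotient G)).
  do 3![apply: (qisog_prod (qisog_refl (gT _)))].
  exact: (qisog_prod (qisog_prod (qisog_sym q5) (qisog_sym q5'))
    (qisog_prod (qisog_sym q6) (qisog_sym q6'))).
split.
  by rewrite e2E -(rotation_component p_prime p_gt3 D_dihedral); apply: iso; exact: prymG.
split.
  by rewrite e3E -(dihedral_component p_prime p_gt3 D_dihedral); apply: iso; exact: prymG.
split.
  by rewrite e4E -(dihedral_component' p_prime p_gt3 D_dihedral); apply: iso; exact: prymG.
split.
  apply: iso; apply: (qisog_trans q6).
  by rewrite -(klein_component p_prime p_gt3 D_dihedral); exact: prymG.
apply: iso; apply: (qisog_trans q5); rewrite -(reflection_component p_prime D_dihedral).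
have sub1 : C_s \subset D_p by apply: genS; rewrite finset.sub1set !inE eqxx.
have sub2 : C_s \subset D_2 by apply: genS; rewrite finset.sub1set !inE eqxx !orbT.
apply: (qisog_prym_inter a_action (q_quotient C_s) (q_quotient D_p) (q_quotient D_2)) => //.
- exact: f_holomorphic.
- exact: f_holomorphic.
- by move=> x; exact: f_factor.
- by move=> x; exact: f_factor.
by rewrite (avg_rot2_klein p_prime D_dihedral) (avg_klein_rot2 p_prime D_dihedral).
Qed.
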